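(* Let $\mathscr H$ be a Hilbert space, $\mathcal E$ a parameter set, and $\{H^\pm(p)\}_{p\in\mathcal E}$, $S$, $A$, $\mathscr D\subset\mathscr G\subset\mathscr H$, $\mathscr S$, be as in the context: $H^{\pm}(p)$ are closed operators with common domain $\mathscr D$ independent of $p$, $(H^+(p))^*=H^-(p)$, $H^+(p)$ is dissipative, $S$ is a non-negative injective self-adjoint operator independent of $p$ with form domain $\mathscr G=\mathcal D(S^{1/2})\supset\mathscr D$, and $A$ is self-adjoint with $S\in\mathcal C^1(A)$ such that $W_t=e^{itA}$ satisfies $W_t\mathscr G\subset\mathscr G$ and $W_t\mathscr S\subset\mathscr S$ for all $t\in\mathbb{R}$. Write $H^\pm=H^\pm(p)$. Suppose that $H^\pm\in\mathcal C^2(A;\mathscr G,\mathscr G^* )$ for all $p\in\mathcal E$ and that there is a constant $c$, independent of $p$, such that $$|\langle H^{\mp}f,Ag\rangle-\langle Af,H^{\pm}g\rangle|\leq c\,\|f\|\cdot\|(H^\pm\pm i)g\|\quad\text{for all }f,g\in\mathscr D\cap\mathcal D(A).$$ Let $c_1\geq0$ be independent of $p$ and assume that, in the sense of forms on $\mathscr G$, $$[\operatorname{Re}(H^\pm),iA]_\circ-c_1\operatorname{Re}(H^\pm)\geq S>0,$$ $$\pm c_1[\operatorname{Im}(H^\pm),iA]_\circ\geq0,\qquad\pm\operatorname{Im}(H^\pm)\geq0.$$ Suppose also that there is $C>0$, independent of $p\in\mathcal E$, such that $$\big|\langle f,[[H^\pm,A]_\circ,A]_\circ f\rangle\big|\leq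 C\|S^{1/2}f\|^2\quad\text{for all }f\in\mathscr G.$$ Then there are $c$ and $\mu_0>0$, both independent of $p$, such that $$|\langle f,(H^\pm-\lambda\pm i\mu)^{-1}f\rangle|\leq c\big(\|S^{-1/2}f\|^2+\|S^{-1/2}Af\|^2\big)\leq c\,\|f\|^2_{\mathcal D(A|_{\mathscr S^*})}$$ for all $f\in\mathcal D(A)\cap\mathcal D(S^{-1/2})$ with $Af\in\mathcal D(S^{-1/2})$, all $p\in\mathcal E$, all $\mu\in(0,\mu_0)$, and all $\lambda\geq0$ in the case $c_1>0$, respectively all $\lambda\in\mathbb{R}$ in the case $c_1=0$.
   Context: Setting. $\{H^\pm(p)\}_{p\in\mathcal E}$ are closed, densely defined operators in $\mathscr H$ with $\mathcal D(H^+(p))=\mathcal D(H^-(p))=\mathscr D$ for all $p\in\mathcal E$; $\mathscr D$ carries the graph norm of $H^+(p_0)$ for a fixed $p_0\in\mathcal E$; $(H^+(p))^*=H^-(p)$; and $\operatorname{Im}\langle f,H^+(p)f\rangle\geq0$ for $f\in\mathscr D$. $\operatorname{Re}(H^\pm)=(H^++H^-)/2$ and $\operatorname{Im}(H^\pm)=\pm(H^+-H^-)/(2i)$. $S\geq0$ is self-adjoint and injective (written $S>0$), $\mathscr G=\mathcal D(S^{1/2})$ with graph norm, $\mathscr D\subset\mathscr G$. $\mathscr S$ is the completion of $\mathscr G$ under the norm $\|f\|_{\mathscr S}=\|S^{1/2}f\|$; $\mathscr S^*$ is its anti-dual, whose norm on vectors $f\in\mathcal D(S^{-1/2})\subset\mathscr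 H$ is $\|S^{-1/2}f\|$. $\mathscr H$ is identified with its anti-dual, so $\mathscr D\subset\mathscr G\subset\mathscr H\subset\mathscr G^*\subset\mathscr D^*$. $W_t=e^{itA}$. ''$W_t\mathscr S\subset\mathscr S$'' means that $W_t|_{\mathscr G}$ extends to a bounded operator on $\mathscr S$. $S\in\mathcal C^1(A)$ means $t\mapsto e^{-itA}(S-z)^{-1}e^{itA}$ is strongly $C^1$ for some $z\notin\sigma(S)$. By duality $W_t$ acts as a $C_0$-group in $\mathscr G^*$ and $\mathscr S^*$; $A|_{\mathscr S^*}$ is the generator in $\mathscr S^*$, and $\|f\|^2_{\mathcal D(A|_{\mathscr S^*})}=\|f\|_{\mathscr S^*}^2+\|Af\|_{\mathscr S^*}^2$. $L\in\mathcal C^k(A;\mathscr G,\mathscr G^* )$ means that $L\in\mathcal B(\mathscr G,\mathscr G^* )$ and $t\mapsto W_{-t}LW_t$ is strongly $C^k$ from $\mathscr G$ to $\mathscr G^*$; for $H^\pm$ it is understood that $H^\pm$ extends to an element of $\mathcal B(\mathscr G,\mathscr G^* )$. $[L,A]_\circ\in\mathcal B(\mathscr G,\mathscr G^* )$ is the extension of the form commutator $[L,A]$, and $[[L,A]_\circ,A]_\circ$ the iterated one. *)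

(* Defs.v *)
From mathcomp Require Import all_boot all_order all_algebra.
From mathcomp Require Import all_classical all_reals all_analysis.
From mathcomp Require Export complex sesquilinear.

Set Implicit Arguments.
Unset Strict Implicit.
Unset Printing Implicit Defensive.

Import numFieldNormedType.Exports.
Import Order.TTheory GRing.Theory Num.Theory.
Local Open Scope classical_set_scope.
Local Open Scope ring_scope.
Local Open Scope complex_scope.

(* MathComp forms are linear in the first argument; the inner product used
   here is linear in the second one, so that [f |-> <., f>] embeds a Hilbert
   space in its anti-dual. *)
Definition braket (R : realType) (H : completeNormedModType R[i])
  (ip : {dot H for Num.conj}) (f g : H) : R[i] := ip g f.

Definition hilbert_ip (R : realType) (H : completeNormedModType R[i])
  (ip : {dot H for Num.conj}) : Prop := forall f, `|f| ^+ 2 = braket ip f f.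

Definition subspace (R : realType) (H : lmodType R[i]) (V : set H) : Prop :=
  V 0 /\ forall (a : R[i]) f g, V f -> V g -> V (a *: f + g).

Definition linear_on (R : realType) (H X : lmodType R[i]) (V : set H)
  (T : H -> X) : Prop :=
  forall (a : R[i]) f g, V f -> V g -> T (a *: f + g) = a *: T f + T g.

(* The values of [app] outside [dom] are irrelevant. *)
Record operator (H : Type) := Operator { dom : set H ; app :> H -> H }.

Definition op_eq (H : Type) (T U : operator H) : Prop :=
  dom T = dom U /\ forall f, dom T f -> T f = U f.

Definition op_comp (H : Type) (T U : operator H) : operator H :=
  Operator [set f | dom U f /\ dom T (U f)] (fun f => T (U f)).

Definition op_shift (R : realType) (H : completeNormedModType R[i])
  (T : operator H) (z : R[i]) : operator H :=
  Operator (dom T) (fun f => T f - z *: f).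

Definition op_inv (R : realType) (H : completeNormedModType R[i])
  (T : operator H) : operator H :=
  Operator (T @` dom T) (fun g => xget 0 [set f | dom T f /\ T f = g]).

Definition op_injective (H : Type) (T : operator H) : Prop :=
  forall f g, dom T f -> dom T g -> T f = T g -> f = g.

Definition linear_op (R : realType) (H : completeNormedModType R[i])
  (T : operator H) : Prop := subspace (dom T) /\ linear_on (dom T) T.

Definition closed_op (R : realType) (H : completeNormedModType R[i])
  (T : operator H) : Prop :=
  closed [set u : H * H | dom T u.1 /\ u.2 = T u.1].

Definition adjoint (R : realType) (H : completeNormedModType R[i])
  (ip : {dot H for Num.conj}) (T : operator H) : operator H :=
  let adj g := [set h | forall f, dom T f ->
                          braket ip g (T f) = braket ip h f] in
  Operator [set g | adj g !=set0] (fun g => xget 0 (adj g)).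

Definition selfadjoint (R : realType) (H : completeNormedModType R[i])
  (ip : {dot H for Num.conj}) (T : operator H) : Prop :=
  [/\ linear_op T, dense (dom T) & op_eq (adjoint ip T) T].

Definition nonneg_op (R : realType) (H : completeNormedModType R[i])
  (ip : {dot H for Num.conj}) (T : operator H) : Prop :=
  forall f, dom T f -> 0 <= braket ip f (T f).

Definition is_sqrt_op (R : realType) (H : completeNormedModType R[i])
  (ip : {dot H for Num.conj}) (S T : operator H) : Prop :=
  [/\ selfadjoint ip T, nonneg_op ip T & op_eq (op_comp T T) S].

Definition in_resolvent_set (R : realType) (H : completeNormedModType R[i])
  (T : operator H) (z : R[i]) : Prop :=
  [/\ op_injective (op_shift T z),
      dom (op_inv (op_shift T z)) = setT &
      exists M : R, forall f, `|op_inv (op_shift T z) f| <= M%:C * `|f| ].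

Definition unitary_group (R : realType) (H : completeNormedModType R[i])
  (ip : {dot H for Num.conj}) (W : R -> H -> H) : Prop :=
  [/\ forall t, linear_on setT (W t),
      forall t f g, braket ip (W t f) (W t g) = braket ip f g,
      forall f, W 0 f = f,
      forall s t f, W (s + t) f = W s (W t f) &
      forall f, continuous (fun t => W t f)].

(* [W t = exp(itA)] in the sense of Stone's theorem. *)
Definition generator (R : realType) (H : completeNormedModType R[i])
  (W : R -> H -> H) : operator H :=
  let q f (t : R) := ('i * t%:C)^-1 *: (W t f - f) in
  Operator [set f | cvg (q f t @[t --> 0^'])]
           (fun f => lim (q f t @[t --> 0^'])).

Definition is_exp_itA (R : realType) (H : completeNormedModType R[i])
  (ip : {dot H for Num.conj}) (A : operator H) (W : R -> H -> H) : Prop :=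
  unitary_group ip W /\ op_eq (generator W) A.

Definition C1_curve (R : realType) (H : completeNormedModType R[i])
  (F : R -> H) : Prop :=
  exists2 F' : R -> H,
    forall t, ((h^-1)%:C *: (F (t + h) - F t)) @[h --> 0^'] --> F' t &
    continuous F'.

(* [S \in C^1(A)], where [W t = exp(itA)]. *)
Definition op_C1 (R : realType) (H : completeNormedModType R[i])
  (W : R -> H -> H) (S : operator H) : Prop :=
  exists2 z, in_resolvent_set S z &
    forall f, C1_curve (fun t => W (- t) (op_inv (op_shift S z) (W t f))).

Definition graph_norm (R : realType) (H : completeNormedModType R[i])
  (T : operator H) (f : H) : R[i] := sqrtC (`|f| ^+ 2 + `|T f| ^+ 2).

(* [j : V -> X] exhibits X as the completion of (V, N). *)
Definition is_completion (R : realType) (H X : completeNormedModType R[i])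
  (V : set H) (N : H -> R[i]) (j : H -> X) : Prop :=
  [/\ linear_on V j, forall f, V f -> `|j f| = N f & dense (j @` V)].

Definition extends_boundedly (R : realType) (H X : completeNormedModType R[i])
  (V : set H) (j : H -> X) (U : H -> H) : Prop :=
  exists2 T : {linear X -> X}, continuous T & forall f, V f -> T (j f) = j (U f).

(* Norm of [f], acting by [<., f>], in the anti-dual of the completion of
   (V, N); since V is dense there, the supremum may be taken over V. *)
Definition dual_norm (R : realType) (H : completeNormedModType R[i])
  (ip : {dot H for Num.conj}) (V : set H) (N : H -> R[i]) (f : H) : R :=
  sup [set complex.Re `|braket ip g f| | g in [set g | V g /\ N g <= 1]].

(* Membership in the anti-dual of (V, N); functionals are total functions of
   which only the restriction to V matters. *)
Definition antidual (R : realType) (H : completeNormedModType R[i])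
  (V : set H) (N : H -> R[i]) (phi : H -> R[i]) : Prop :=
  (forall a f g, V f -> V g ->
     phi (a *: f + g) = (a^*)%R * phi f + phi g) /\
  exists M : R, forall g, V g -> `|phi g| <= M%:C * N g.

(* [F] is of class C^k from the real line to the anti-dual of (V, N), for the
   norm topology; |phi g| <= e N g on V means that phi has norm at most e. *)
Fixpoint Ck_antidual (R : realType) (H : completeNormedModType R[i])
  (V : set H) (N : H -> R[i]) (k : nat) (F : R -> H -> R[i]) : Prop :=
  (forall t, antidual V N (F t)) /\
  match k with
  | 0 => forall (t e : R), 0 < e -> \forall s \near t,
           forall g, V g -> `|F s g - F t g| <= e%:C * N g
  | k'.+1 => exists2 F' : R -> H -> R[i],
      forall (t e : R), 0 < e -> \forall h \near 0^', forall g, V g ->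
        `|(h^-1)%:C * (F (t + h) g - F t g) - F' t g| <= e%:C * N g &
      Ck_antidual V N k' F'
  end.

(* An element L of B(V, V^* ), given by the form [L f g = <f, L g>]. *)
Definition bounded_form (R : realType) (H : completeNormedModType R[i])
  (V : set H) (N : H -> R[i]) (L : H -> H -> R[i]) : Prop :=
  [/\ forall a f g1 g2, V f -> V g1 -> V g2 ->
        L f (a *: g1 + g2) = a * L f g1 + L f g2,
      forall a f1 f2 g, V f1 -> V f2 -> V g ->
        L (a *: f1 + f2) g = (a^*)%R * L f1 g + L f2 g &
      exists M : R, forall f g, V f -> V g -> `|L f g| <= M%:C * N f * N g].

(* [L \in C^k(A; V, V^* )], where [W t = exp(itA)] acts on [V^*] as the
   anti-dual of [W (- t)], so that [<f, W_{-t} L W_t g> = L (W_t f) (W_t g)]. *)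
Definition form_Ck (R : realType) (H : completeNormedModType R[i])
  (V : set H) (N : H -> R[i]) (W : R -> H -> H) (k : nat)
  (L : H -> H -> R[i]) : Prop :=
  bounded_form V N L /\
  forall g, V g -> Ck_antidual V N k (fun t f => L (W t f) (W t g)).

Definition is_form_commutator (R : realType) (H : completeNormedModType R[i])
  (V : set H) (N : H -> R[i]) (A : operator H) (L B : H -> H -> R[i]) : Prop :=
  let dA := [set f | [/\ dom A f, V f & V (A f)]] in
  bounded_form V N B /\
  forall f g, dA f -> dA g -> B f g = L f (A g) - L (A f) g.

(* [[L, A]_o]; on V it does not depend on the choice made by [xget], because
   the domain of A in V is dense in V when exp(itA) leaves V invariant. *)
Definition commutator (R : realType) (H : completeNormedModType R[i])
  (V : set H) (N : H -> R[i]) (A : operator H) (L : H -> H -> R[i]) :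
  H -> H -> R[i] :=
  xget (fun _ _ => 0) [set B | is_form_commutator V N A L B].

(* A family indexed by [+] and [-] is indexed by [true] and [false]. *)
Definition pm (R : realType) (s : bool) : R[i] := if s then 1 else -1.

Definition form_Re (R : realType) (H : Type) (h : bool -> H -> H -> R[i]) :
  H -> H -> R[i] := fun f g => (h true f g + h false f g) / 2.

Definition form_Im (R : realType) (H : Type) (h : bool -> H -> H -> R[i])
  (s : bool) : H -> H -> R[i] :=
  fun f g => pm R s * ((h true f g - h false f g) / (2 * 'i)).

(* Main.v *)
From HB Require Import structures.
Require Import Defs.
From mathcomp Require Import all_boot all_order all_algebra.
From mathcomp Require Import all_classical all_reals all_analysis.
From mathcomp Require Import ring lra zify.

Set Implicit Arguments.
Unset Strict Implicit.
Unset Printing Implicit Defensive.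

Import numFieldNormedType.Exports.
Import Order.TTheory GRing.Theory Num.Theory.
Local Open Scope classical_set_scope.
Local Open Scope ring_scope.
Local Open Scope complex_scope.

(** The operator [H - z] is regularised, as a form on the form domain of [S], by
    [h_eps := h - eps B], where [B] is the commutator of [h] with [A]. The
    positivity assumptions give
    [Im (h_eps - z) - c1 eps Re (h_eps - z) >= eps S + mu] for all [eps > 0], so that
    Lax-Milgram yields [u_eps := (h_eps - z)^-1 f], and the form factor
    [F_eps := <f, u_eps>] satisfies [eps |S^(1/2) u_eps|^2 <= (1 + c1) |F_eps|].
    The derivative of [F_eps] is [<v_eps, B u_eps>], where [v_eps] solves the adjoint
    equation. Now [B] is the commutator of [h_eps] with [A] plus [eps] times the
    double commutator; the first part is undone by the virial identity, the second is
    controlled by [S]. Hence [|F_eps'|] is at most a constant times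
    [eps^(-1/2) (|S^(-1/2) f|^2 + |S^(-1/2) A f|^2 + |F_eps|)], a weight that the
    substitution [eps = s^2] removes, and Gronwall's inequality bounds [F_eps]
    uniformly as [eps] tends to [0], where [u_eps] tends to [(H - z)^-1 f]. *)


(** * Inner product spaces *)

(** Three obstacles shape the proof. The vectors [u_eps] lie in the form domain but need not lie in
    the domain of [A], so the commutator of [h_eps] with [A] cannot be expanded on them; the virial
    identity is obtained instead by comparing the equation with its conjugate under [W t] and
    letting t tend to 0. That limit needs control of [W t] on the form domain, where only a bound
    for each single t is given: Baire's theorem makes these bounds locally uniform. In place of
    strong continuity there, convergence in H together with boundedness yields weak convergence in
    the form domain, which bounded functionals respect. Finally, the commutators of the statement
    are chosen among extensions from the domain of [A]; to identify them with derivatives of forms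
    along the group, the vectors f of the form domain with A f again in it must be weakly dense, and
    this comes from resolvents of [A] far out on the imaginary axis. The minus sign needs no second
    run: the resolvent of H^- at the conjugate point is the adjoint of that of H^+. *)

Section ComplexModulus.
Variable R : realType.

Lemma le_of_sqr (a b : R) : 0 <= b -> a ^+ 2 <= b ^+ 2 -> a <= b.
Proof. by move=> b0 ab; apply: contraTT ab; rewrite -!ltNge => ba; nra. Qed.

Implicit Types z w : R[i].

(** Norms on [R[i]] take their values in [R[i]]; this real-valued copy keeps all estimates in the
    ordered field [R], where [lra] and [nra] apply. *)
Definition cmod z : R := complex.Re `|z|.

Lemma conjCE z : (z^*)%R = conjc z. Proof. by []. Qed.

Lemma ReD z w : complex.Re (z + w) = complex.Re z + complex.Re w.
Proof. by case: z w => [a b] [c d]. Qed.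

Lemma ImD z w : complex.Im (z + w) = complex.Im z + complex.Im w.
Proof. by case: z w => [a b] [c d]. Qed.

Lemma ReN z : complex.Re (- z) = - complex.Re z.
Proof. by case: z. Qed.

Lemma ImN z : complex.Im (- z) = - complex.Im z.
Proof. by case: z. Qed.

Lemma ReM z w : complex.Re (z * w) =
  complex.Re z * complex.Re w - complex.Im z * complex.Im w.
Proof. by case: z w => [a b] [c d]. Qed.

Lemma ImM z w : complex.Im (z * w) =
  complex.Re z * complex.Im w + complex.Im z * complex.Re w.
Proof. by case: z w => [a b] [c d]. Qed.

Lemma Reconj z : complex.Re (z^*)%R = complex.Re z.
Proof. by case: z. Qed.

Lemma Imconj z : complex.Im (z^*)%R = - complex.Im z.
Proof. by case: z. Qed.

Lemma complex_ext z w :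
  complex.Re z = complex.Re w -> complex.Im z = complex.Im w -> z = w.
Proof. by case: z w => [a b] [c d] /= -> ->. Qed.

Lemma normcmod z : `|z| = (cmod z)%:C.
Proof. by rewrite /cmod normc_def. Qed.

Lemma cmod_sqr z : cmod z ^+ 2 = complex.Re z ^+ 2 + complex.Im z ^+ 2.
Proof. by rewrite /cmod normc_def /= sqr_sqrtr // addr_ge0 ?sqr_ge0. Qed.

Lemma cmod_ge0 z : 0 <= cmod z.
Proof. by rewrite -ler0c -normcmod. Qed.
Hint Resolve cmod_ge0 : core.

Lemma cmodM z w : cmod (z * w) = cmod z * cmod w.
Proof. by apply: (@complexI R); rewrite rmorphM /= -!normcmod normrM. Qed.

Lemma cmodD z w : cmod (z + w) <= cmod z + cmod w.
Proof. by rewrite -lecR rmorphD /= -!normcmod ler_normD. Qed.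

Lemma cmodN z : cmod (- z) = cmod z.
Proof. by rewrite /cmod normrN. Qed.

Lemma cmodB z w : cmod (z - w) <= cmod z + cmod w.
Proof. by rewrite -(cmodN w) cmodD. Qed.

Lemma cmod_distC z w : cmod (z - w) = cmod (w - z).
Proof. by rewrite -cmodN opprB. Qed.

Lemma cmod_conj z : cmod (z^*)%R = cmod z.
Proof. by rewrite /cmod norm_conjC. Qed.

Lemma cmod_real (r : R) : cmod r%:C = `|r|.
Proof. by rewrite /cmod normc_def /= expr0n addr0 sqrtr_sqr. Qed.

Lemma cmod0 : cmod 0 = 0. Proof. by rewrite /cmod normr0. Qed.

Lemma cmodi : cmod 'i = 1 :> R.
Proof. by rewrite complexiE /cmod normCi. Qed.

Lemma cmod_eq0 z : (cmod z == 0) = (z == 0).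
Proof.
rewrite -(normr_eq0 z) normcmod; apply/eqP/eqP => [->//|].
by move=> /(congr1 (@complex.Re R)).
Qed.

Lemma Re_le_cmod z : `|complex.Re z| <= cmod z.
Proof. by rewrite -lecR -normcmod normc_ge_Re. Qed.

Lemma Re_le_cmod' z : complex.Re z <= cmod z.
Proof. exact: le_trans (ler_norm _) (Re_le_cmod z). Qed.

Lemma Im_le_cmod z : `|complex.Im z| <= cmod z.
Proof.
rewrite -(ler_pXn2r (n := 2)) ?nnegrE //.
by rewrite cmod_sqr real_normK ?num_real // lerDr sqr_ge0.
Qed.

Lemma cmodE2 z : z * (z^*)%R = (cmod z ^+ 2)%:C.
Proof. by rewrite -normCK normcmod -rmorphXn. Qed.

Lemma cmod_phase z : exists2 t : R[i], cmod t = 1 & t * z = (cmod z)%:C.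
Proof.
have [->|z0] := eqVneq z 0.
  exists 1; first by rewrite /cmod normr1.
  by rewrite cmod0 mulr0.
have cz : cmod z != 0 by rewrite cmod_eq0.
exists ((z^*)%R * ((cmod z)^-1)%:C).
  by rewrite cmodM cmod_conj cmod_real ger0_norm ?invr_ge0 // mulfV.
by rewrite mulrAC (mulrC (z^*)%R) cmodE2 -rmorphM /= expr2 mulfK.
Qed.

Lemma ge0_ReIm z : 0 <= z -> 0 <= complex.Re z /\ complex.Im z = 0.
Proof. by rewrite lecE /= => /andP[/eqP-> ->]. Qed.

End ComplexModulus.
#[global] Hint Extern 0 (is_true (@Order.le _ _ _ (cmod _))) => exact: cmod_ge0 : core.

Section InnerProduct.
Variables (R : realType) (E : lmodType R[i]).
Implicit Types (q : E -> E -> R[i]) (x y z : E).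

(** Axioms on a bare module, with neither norm nor topology, so that they apply alike to H and to
    the form domain, whose graph inner product is attached to no normed structure. *)
Record inner_product q : Prop := InnerProduct {
  ip_lin : forall a x y z, q z (a *: x + y) = a * q z x + q z y;
  ip_herm : forall x y, q y x = ((q x y)^*)%R;
  ip_ge0 : forall x, 0 <= q x x;
  ip_def : forall x, q x x = 0 -> x = 0 }.

Definition qnorm q x : R := Num.sqrt (complex.Re (q x x)).

Definition qcomplete q : Prop := forall u : nat -> E,
  (forall e, 0 < e -> exists n, forall m k, (n <= m)%N -> (n <= k)%N ->
     qnorm q (u m - u k) < e) ->
  exists l, forall e, 0 < e -> exists n, forall m, (n <= m)%N ->
     qnorm q (u m - l) < e.

Section Basic.
Variables (q : E -> E -> R[i]) (qP : inner_product q).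
Local Notation N := (qnorm q).

Lemma ipDr z x y : q z (x + y) = q z x + q z y.
Proof. by have := ip_lin qP 1 x y z; rewrite scale1r mul1r. Qed.

Lemma ip0r z : q z 0 = 0.
Proof. by have := ipDr z 0 0; rewrite addr0 => /eqP; rewrite -subr_eq subrr => /eqP. Qed.

Lemma ipZr a z x : q z (a *: x) = a * q z x.
Proof. by have := ip_lin qP a x 0 z; rewrite ip0r !addr0. Qed.

Lemma ipNr z x : q z (- x) = - q z x.
Proof. by rewrite -scaleN1r ipZr mulN1r. Qed.

Lemma ipBr z x y : q z (x - y) = q z x - q z y.
Proof. by rewrite ipDr ipNr. Qed.

Lemma ipDl z x y : q (x + y) z = q x z + q y z.
Proof. by rewrite !(ip_herm qP z) ipDr rmorphD. Qed.

Lemma ipZl a z x : q (a *: x) z = (a^*)%R * q x z.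
Proof. by rewrite !(ip_herm qP z) ipZr rmorphM. Qed.

Lemma ip0l z : q 0 z = 0.
Proof. by rewrite (ip_herm qP z) ip0r rmorph0. Qed.

Lemma ipNl z x : q (- x) z = - q x z.
Proof. by rewrite !(ip_herm qP z) ipNr rmorphN. Qed.

Lemma ipBl z x y : q (x - y) z = q x z - q y z.
Proof. by rewrite ipDl ipNl. Qed.

Lemma qnorm_ge0 x : 0 <= N x.
Proof. exact: sqrtr_ge0. Qed.
Hint Resolve qnorm_ge0 : core.

Lemma qnorm_sqr x : q x x = (N x ^+ 2)%:C.
Proof.
have /ge0_ReIm[r0 i0] := ip_ge0 qP x.
by apply: complex_ext => //=; rewrite sqr_sqrtr.
Qed.

Lemma qnorm0 : N 0 = 0.
Proof. by rewrite /qnorm ip0r sqrtr0. Qed.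

Lemma qnorm_eq0 x : N x = 0 -> x = 0.
Proof. by move=> x0; apply: (ip_def qP); rewrite qnorm_sqr x0 expr0n. Qed.

Lemma qnormZ a x : N (a *: x) = cmod a * N x.
Proof.
have h : N (a *: x) ^+ 2 = (cmod a * N x) ^+ 2.
  apply: (@complexI R).
  rewrite -qnorm_sqr ipZl ipZr mulrA (mulrC (a^*)%R) cmodE2 qnorm_sqr.
  by rewrite -rmorphM exprMn.
by apply/eqP; rewrite -(@eqrXn2 _ 2) ?h //; apply: mulr_ge0.
Qed.

Lemma qnormN x : N (- x) = N x.
Proof. by rewrite /qnorm ipNl ipNr opprK. Qed.

Lemma qnormBC x y : N (x - y) = N (y - x).
Proof. by rewrite -qnormN opprB. Qed.

Lemma qnormD_sqr x y :
  N (x + y) ^+ 2 = N x ^+ 2 + N y ^+ 2 + 2 * complex.Re (q x y).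
Proof.
have: q (x + y) (x + y) = q x x + q y y + (q x y + (q x y)^*)%R.
  by rewrite ipDl !ipDr -(ip_herm qP x y); ring.
move=> /(congr1 (@complex.Re R)).
by rewrite !qnorm_sqr !ReD Reconj /= => ->; ring.
Qed.

Lemma qnormB_sqr x y :
  N (x - y) ^+ 2 = N x ^+ 2 + N y ^+ 2 - 2 * complex.Re (q x y).
Proof. by rewrite qnormD_sqr qnormN ipNr ReN mulrN. Qed.

Lemma cauchy_schwarz x y : cmod (q x y) <= N x * N y.
Proof.
have [->|y0] := eqVneq y 0; first by rewrite ip0r cmod0 mulr_ge0.
have Ny : 0 < N y.
  by rewrite lt_neqAle qnorm_ge0 andbT eq_sym; apply: contra_neq y0 => /qnorm_eq0.
have := sqr_ge0 (N ((N y ^+ 2)%:C *: x - q y x *: y)).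
rewrite qnormB_sqr !qnormZ ipZl ipZr conjCE conjc_real.
rewrite (ip_herm qP x y) cmod_conj !cmod_real (mulrC (q x y)^*%R) cmodE2.
rewrite -rmorphM /= ger0_norm ?sqr_ge0 // => h.
apply: le_of_sqr; first exact: mulr_ge0.
rewrite -(ler_pM2l (exprn_gt0 2 Ny)); move: h.
by rewrite -subr_ge0 => h; nra.
Qed.

Lemma qnormD x y : N (x + y) <= N x + N y.
Proof.
apply: le_of_sqr; first exact: addr_ge0.
rewrite qnormD_sqr; have := le_trans (Re_le_cmod' (q x y)) (cauchy_schwarz x y); nra.
Qed.

Lemma qnormB x y : N (x - y) <= N x + N y.
Proof. by rewrite -(qnormN y) qnormD. Qed.

Lemma qnorm_dist x y z : N (x - z) <= N (x - y) + N (y - z).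
Proof. by have := qnormD (x - y) (y - z); rewrite addrA subrK. Qed.

Lemma parallelogram x y :
  N (x - y) ^+ 2 = 2 * N x ^+ 2 + 2 * N y ^+ 2 - N (x + y) ^+ 2.
Proof. by rewrite qnormB_sqr qnormD_sqr; ring. Qed.

End Basic.
End InnerProduct.
#[global] Hint Extern 0 (is_true (@Order.le _ _ _ (qnorm _ _))) => exact: qnorm_ge0 : core.

Section RealHelpers.
Variable R : realType.

Lemma natSinv_small (e : R) : 0 < e ->
  exists n, forall m, (n <= m)%N -> m.+1%:R^-1 < e.
Proof.
move=> e0; have [n _ H] := near_infty_natSinv_lt (PosNum e0).
by exists n => m nm; apply: H.
Qed.

Lemma ReRM (r : R) (z : R[i]) : complex.Re (r%:C * z) = r * complex.Re z.
Proof. by rewrite ReM /= mul0r subr0. Qed.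

(** Minimality of the distance tested at a competitor shifted by K^-1 b along w, with c = |b|, d the
    infimum and P the squared distance of an almost-minimiser. Taking K = |w|^2 + 1 instead of |w|^2
    includes the case w = 0. *)
Lemma proj_aux (K Nw c d t P : R) : 0 < K -> Nw ^+ 2 = K - 1 ->
  d <= P + (K^-1 * c * Nw) ^+ 2 - 2 * (K^-1 * c ^+ 2) -> P < d + t ->
  c ^+ 2 <= K * t.
Proof.
move=> K0 NK h1 h2; have KK : K^-1 * K = 1 by rewrite mulVf // gt_eqF.
have -> : c ^+ 2 = K * (K^-1 * c ^+ 2) by rewrite mulrA mulfV ?mul1r // gt_eqF.
rewrite ler_pM2l //; move: h1; rewrite !exprMn NK.
have -> : K^-1 ^+ 2 * c ^+ 2 * (K - 1) =
  (K^-1 * K) * (K^-1 * c ^+ 2) - (K^-1 * c) ^+ 2 by ring.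
rewrite KK; have := sqr_ge0 (K^-1 * c); move: (K^-1) (K^-1 * c ^+ 2) => k kc.
lra.
Qed.

Lemma lt_of_sqr (a b : R) : 0 <= b -> a ^+ 2 < b ^+ 2 -> a < b.
Proof. by move=> b0 ab; apply: contraTT ab; rewrite -!leNgt => ba; nra. Qed.

Lemma le0_eps (a : R) : (forall e, 0 < e -> a <= e) -> a <= 0.
Proof. by move=> H; apply/ler_addgt0Pr => e e0; rewrite add0r; apply: H. Qed.

Lemma cmod_eps (z : R[i]) : (forall e : R, 0 < e -> cmod z <= e) -> z = 0.
Proof.
move=> /le0_eps H; apply/eqP; rewrite -cmod_eq0 eq_le H /=.
exact: cmod_ge0.
Qed.

Lemma qnorm_eps (E : lmodType R[i]) (q : E -> E -> R[i]) (x : E) :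
  inner_product q -> (forall e : R, 0 < e -> qnorm q x <= e) -> x = 0.
Proof.
move=> qP /le0_eps H; apply: (qnorm_eq0 qP); apply/eqP.
by rewrite eq_le H /= qnorm_ge0.
Qed.

End RealHelpers.

Definition qcvg (R : realType) (E : lmodType R[i]) (q : E -> E -> R[i])
  (u : nat -> E) (l : E) : Prop :=
  forall e, 0 < e -> exists n, forall m, (n <= m)%N -> qnorm q (u m - l) < e.

(** * Orthogonal projection, Riesz representation and surjectivity *)

Section Projection.
Variables (R : realType) (E : lmodType R[i]) (q : E -> E -> R[i]).
Hypotheses (qP : inner_product q) (qC : qcomplete q).
Local Notation N := (qnorm q).

(* [V] need not be closed: the projection lies in its closure. *)
Lemma projection (V : set E) (x : E) : Defs.subspace V ->
  exists y, (forall e, 0 < e -> exists2 v, V v & N (y - v) < e) /\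
    forall v, V v -> q v (x - y) = 0.
Proof.
move=> [V0 VL]; pose D := [set N (x - v) ^+ 2 | v in V].
have D_lb : lbound D 0 by move=> _ [v _ <-]; exact: sqr_ge0.
have D_inf : has_inf D by split; [exists (N (x - 0) ^+ 2), 0|exists 0].
pose d := inf D.
have hd v : V v -> d <= N (x - v) ^+ 2.
  by move=> Vv; apply: ge_inf; [exists 0|exists v].
have /choice[v hv] : forall n, exists v, V v /\ N (x - v) ^+ 2 < d + n.+1%:R^-1.
  move=> n; have n0 : 0 < n.+1%:R^-1 :> R by rewrite invr_gt0.
  by have [_ [v Vv <-] ?] := inf_adherent n0 D_inf; exists v.
have cau m n : N (v m - v n) ^+ 2 <= 2 * m.+1%:R^-1 + 2 * n.+1%:R^-1.
  have [[Vm hm] [Vn hn]] := (hv m, hv n).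
  have -> : v m - v n = (x - v n) - (x - v m).
    by rewrite opprB [RHS]addrC addrA subrK.
  rewrite (parallelogram qP).
  have Vw : V ((2^-1 : R[i]) *: v n + (2^-1 : R[i]) *: v m).
    by apply: (VL) => //; rewrite -[_ *: _]addr0; apply: (VL).
  have -> : x - v n + (x - v m) =
      (2 : R)%:C *: (x - ((2^-1 : R[i]) *: v n + (2^-1 : R[i]) *: v m)).
    rewrite scalerBr scalerDr !scalerA rmorph_nat mulfV ?pnatr_eq0 // !scale1r.
    by rewrite scaler_nat mulr2n opprD addrACA.
  rewrite (qnormZ qP) cmod_real ger0_norm //.
  rewrite exprMn; have := hd _ Vw; move: hm hn.
  by move: (m.+1%:R^-1) (n.+1%:R^-1) => im in_; lra.
have /qC[y hy] : forall e, 0 < e -> exists n, forall m k, (n <= m)%N ->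
    (n <= k)%N -> N (v m - v k) < e.
  move=> e e0; have e4 : 0 < e ^+ 2 / 4 by rewrite divr_gt0 ?exprn_gt0.
  have [n hn] := natSinv_small e4; exists n => m k nm nk.
  have := hn _ nm; have := hn _ nk; have := cau m k.
  move: (m.+1%:R^-1) (k.+1%:R^-1) => im ik c hk hm.
  by apply: lt_of_sqr; [exact: ltW|lra].
exists y; split => [e e0|w Vw].
  have [n hn] := hy _ e0; exists (v n); first by case: (hv n).
  by rewrite (qnormBC qP) hn.
apply: cmod_eps => e e0.
pose K := N w ^+ 2 + 1.
have K0 : 0 < K by rewrite ltr_wpDl ?sqr_ge0.
have bnd n : cmod (q w (x - v n)) ^+ 2 <= K * n.+1%:R^-1.
  have [Vn hn] := hv n; set b := q w (x - v n).
  have Vp : V (((K^-1)%:C * b) *: w + v n) by apply: VL.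
  have := hd _ Vp.
  have -> : x - (((K^-1)%:C * b) *: w + v n) = (x - v n) - ((K^-1)%:C * b) *: w.
    by rewrite opprD addrCA addrC.
  rewrite (qnormB_sqr qP) (ipZr qP) (qnormZ qP) (ip_herm qP w) -/b.
  rewrite -mulrA cmodE2 cmodM cmod_real ger0_norm ?invr_ge0 ?(ltW K0) //.
  rewrite ReRM /= => h; apply: (proj_aux K0 _ h hn).
  by rewrite /K addrK.
have e2 : 0 < e ^+ 2 / (4 * K) by rewrite divr_gt0 ?exprn_gt0 ?mulr_gt0.
have [n1 h1] := natSinv_small e2.
have e3 : 0 < e / (2 * K) by rewrite divr_gt0 ?mulr_gt0.
have [n2 h2] := hy _ e3.
pose n := maxn n1 n2.
have -> : q w (x - y) = q w (x - v n) + q w (v n - y).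
  by rewrite -(ipDr qP) addrA subrK.
have A1 : cmod (q w (x - v n)) <= e / 2.
  apply: le_of_sqr; first by rewrite divr_ge0 ?ltW.
  apply: le_trans (bnd n) _.
  have := h1 n (leq_maxl _ _); move: (n.+1%:R^-1) => t ht.
  apply: le_trans (ler_wpM2l (ltW K0) (ltW ht)) _.
  suff -> : K * (e ^+ 2 / (4 * K)) = (e / 2) ^+ 2 by [].
  by field; rewrite gt_eqF.
have A2 : cmod (q w (v n - y)) <= e / 2.
  apply: le_trans (cauchy_schwarz qP _ _) _.
  have := h2 n (leq_maxr _ _) => /ltW h.
  have NwK : N w <= K.
    have := sqr_ge0 (N w - 2^-1); rewrite /K; have := qnorm_ge0 q w; nra.
  apply: le_trans (ler_wpM2l (qnorm_ge0 _ _) h) _.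
  have : N w * (e / (2 * K)) <= K * (e / (2 * K)).
    by rewrite ler_wpM2r // ltW.
  move=> h'; apply: le_trans h' _.
  suff -> : K * (e / (2 * K)) = e / 2 by [].
  by field; rewrite gt_eqF.
by apply: le_trans (cmodD _ _) _; lra.
Qed.

(** The usual argument on the orthogonal complement of the kernel, carried out along a map [io]
    whose range need not be closed. With [io] the inclusion of the form domain, a functional on it
    that is continuous for the norm of H is represented by a vector of H. *)
Lemma riesz_along (V : lmodType R[i]) (io : V -> E) (phi : V -> R[i]) (M : R) :
  (forall a x y, io (a *: x + y) = a *: io x + io y) ->
  (forall a x y, phi (a *: x + y) = (a^*)%R * phi x + phi y) ->
  (forall x, cmod (phi x) <= M * N (io x)) ->
  exists w, forall x, phi x = q (io x) w.
Proof.
move=> ioL phiL phiM.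
have phi0 : phi 0 = 0.
  have := phiL 1 0 0; rewrite scaler0 addr0 rmorph1 mul1r => /eqP.
  by rewrite -subr_eq0 opprD addrA subrr sub0r oppr_eq0 => /eqP.
have io0 : io 0 = 0.
  have := ioL 1 0 0; rewrite scaler0 addr0 scale1r => /eqP.
  by rewrite -subr_eq0 opprD addrA subrr sub0r oppr_eq0 => /eqP.
have sub x y a : io (x - a *: y) = io x - a *: io y /\
    phi (x - a *: y) = phi x - (a^*)%R * phi y.
  have -> : x - a *: y = (- a) *: y + x by rewrite scaleNr addrC.
  by rewrite ioL phiL scaleNr rmorphN mulNr; split; exact: addrC.
have [allK|/existsNP[x0 /eqP x0P]] := pselect (forall x, phi x = 0).
  by exists 0 => x; rewrite allK (ip0r qP).
have sV : Defs.subspace (io @` [set x | phi x = 0]).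
  split; first by exists 0.
  move=> a _ _ [x /= hx <-] [y /= hy <-]; exists (a *: x + y) => //=.
  by rewrite phiL hx hy mulr0 addr0.
have [y [yV yP]] := projection (io x0) sV; pose p := io x0 - y.
have qyp : q y p = 0.
  apply: cmod_eps => e e0; have Np : 0 < N p + 1 by rewrite ltr_wpDl.
  have [v Vv hv] := yV (e / (N p + 1)) (divr_gt0 e0 Np).
  have -> : q y p = q (y - v) p by rewrite (ipBl qP) (yP _ Vv) subr0.
  apply: le_trans (cauchy_schwarz qP _ _) _.
  move: hv; rewrite ltr_pdivlMr // => hv.
  by have := qnorm_ge0 q (y - v); nra.
(* If p vanished, [io x0] would be a limit of images of kernel vectors, and the bound on [phi] by
   [N (io x)] would force [phi x0 = 0]. *)
have pp : q p p != 0.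
  apply/eqP => /(ip_def qP)/subr0_eq p0; case/eqP: x0P.
  apply: cmod_eps => e e0; have M0 : 0 < `|M| + 1 by rewrite ltr_wpDl.
  have [_ [v /= Vv <-] hv] := yV (e / (`|M| + 1)) (divr_gt0 e0 M0).
  move: hv; rewrite -p0; have [] := sub x0 v 1.
  rewrite !scale1r rmorph1 mul1r Vv subr0 => <- <-.
  rewrite ltr_pdivlMr // => hv; apply: le_trans (phiM _) _.
  by have := ler_norm M; have := qnorm_ge0 q (io (x0 - v)); nra.
exists ((phi x0 / q p p) *: p) => x; rewrite (ipZr qP).
pose a := ((phi x / phi x0)^*)%R.
have [h1 h2] := sub x x0 a.
have /yP : (io @` [set x | phi x = 0]) (io (x - a *: x0)).
  by exists (x - a *: x0) => //=; rewrite h2 conjCK divfK // subrr.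
rewrite h1 (ipBl qP) (ipZl qP) conjCK => /eqP; rewrite subr_eq0 => /eqP->.
have -> : q (io x0) (io x0 - y) = q p p.
  by rewrite -[in LHS](subrK y (io x0)) -/p (ipDl qP) addrK qyp addr0.
by field; rewrite pp x0P.
Qed.

Lemma riesz (phi : E -> R[i]) (M : R) :
  (forall a x y, phi (a *: x + y) = (a^*)%R * phi x + phi y) ->
  (forall x, cmod (phi x) <= M * N x) ->
  exists w, forall x, phi x = q x w.
Proof. exact: (riesz_along (io := id)). Qed.

Lemma dense_of_perp0 (V : set E) : Defs.subspace V ->
  (forall x, (forall v, V v -> q v x = 0) -> x = 0) ->
  forall x e, 0 < e -> exists2 v, V v & N (x - v) < e.
Proof.
move=> sV VP x e e0; have [y [yV yP]] := projection x sV.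
by have /subr0_eq -> := VP _ yP; exact: yV.
Qed.

End Projection.

Section Onto.
Variables (R : realType) (E F : lmodType R[i]).
Variables (q : E -> E -> R[i]) (r : F -> F -> R[i]).
Hypotheses (qP : inner_product q) (qC : qcomplete q).
Hypotheses (rP : inner_product r) (rC : qcomplete r).

(** The lower bound and closedness make the range closed, and triviality of its orthogonal
    complement makes it dense. This one criterion serves Lax-Milgram, the resolvent of [A] and the
    resolvent of a dissipative operator. *)
Lemma onto (Dm : set E) (B : E -> F) (alpha : R) :
  Defs.subspace Dm -> linear_on Dm B -> 0 < alpha ->
  (forall u l w, (forall n, Dm (u n)) -> qcvg q u l ->
     qcvg r (B \o u) w -> Dm l /\ B l = w) ->
  (forall x, Dm x -> alpha * qnorm q x <= qnorm r (B x)) ->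
  (forall w, (forall x, Dm x -> r (B x) w = 0) -> w = 0) ->
  forall w, exists2 x, Dm x & B x = w.
Proof.
move=> [D0 DL] BL a0 Bcl Blow Bperp w.
have sV : Defs.subspace (B @` Dm).
  split; first exists 0 => //.
    have := BL (-1) 0 0 D0 D0; rewrite scaler0 addr0 scaleN1r => h.
    by rewrite {1}h addNr.
  by move=> a _ _ [x Dx <-] [y Dy <-]; exists (a *: x + y); [exact: DL|exact: BL].
have BB x y : Dm x -> Dm y -> Dm (y - x) /\ B (y - x) = B y - B x.
  move=> Dx Dy; split; first by rewrite -scaleN1r addrC; apply: DL.
  by rewrite addrC -scaleN1r BL // scaleN1r addrC.
have Bp v : (forall y, (B @` Dm) y -> r y v = 0) -> v = 0.
  by move=> H; apply: Bperp => x Dx; apply: H; exists x.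
have /choice[u hu] : forall n, exists u, Dm u /\ qnorm r (w - B u) < n.+1%:R^-1.
  move=> n; have n0 : 0 < n.+1%:R^-1 :> R by rewrite invr_gt0.
  by have [_ [x Dx <-] ?] := dense_of_perp0 rP rC sV Bp w n0; exists x.
have cw : qcvg r (B \o u) w.
  move=> e /natSinv_small[n hn]; exists n => m /hn; apply: le_lt_trans.
  by rewrite (qnormBC rP) ltW //; case: (hu m).
have [|l hl] := @qC u.
  move=> e e0; have ea : 0 < alpha * e / 2 by rewrite divr_gt0 ?mulr_gt0.
  have [n hn] := cw _ ea; exists n => m k /hn hm /hn hk.
  have [[Dk _] [Dmm _]] := (hu k, hu m).
  have [Db Bb] := BB _ _ Dk Dmm.
  rewrite -(ltr_pM2l a0); apply: le_lt_trans (Blow _ Db) _; rewrite Bb.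
  apply: le_lt_trans (qnorm_dist rP _ w _) _.
  by rewrite (qnormBC rP w); move: hm hk => /=; lra.
have [Dl Bl] := Bcl u l w (fun n => proj1 (hu n)) hl cw.
by exists l.
Qed.

End Onto.

(** * Bounded sesquilinear forms: Lax-Milgram and uniform boundedness *)

Definition sesqui (R : realType) (E : lmodType R[i]) (L : E -> E -> R[i]) :=
  (forall a x y z, L z (a *: x + y) = a * L z x + L z y) /\
  (forall a x y z, L (a *: x + y) z = (a^*)%R * L x z + L y z).

Definition bform (R : realType) (E : lmodType R[i]) (q : E -> E -> R[i])
  (L : E -> E -> R[i]) :=
  sesqui L /\
  exists M : R, forall x y, cmod (L x y) <= M * qnorm q x * qnorm q y.

Section Forms.
Variables (R : realType) (E : lmodType R[i]) (q : E -> E -> R[i]).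
Hypotheses (qP : inner_product q) (qC : qcomplete q).
Local Notation N := (qnorm q).

Section Sesqui.
Variables (L : E -> E -> R[i]) (Ls : sesqui L).

Lemma sesqDr z x y : L z (x + y) = L z x + L z y.
Proof. by have := Ls.1 1 x y z; rewrite scale1r mul1r. Qed.

Lemma sesqDl z x y : L (x + y) z = L x z + L y z.
Proof. by have := Ls.2 1 x y z; rewrite scale1r rmorph1 mul1r. Qed.

Lemma sesq0r z : L z 0 = 0.
Proof. by have := sesqDr z 0 0; rewrite addr0 => /eqP; rewrite -subr_eq subrr => /eqP. Qed.

Lemma sesq0l z : L 0 z = 0.
Proof. by have := sesqDl z 0 0; rewrite addr0 => /eqP; rewrite -subr_eq subrr => /eqP. Qed.

Lemma sesqZr a z x : L z (a *: x) = a * L z x.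
Proof. by have := Ls.1 a x 0 z; rewrite sesq0r !addr0. Qed.

Lemma sesqZl a z x : L (a *: x) z = (a^*)%R * L x z.
Proof. by have := Ls.2 a x 0 z; rewrite sesq0l !addr0. Qed.

Lemma sesqNr z x : L z (- x) = - L z x.
Proof. by rewrite -scaleN1r sesqZr mulN1r. Qed.

Lemma sesqNl z x : L (- x) z = - L x z.
Proof. by rewrite -scaleN1r sesqZl rmorphN rmorph1 mulN1r. Qed.

Lemma sesqBr z x y : L z (x - y) = L z x - L z y.
Proof. by rewrite sesqDr sesqNr. Qed.

Lemma sesqBl z x y : L (x - y) z = L x z - L y z.
Proof. by rewrite sesqDl sesqNl. Qed.

End Sesqui.

Lemma bform_bound (L : E -> E -> R[i]) : bform q L ->
  exists2 M : R, 0 < M & forall x y, cmod (L x y) <= M * N x * N y.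
Proof.
move=> [_ [M hM]]; exists (`|M| + 1); first by rewrite ltr_wpDl.
move=> x y; apply: le_trans (hM x y) _; rewrite -!mulrA.
apply: ler_wpM2r; first exact: mulr_ge0.
by have := ler_norm M; lra.
Qed.

(** Riesz turns [L] into an operator [B] with [L x u = q x (B u)], and coercivity bounds [B] below
    and makes its cokernel trivial. The multiplier [theta] is there because the regularised form is
    coercive only after a rotation; [cmod theta + 1] avoids a case distinction on [theta = 0]. *)
Lemma lax_milgram (L : E -> E -> R[i]) (theta : R[i]) (alpha : R) :
  bform q L -> 0 < alpha ->
  (forall x, alpha * N x ^+ 2 <= complex.Re (theta * L x x)) ->
  forall (phi : E -> R[i]) (M : R),
  (forall a x y, phi (a *: x + y) = (a^*)%R * phi x + phi y) ->
  (forall x, cmod (phi x) <= M * N x) ->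
  exists u, forall x, L x u = phi x.
Proof.
move=> LB a0 Lco phi M phiL phiM.
have [K K0 hK] := bform_bound LB; have [Ls _] := LB.
have /choice[B hB] : forall u, exists w, forall x, L x u = q x w.
  move=> u; apply: (@riesz _ _ _ qP qC (L^~ u) (K * N u)).
    by move=> a x y; exact: Ls.2.
  by move=> x; rewrite mulrAC.
have [w hw] := riesz qP qC phiL phiM.
have ext x y : (forall z, q z x = q z y) -> x = y.
  move=> H; apply/eqP; rewrite -subr_eq0; apply/eqP/(ip_def qP).
  by rewrite (ipBr qP) H subrr.
have BL : linear_on setT B.
  move=> a x y _ _; apply: ext => z.
  by rewrite -hB (ip_lin qP) -!hB Ls.1.
have Bbd x : N (B x) <= K * N x.
  have [->|Bx0] := eqVneq (N (B x)) 0; first by rewrite mulr_ge0 // ltW.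
  have Bx : 0 < N (B x) by rewrite lt_neqAle eq_sym Bx0 qnorm_ge0.
  rewrite -(ler_pM2l Bx) -expr2; have := hK (B x) x.
  by rewrite hB qnorm_sqr // cmod_real ger0_norm ?sqr_ge0 // mulrCA mulrA.
have th0 : 0 < cmod theta + 1 by rewrite ltr_wpDl // cmod_ge0.
have Blow x : alpha / (cmod theta + 1) * N x <= N (B x).
  have [->|x0] := eqVneq (N x) 0; first by rewrite mulr0 qnorm_ge0.
  have Nx : 0 < N x by rewrite lt_neqAle eq_sym x0 qnorm_ge0.
  rewrite mulrAC ler_pdivrMr // -(ler_pM2l Nx).
  have h1 := Lco x; have h2 := Re_le_cmod' (theta * L x x).
  move: h2; rewrite hB cmodM => h2; have h3 := cauchy_schwarz qP x (B x).
  have h4 := ler_wpM2l (cmod_ge0 theta) h3.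
  have h5 := mulr_ge0 (qnorm_ge0 q x) (qnorm_ge0 q (B x)).
  by move: h1; rewrite hB; lra.
have al0 : 0 < alpha / (cmod theta + 1) by rewrite divr_gt0.
have [|||v hv|u _ Bu] :=
    onto qC qP qC (Dm := setT) _ BL al0 _ _ _ w; [by []| |by move=> x _; exact: Blow| |].
- move=> u l v _ ul Bv; split=> //.
  apply/eqP; rewrite -subr_eq0; apply/eqP/(qnorm_eps qP) => e e0.
  have K1 : 0 < K + 1 by lra.
  have e2 : 0 < e / 2 / (K + 1) by rewrite !divr_gt0.
  have e3 : 0 < e / 2 by rewrite divr_gt0.
  have [n1 h1] := ul _ e2; have [n2 h2] := Bv _ e3.
  pose n := maxn n1 n2.
  have /= := h2 n (leq_maxr _ _) => hb.
  have := h1 n (leq_maxl _ _); rewrite ltr_pdivlMr // => ha.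
  apply: le_trans (qnorm_dist qP _ (B (u n)) _) _.
  have -> : B l - B (u n) = B (l - u n).
    by rewrite -scaleN1r addrC -BL // addrC scaleN1r.
  have hc := Bbd (l - u n); move: hc; rewrite (qnormBC qP l).
  by have := qnorm_ge0 q (u n - l); nra.
- have := hv v I; rewrite (ip_herm qP) -hB => /eqP.
  rewrite fmorph_eq0 => /eqP Lv.
  have := Lco v; rewrite Lv mulr0 /= => h.
  apply: (qnorm_eq0 qP); apply/eqP; rewrite -(@sqrf_eq0 R).
  by apply/eqP/le_anti; rewrite sqr_ge0 andbT -(ler_pM2l a0) mulr0.
- by exists u => x; rewrite hB Bu hw.
Qed.

(* Gliding hump: [L x y = q x (T y)], and [x] is built as the sum of the
   vectors [+- 3 ^- n *: T (y n) / N (T (y n))] along which [q _ (T (y n))]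
   is large. *)
Lemma separately_bounded (L : E -> E -> R[i]) : sesqui L ->
  (forall x, exists M : R, forall y, cmod (L x y) <= M * N y) ->
  (forall y, exists M : R, forall x, cmod (L x y) <= M * N x) ->
  bform q L.
Proof.
move=> Ls Ll Lr; split=> //.
have /choice[T hT] : forall u, exists w, forall x, L x u = q x w.
  move=> u; have [M hM] := Lr u.
  by apply: (@riesz _ _ _ qP qC (L^~ u) M) => // a x y; exact: Ls.2.
apply: contrapT => /forallNP H.
pose g n : R := 3^-1 ^+ n.
have g0 n : 0 < g n by rewrite exprn_gt0.
have gS n : g n.+1 = g n / 3 by rewrite /g exprSr.
have /choice[y hy] : forall n : nat, exists y, N y = 1 /\ n%:R < g n * N (T y).
  move=> n; have /existsNP[x /existsNP[y /negP]] := H (n%:R / g n).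
  rewrite -ltNge hT => h.
  have h1 := lt_le_trans h (cauchy_schwarz qP _ _).
  have Nx : 0 < N x.
    rewrite lt_neqAle qnorm_ge0 andbT eq_sym; apply/eqP => x0.
    by move: h1; rewrite x0 mulr0 !mul0r ltxx.
  move: h1; rewrite mulrAC mulrC ltr_pM2l // => h1.
  have Ny : 0 < N y.
    rewrite lt_neqAle qnorm_ge0 andbT eq_sym; apply/eqP => y0.
    move: h1; have -> : y = 0 by exact: (qnorm_eq0 qP).
    have -> : T 0 = 0.
      by apply: (ip_def qP); rewrite -hT (sesq0r Ls).
    by rewrite (qnorm0 qP) mulr0 ltxx.
  exists (((N y)^-1)%:C *: y); have Nyi : 0 <= (N y)^-1 by rewrite invr_ge0 ltW.
  rewrite (qnormZ qP) cmod_real ger0_norm // mulVf ?gt_eqF //; split=> //.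
  have -> : T (((N y)^-1)%:C *: y) = ((N y)^-1)%:C *: T y.
    apply/eqP; rewrite -subr_eq0; apply/eqP/(ip_def qP).
    by rewrite (ipBr qP) (ipZr qP) -!hT (sesqZr Ls) subrr.
  rewrite (qnormZ qP) cmod_real ger0_norm // mulrCA mulrC ltr_pdivlMr //.
  by move: h1; rewrite mulrAC ltr_pdivrMr // mulrC (mulrC (g n)).
pose t n := T (y n).
have tn0 n : 0 <= N (t n) by exact: qnorm_ge0.
have tn n : (0 < n)%N -> 0 < N (t n).
  move=> n0; have [_ h] := hy n; rewrite -(pmulr_rgt0 _ (g0 n)).
  by apply: le_lt_trans h.
pose ee n := (g n / N (t n))%:C *: t n.
have Nee n : N (ee n) <= g n.
  rewrite (qnormZ qP) cmod_real ger0_norm; last by rewrite divr_ge0 // ltW.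
  have [->|tz] := eqVneq (N (t n)) 0; first by rewrite mulr0 ltW.
  by rewrite divfK.
have qee n : (0 < n)%N -> cmod (q (ee n) (t n)) = g n * N (t n).
  move=> /tn n0; rewrite (ipZl qP) conjCE conjc_real (qnorm_sqr qP) -rmorphM /=.
  rewrite cmod_real ger0_norm; last first.
    by rewrite mulr_ge0 ?divr_ge0 ?sqr_ge0 // ltW.
  by rewrite expr2 mulrA divfK ?gt_eqF.
(* The values of [q _ (t n)] at [x + ee n] and [x - ee n] differ by twice [q (ee n) (t n)], so one
   of the two has modulus at least [g n * N (t n)]. *)
have choose x n : exists x', N (x' - x) <= g n /\
    ((0 < n)%N -> g n * N (t n) <= cmod (q x' (t n))).
  have [h|h] := leP (g n * N (t n)) (cmod (q (x + ee n) (t n))).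
    exists (x + ee n); split=> //; by rewrite addrC addKr.
  exists (x - ee n); split; first by rewrite addrC addKr (qnormN qP).
  move=> n0; have : 2 * (g n * N (t n)) <=
      cmod (q (x + ee n) (t n)) + cmod (q (x - ee n) (t n)).
    rewrite -qee // -[2](ger0_norm (ler0n R 2)) -cmod_real -cmodM.
    apply: le_trans (cmodB _ _); rewrite le_eqVlt; apply/orP; left.
    apply/eqP; congr cmod; rewrite (ipDl qP) (ipBl qP) rmorph_nat.
    by ring.
  lra.
have /choice[F hF] : forall p : E * nat, exists x', N (x' - p.1) <= g p.2 /\
    ((0 < p.2)%N -> g p.2 * N (t p.2) <= cmod (q x' (t p.2))).
  by move=> p; exact: choose.
pose xs := fix xs n := if n is m.+1 then F (xs m, m) else 0.
have xsS n : N (xs n.+1 - xs n) <= g n /\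
    ((0 < n)%N -> g n * N (t n) <= cmod (q (xs n.+1) (t n))).
  exact: (hF (xs n, n)).
have xsB n k : N (xs (n + k)%N - xs n) <= 3 / 2 * (g n - g (n + k)%N).
  elim: k => [|k IH]; first by rewrite addn0 !subrr (qnorm0 qP) mulr0.
  have [h _] := xsS (n + k)%N; rewrite addnS.
  by apply: le_trans (qnorm_dist qP _ (xs (n + k)%N) _) _; rewrite gS; lra.
have xsB' n m : (n <= m)%N -> N (xs m - xs n) <= 3 / 2 * g n.
  move=> nm; rewrite -(subnKC nm); apply: le_trans (xsB _ _) _.
  by have := g0 (n + (m - n))%N; lra.
have gsmall n : g n <= n.+1%:R^-1.
  rewrite /g exprVn lef_pV2 ?posrE ?exprn_gt0 // -natrX ler_nat.
  by elim: n => // n IH; rewrite expnS; lia.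
have [|x hx] := @qC xs.
  move=> e e0; have e6 : 0 < e / 6 by rewrite divr_gt0.
  have [n hn] := natSinv_small e6; exists n => m k nm nk.
  apply: le_lt_trans (qnorm_dist qP _ (xs n) _) _; rewrite (qnormBC qP (xs n)).
  have := xsB' _ _ nm; have := xsB' _ _ nk; have := gsmall n.
  by have := hn n (leqnn n); move: (n.+1%:R^-1) => i *; lra.
(* All later increments add up to at most 3/2 * 3^-(n+1) = 3^-n / 2, so [q x (t n)] keeps half of
   what was gained at step n, more than n / 2. *)
have xlim n : N (x - xs n.+1) <= g n / 2.
  apply/ler_addgt0Pr => e /hx[k hk]; pose m := maxn k n.+1.
  apply: le_trans (qnorm_dist qP _ (xs m) _) _; rewrite (qnormBC qP x).
  have := hk m (leq_maxl _ _); have := xsB' n.+1 m (leq_maxr _ _).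
  by rewrite gS; lra.
have [M hM] := Ll x.
pose n := (Num.truncn (2 * `|M|)).+1.
have hn : 2 * `|M| < n%:R by rewrite truncnS_gt.
have [yn1 yn2] := hy n; have [_ /(_ isT) h1] := xsS n.
have := hM (y n); rewrite yn1 mulr1 hT -/(t n) => h2.
have h3 := cauchy_schwarz qP (x - xs n.+1) (t n).
have h4 := ler_wpM2r (tn0 n) (xlim n).
have h5 : cmod (q (xs n.+1) (t n)) <= cmod (q x (t n)) + cmod (q (x - xs n.+1) (t n)).
  by rewrite -[X in q X (t n)](subKr x) (ipBl qP) cmodB.
have h6 := ler_norm M; move: yn2; rewrite -/(t n) => yn2.
lra.
Qed.

End Forms.

(** * Calculus on the line *)

Section Vanish.
Variables (R : realType) (I : Type) (F : set_system I).
Implicit Types x y : I -> R.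

(** One-sided, because it is meant for nonnegative quantities, for which an upper bound is enough.
    Leaving the filter free covers sequences and t tending to 0 at once, and stands in for a
    topology on the form domain. *)
Definition vanish x : Prop := forall e, 0 < e -> \forall i \near F, x i < e.

Context {FF : Filter F}.

Lemma vanish_le x y : (\forall i \near F, x i <= y i) -> vanish y -> vanish x.
Proof.
move=> xy y0 e e0; have ye := y0 e e0.
by apply: filterS2 xy ye => i; exact: le_lt_trans.
Qed.

Lemma vanishD x y : vanish x -> vanish y -> vanish (fun i => x i + y i).
Proof.
move=> x0 y0 e e0; have e2 : 0 < e / 2 by rewrite divr_gt0.
by apply: filterS2 (x0 _ e2) (y0 _ e2) => i; lra.
Qed.

Lemma vanishZ (c : R) x : 0 <= c -> vanish x -> vanish (fun i => c * x i).
Proof.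
move=> c0 x0 e e0; have c1 : 0 < c + 1 by lra.
have ec : 0 < e / (c + 1) by rewrite divr_gt0.
apply: filterS (x0 _ ec) => i; rewrite ltr_pdivlMr // => h.
by have [xi|xi] := leP 0 (x i); nra.
Qed.

Lemma vanish_cst (c : R) : ProperFilter F -> vanish (fun=> c) -> c <= 0.
Proof. by move=> PF c0; apply: le0_eps => e /c0 /filter_ex[_ /ltW]. Qed.

End Vanish.

Section Calculus.
Variable R : realType.
Implicit Types (phi : R -> R[i]) (s : R).

Definition cderiv phi s (l : R[i]) : Prop :=
  vanish 0^' (fun h : R => cmod ((h^-1)%:C * (phi (s + h) - phi s) - l)).

Lemma vanish_id : vanish (0 : R)^' (fun h : R => `|h|).
Proof. by move=> e e0; exact: dnbhs0_lt. Qed.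

Lemma is_derive_vanish (f : R -> R) s (l : R) :
  vanish 0^' (fun h : R => `|h^-1 * (f (s + h) - f s) - l|) ->
  is_derive s 1 f l.
Proof.
move=> fl.
have H : h^-1 *: (f (h *: (1 : R) + s) - f s) @[h --> 0^'] --> l.
  apply/cvgrPdist_lt => e /fl; apply: filterS => h.
  by rewrite (addrC s) distrC /GRing.scale /= mulr1.
apply: DeriveDef; first by apply/cvg_ex; exists l.
exact: cvg_lim H.
Qed.

Lemma cderiv_Re phi s l (t : R[i]) : cderiv phi s l ->
  is_derive s 1 (fun r => complex.Re (t * phi r)) (complex.Re (t * l)).
Proof.
move=> phil; apply: is_derive_vanish.
apply: vanish_le (vanishZ (cmod_ge0 t) phil).
apply: nearW => h; rewrite -cmodM; apply: le_trans (Re_le_cmod _).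
rewrite le_eqVlt; apply/orP; left; apply/eqP; congr (`|_|).
rewrite -ReN -ReD -mulrBr -ReRM -ReN -ReD; congr complex.Re.
by rewrite [RHS]mulrBr [in RHS]mulrCA.
Qed.

Lemma derive_nondecreasing (f df : R -> R) (a b : R) : a <= b ->
  (forall x, a <= x <= b -> is_derive x 1 f (df x)) ->
  (forall x, a <= x <= b -> 0 <= df x) -> f a <= f b.
Proof.
rewrite le_eqVlt => /orP[/eqP->//|ab] fd df0.
have [x xab||c cab fc] := @MVT R f df a b ab.
- by apply: fd; move: xab; rewrite in_itv /= => /andP[/ltW-> /ltW->].
- apply: derivable_within_continuous => x; rewrite in_itv /= => xab.
  by have [] := fd x xab.
rewrite -subr_ge0 fc mulr_ge0 // ?subr_ge0 ?(ltW ab) //; apply: df0.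
by move: cab; rewrite in_itv /= => /andP[/ltW-> /ltW->].
Qed.

(** Testing the real part against every multiplier [t] reduces complex derivatives to real ones: the
    product rule and monotonicity criteria of real functions carry over. *)
Definition rderiv phi s l : Prop := forall t : R[i],
  is_derive s 1 (fun r => complex.Re (t * phi r)) (complex.Re (t * l)).

Lemma cderiv_rderiv phi s l : cderiv phi s l -> rderiv phi s l.
Proof. by move=> d t; exact: cderiv_Re. Qed.

Lemma rderivM phi s l (f : R -> R) (f' : R) :
  rderiv phi s l -> is_derive s 1 f f' ->
  rderiv (fun r => (f r)%:C * phi r) s (f'%:C * phi s + (f s)%:C * l).
Proof.
move=> d df t.
have -> : (fun r => complex.Re (t * ((f r)%:C * phi r))) =
    f * (fun r => complex.Re (t * phi r)).
  by apply/funext => r; rewrite mulrCA ReRM.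
apply: is_derive_eq (is_deriveM df (d t)) _.
by rewrite mulrDr ReD ![t * (_%:C * _)]mulrCA !ReRM /GRing.scale /=; ring.
Qed.

Lemma is_derive_expRZ (c s : R) :
  is_derive s 1 (fun r => expR (c * r)) (c * expR (c * s)).
Proof.
have h : is_derive s 1 (fun r : R => c * r) c.
  have -> : (fun r : R => c * r) = c \*: id by [].
  by apply: is_derive_eq (is_deriveZ c (is_derive_id s 1)) _; rewrite /GRing.scale /= mulr1.
have := is_derive1_comp (is_derive_expR (c * s)) h.
by rewrite mulrC.
Qed.

(** A phase turns [phi t - phi 0] into its modulus; then the real function [psi - Re (z * phi)] is
    nondecreasing. *)
Lemma mean_value phi (phi' : R -> R[i]) (psi psi' : R -> R) (t : R) : 0 <= t ->
  (forall s, 0 <= s <= t -> rderiv phi s (phi' s)) ->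
  (forall s, 0 <= s <= t -> is_derive s 1 psi (psi' s)) ->
  (forall s, 0 <= s <= t -> cmod (phi' s) <= psi' s) ->
  cmod (phi t - phi 0) <= psi t - psi 0.
Proof.
move=> t0 dphi dpsi le.
have [z z1 hz] := cmod_phase (phi t - phi 0).
pose f := psi - (fun r => complex.Re (z * phi r)).
have fd s : 0 <= s <= t -> is_derive s 1 f (psi' s - complex.Re (z * phi' s)).
  by move=> st; apply: is_deriveB; [exact: dpsi|exact: dphi].
have : f 0 <= f t.
  apply: (derive_nondecreasing t0 fd) => s st.
  rewrite subr_ge0; apply: le_trans (le s st); apply: le_trans (Re_le_cmod' _) _.
  by rewrite cmodM z1 mul1r.
have -> : cmod (phi t - phi 0) = complex.Re (z * phi t) - complex.Re (z * phi 0).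
  by rewrite -ReN -ReD -mulrBr hz.
by rewrite /f !fctE; lra.
Qed.

End Calculus.

Section Operators.
Variables (R : realType) (H : lmodType R[i]) (q : H -> H -> R[i]).

(** Density is expressed by a trivial orthogonal complement, and self-adjointness by symmetry
    together with maximality [sa_max] (the adjoint is contained in the operator), so that only the
    form [q] is involved. *)
Record selfadj (Dm : set H) (T : H -> H) : Prop := SelfAdj {
  sa_sub : Defs.subspace Dm;
  sa_lin : linear_on Dm T;
  sa_dense : forall x, (forall k, Dm k -> q k x = 0) -> x = 0;
  sa_sym : forall x y, Dm x -> Dm y -> q (T x) y = q x (T y);
  sa_max : forall x y, (forall k, Dm k -> q (T k) x = q k y) -> Dm x /\ T x = y }.

Hypotheses (qP : inner_product q) (qC : qcomplete q).
Local Notation N := (qnorm q).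

Lemma qcvg_ip (u : nat -> H) l x : qcvg q u l ->
  vanish \oo (fun n => cmod (q x (u n) - q x l)).
Proof.
move=> ul; apply: (@vanish_le _ _ _ _ _ (fun n => N x * N (u n - l))).
  by apply: nearW => n; rewrite -(ipBr qP) cauchy_schwarz.
apply: vanishZ => // e /ul[n hn]; exists n => // m /=; exact: hn.
Qed.

Lemma qcvg_unique_ip (u v : nat -> H) x y l m : qcvg q u l -> qcvg q v m ->
  (forall n, q x (u n) = q y (v n)) -> q x l = q y m.
Proof.
move=> ul vm e; apply/eqP; rewrite -subr_eq0 -cmod_eq0; apply/eqP/le_anti.
rewrite cmod_ge0 andbT; apply: (@vanish_cst _ _ \oo) => //.
apply: vanish_le (vanishD (qcvg_ip x ul) (qcvg_ip y vm)).
apply: nearW => n; rewrite (cmod_distC _ (q x l)).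
by apply: le_trans (cmodD _ _); rewrite -e addrA subrK.
Qed.

End Operators.

(** * Form domains *)

Section FormDomain.
Variables (R : realType) (H : lmodType R[i]) (q : H -> H -> R[i]).
Hypotheses (qP : inner_product q) (qC : qcomplete q).
Local Notation N := (qnorm q).

Record unitary (W : R -> H -> H) : Prop := Unitary {
  W_lin : forall t a x y, W t (a *: x + y) = a *: W t x + W t y;
  W_iso : forall t x y, q (W t x) (W t y) = q x y;
  W_0 : forall x, W 0 x = x;
  W_D : forall s t x, W (s + t) x = W s (W t x);
  W_cont : forall x, vanish 0^' (fun t => N (W t x - x)) }.

Record is_gen (W : R -> H -> H) (Dm : set H) (A : H -> H) : Prop := IsGen {
  gen_sa : selfadj q Dm A;
  gen_der : forall f, Dm f ->
    vanish 0^' (fun t : R => N ((t^-1)%:C *: (W t f - f) - 'i *: A f)) }.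

Section Group.
Variables (W : R -> H -> H) (Wu : unitary W).

Lemma W_adj t x y : q (W t x) y = q x (W (- t) y).
Proof. by rewrite -(W_iso Wu t x) -(W_D Wu) subrr (W_0 Wu). Qed.

Lemma W_norm t x : N (W t x) = N x.
Proof. by rewrite /qnorm (W_iso Wu). Qed.

Lemma W_B t x y : W t (x - y) = W t x - W t y.
Proof. by rewrite addrC -scaleN1r (W_lin Wu) scaleN1r addrC. Qed.

Lemma W_zero t : W t 0 = 0.
Proof. by have := W_B t 0 0; rewrite !subrr. Qed.

Lemma W_Z t a x : W t (a *: x) = a *: W t x.
Proof. by have := W_lin Wu t a x 0; rewrite W_zero !addr0. Qed.

Variables (Dm : set H) (A : H -> H) (gA : is_gen W Dm A).

Lemma gen_cderiv k f s : Dm f ->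
  cderiv (fun r => q k (W r f)) s (q k (W s ('i *: A f))).
Proof.
move=> Df; apply: vanish_le (vanishZ (qnorm_ge0 q k) (gen_der gA Df)).
apply: nearW => h.
have -> : (h^-1)%:C * (q k (W (s + h) f) - q k (W s f)) - q k (W s ('i *: A f))
    = q k (W s ((h^-1)%:C *: (W h f - f) - 'i *: A f)).
  by rewrite W_B (W_Z s (h^-1)%:C) W_B -(W_D Wu) !(ipBr qP, ipZr qP).
by rewrite -(W_norm s (_ - _)); exact: cauchy_schwarz.
Qed.

(** Since [q (A u) u] is real, |(A + i kap) u|^2 = |A u|^2 + kap^2 |u|^2, which bounds the operator
    below; a vector w orthogonal to the range satisfies A w = i kap w, and the same identity then
    reads 4 kap^2 |w|^2 = 2 kap^2 |w|^2. *)
Lemma gen_resolvent (kap : R) (f : H) : 0 < kap ->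
  exists2 u, Dm u & A u + ('i * kap%:C) *: u = f.
Proof.
move=> k0; have sA := gen_sa gA.
have nrm u : Dm u -> N (A u + ('i * kap%:C) *: u) ^+ 2 =
    N (A u) ^+ 2 + kap ^+ 2 * N u ^+ 2.
  move=> Du; rewrite (qnormD_sqr qP) (qnormZ qP) cmodM cmodi mul1r cmod_real.
  rewrite exprMn real_normK ?num_real // (ipZr qP).
  have -> : complex.Re ('i * kap%:C * q (A u) u) = 0.
    have : complex.Im (q (A u) u) = 0.
      have := congr1 (@complex.Im R) (ip_herm qP u (A u)).
      by rewrite Imconj -(sa_sym sA Du Du) => h; lra.
    by rewrite !ReM !ImM /= => ->; ring.
  by rewrite mulr0 addr0.
pose B u := A u + ('i * kap%:C) *: u.
have BL : linear_on Dm B.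
  move=> a x y Dx Dy; rewrite /B (sa_lin sA) // !scalerDr !scalerA addrACA.
  by rewrite [a * _]mulrC.
apply: (onto qC qP qC (Dm := Dm) (B := B) (alpha := kap)) => //.
- exact: sa_sub sA.
- move=> u l w Du ul Bw.
  have h k : Dm k -> q (A k - ('i * kap%:C) *: k) l = q k w.
    move=> Dk; apply: (qcvg_unique_ip qP ul Bw) => n /=.
    rewrite (ipBl qP) (ipZl qP) (ipDr qP) (ipZr qP) (sa_sym sA) //.
    rewrite rmorphM /= -complexiE conjCi conjCE conjc_real complexiE.
    by rewrite mulNr mulNr opprK.
  have [Dl Al] : Dm l /\ A l = w - ('i * kap%:C) *: l.
    apply: (sa_max sA) => k Dk; rewrite (ipBr qP) (ipZr qP) -(h k Dk) (ipBl qP).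
    rewrite (ipZl qP) rmorphM /= -complexiE conjCi conjCE conjc_real complexiE.
    by rewrite mulNr mulNr opprK addrK.
  by split=> //; rewrite /B Al subrK.
- move=> u Du; apply: le_of_sqr; first exact: qnorm_ge0.
  by rewrite nrm // exprMn lerDr sqr_ge0.
- move=> w hw.
  have [Dw Aw] : Dm w /\ A w = ('i * kap%:C) *: w.
    apply: (sa_max sA) => k Dk; have := hw _ Dk.
    rewrite (ipDl qP) (ipZl qP) (ipZr qP) rmorphM /= -complexiE conjCi conjCE.
    by rewrite conjc_real complexiE !mulNr => /eqP; rewrite subr_eq0 => /eqP.
  have := nrm _ Dw; rewrite Aw -mulr2n -scaler_nat !(qnormZ qP) !cmodM cmodi.
  rewrite cmod_real mul1r -[2%:R](rmorph_nat (real_complex R)) cmod_real.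
  rewrite ger0_norm // ger0_norm ?ltW // => h.
  apply: (qnorm_eq0 qP); apply/eqP; rewrite -(@sqrf_eq0 R).
  have : kap ^+ 2 * N w ^+ 2 = 0 by move: h; rewrite !exprMn; lra.
  by move=> /eqP; rewrite mulf_eq0 => /orP[|//]; rewrite gt_eqF ?exprn_gt0.
Qed.

End Group.

Variables (V : lmodType R[i]) (io ta : V -> H).

(** The form domain as a module of its own, with its inclusion [io] into H and the square root [ta]
    of S acting on it; thus Riesz and Lax-Milgram apply to a whole type. [fd_max] is the maximality
    of the self-adjoint operator [ta]. *)
Record form_domain : Prop := FormDomain {
  fd_io : forall a x y, io (a *: x + y) = a *: io x + io y;
  fd_ta : forall a x y, ta (a *: x + y) = a *: ta x + ta y;
  fd_inj : injective io;
  fd_sym : forall x y, q (ta x) (io y) = q (io x) (ta y);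
  fd_max : forall x y, (forall k, q (ta k) x = q (io k) y) ->
             exists v, io v = x /\ ta v = y;
  fd_dense : forall x, (forall k, q (io k) x = 0) -> x = 0 }.

Hypothesis fdV : form_domain.

Definition qV (x y : V) : R[i] := q (io x) (io y) + q (ta x) (ta y).
Local Notation NV := (qnorm qV).

Lemma ioD x y : io (x + y) = io x + io y.
Proof. by have := fd_io fdV 1 x y; rewrite !scale1r. Qed.
Lemma io0 : io 0 = 0.
Proof. by have := ioD 0 0; rewrite addr0 => /eqP; rewrite -subr_eq subrr => /eqP. Qed.
Lemma ioZ a x : io (a *: x) = a *: io x.
Proof. by have := fd_io fdV a x 0; rewrite io0 !addr0. Qed.
Lemma ioB x y : io (x - y) = io x - io y.
Proof. by rewrite ioD -scaleN1r ioZ scaleN1r. Qed.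
Lemma taD x y : ta (x + y) = ta x + ta y.
Proof. by have := fd_ta fdV 1 x y; rewrite !scale1r. Qed.
Lemma ta0 : ta 0 = 0.
Proof. by have := taD 0 0; rewrite addr0 => /eqP; rewrite -subr_eq subrr => /eqP. Qed.
Lemma taZ a x : ta (a *: x) = a *: ta x.
Proof. by have := fd_ta fdV a x 0; rewrite ta0 !addr0. Qed.
Lemma taB x y : ta (x - y) = ta x - ta y.
Proof. by rewrite taD -scaleN1r taZ scaleN1r. Qed.

Lemma qV_sqr x : NV x ^+ 2 = N (io x) ^+ 2 + N (ta x) ^+ 2.
Proof.
rewrite {1}/qnorm /qV (qnorm_sqr qP) (qnorm_sqr qP) ReD /= sqr_sqrtr //.
by rewrite addr_ge0 // sqr_ge0.
Qed.

Lemma qV_P : inner_product qV.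
Proof.
split=> [a x y z|x y|x|x].
- by rewrite /qV (fd_io fdV) (fd_ta fdV) !(ipDr qP) !(ipZr qP); ring.
- by rewrite /qV (ip_herm qP (io x)) (ip_herm qP (ta x)) rmorphD.
- by rewrite /qV addr_ge0 // (ip_ge0 qP).
- rewrite /qV !(qnorm_sqr qP) -rmorphD /= => /(congr1 (@complex.Re R)) /= h.
  apply: (fd_inj fdV); rewrite io0; apply: (qnorm_eq0 qP).
  by have := qnorm_ge0 q (io x); have := sqr_ge0 (N (ta x)); nra.
Qed.

Lemma le_io x : N (io x) <= NV x.
Proof. by apply: le_of_sqr => //; rewrite qV_sqr lerDl sqr_ge0. Qed.

Lemma le_ta x : N (ta x) <= NV x.
Proof. by apply: le_of_sqr => //; rewrite qV_sqr lerDr sqr_ge0. Qed.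

Lemma qV_le x : NV x <= N (io x) + N (ta x).
Proof.
apply: le_of_sqr; first by apply: addr_ge0.
by rewrite qV_sqr; have := mulr_ge0 (qnorm_ge0 q (io x)) (qnorm_ge0 q (ta x)); nra.
Qed.

Lemma qV_C : qcomplete qV.
Proof.
move=> u cu.
have [|x ux] := @qC (io \o u).
  move=> e /cu[n hn]; exists n => m k nm nk /=.
  by rewrite -ioB; apply: le_lt_trans (le_io _) (hn _ _ nm nk).
have [|y uy] := @qC (ta \o u).
  move=> e /cu[n hn]; exists n => m k nm nk /=.
  by rewrite -taB; apply: le_lt_trans (le_ta _) (hn _ _ nm nk).
have [v [vx vy]] : exists v, io v = x /\ ta v = y.
  apply: (fd_max fdV) => k; apply: (qcvg_unique_ip qP ux uy) => n.
  exact: fd_sym fdV _ _.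
exists v => e e0; have e2 : 0 < e / 2 by rewrite divr_gt0.
have [n1 h1] := ux _ e2; have [n2 h2] := uy _ e2.
exists (maxn n1 n2) => m; rewrite geq_max => /andP[/h1 /= a /h2 /= b].
by apply: le_lt_trans (qV_le _) _; rewrite ioB taB vx vy; lra.
Qed.

Lemma io_close x e : 0 < e -> exists k, N (x - io k) < e.
Proof.
have sV : Defs.subspace (range io).
  split; first by exists 0 => //; exact: io0.
  by move=> a _ _ [x' _ <-] [y _ <-]; exists (a *: x' + y) => //; rewrite (fd_io fdV).
move=> e0; have [|_ [k _ <-] hk] := dense_of_perp0 qP qC sV _ x e0.
  by move=> y hy; apply: (fd_dense fdV) => k; apply: hy; exists k.
by exists k.
Qed.

(** Applied to [ta x]: as [q (io k) (ta x) = q (ta k) (io x)], a bound on [ta x] follows from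
    quantities that see only [io x], where the group is unitary and differentiable. *)
Lemma norm_le_test (x : H) (c : R) : 0 <= c ->
  (forall k, cmod (q (io k) x) <= c * N (io k)) -> N x <= c.
Proof.
move=> c0 hk; rewrite leNgt; apply/negP => cx.
have e0 : 0 < (N x - c) / 3 by rewrite divr_gt0 // subr_gt0.
have [k hk'] := io_close x e0.
have h1 := hk k.
have h2 : N (io k) <= N x + (N x - c) / 3.
  have := qnormB qP x (x - io k); rewrite opprB addrC subrK; lra.
have h3 := cauchy_schwarz qP (x - io k) x.
have h4 : N x ^+ 2 <= cmod (q (io k) x) + cmod (q (x - io k) x).
  have := cmodD (q (io k) x) (q (x - io k) x).
  by rewrite -(ipDl qP) addrC subrK (qnorm_sqr qP) cmod_real ger0_norm ?sqr_ge0.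
have h5 : N (x - io k) * N x <= (N x - c) / 3 * N x.
  by apply: ler_wpM2r => //; exact: ltW.
have h6 := ler_wpM2l c0 h2.
nra.
Qed.

Lemma lin_riesz (phi : V -> R[i]) (M : R) :
  (forall a x y, phi (a *: x + y) = a * phi x + phi y) ->
  (forall x, cmod (phi x) <= M * NV x) ->
  exists w, forall x, phi x = qV w x.
Proof.
move=> phiL phiM.
have [||w hw] := @riesz _ _ _ qV_P qV_C (fun x => (phi x)^*)%R M.
- by move=> a x y; rewrite phiL rmorphD rmorphM.
- by move=> x; rewrite cmod_conj.
by exists w => x; rewrite (ip_herm qV_P x) -hw conjCK.
Qed.

(** In the only delicate term, [ta w] is approximated by some [io k]: the error is controlled by the
    bound on [ta (x i)], and [q (io k) (ta _) = q (ta k) (io _)] converges with [io (x i)]. *)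
Lemma weak_limit (I : Type) (F : set_system I) {FF : Filter F} (x : I -> V)
    (l w : V) (M : R) :
  vanish F (fun i => N (io (x i) - io l)) ->
  (\forall i \near F, N (ta (x i)) <= M) ->
  vanish F (fun i => cmod (qV w (x i) - qV w l)).
Proof.
move=> xl xM e e0.
pose M' := `|M| + N (ta l) + 1.
have M'0 : 0 < M' by rewrite ltr_wpDl // addr_ge0.
have e2 : 0 < e / 2 / M' by rewrite !divr_gt0.
have [k hk] := io_close (ta w) e2.
have K0 : 0 <= N (io w) + N (ta k) by apply: addr_ge0.
have e3 : 0 < e / 2 by rewrite divr_gt0.
apply: filterS2 xM (vanishZ K0 xl e3) => i xM hi.
have -> : qV w (x i) - qV w l = q (io w) (io (x i) - io l) +
    (q (ta w - io k) (ta (x i) - ta l) + q (ta k) (io (x i) - io l)).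
  rewrite /qV !(ipBl qP) !(ipBr qP) !(fd_sym fdV); ring.
have h1 := cauchy_schwarz qP (io w) (io (x i) - io l).
have h2 := cauchy_schwarz qP (ta w - io k) (ta (x i) - ta l).
have h3 := cauchy_schwarz qP (ta k) (io (x i) - io l).
have h4 : N (ta (x i) - ta l) <= M'.
  by have := qnormB qP (ta (x i)) (ta l); have := ler_norm M; rewrite /M'; lra.
have h5 : N (ta w - io k) * N (ta (x i) - ta l) <= e / 2.
  have := ler_pM (qnorm_ge0 q _) (qnorm_ge0 q _) (ltW hk) h4.
  by rewrite divfK ?gt_eqF.
apply: le_lt_trans (cmodD _ _) _.
have := cmodD (q (ta w - io k) (ta (x i) - ta l)) (q (ta k) (io (x i) - io l)).
lra.
Qed.

End FormDomain.

(** * Invariance of the form domain under the group *)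

Lemma dnbhs0P (R : realType) (P : R -> Prop) : (\forall h \near 0^', P h) <->
  exists2 r : R, 0 < r & forall h, h != 0 -> `|h| < r -> P h.
Proof.
split=> [|[r r0 hr]].
  rewrite near_withinE => /nbhs_ballP[r /= r0 hr]; exists r => // h h0 hh.
  by apply: hr => //; rewrite /ball /= sub0r normrN.
rewrite near_withinE; apply/nbhs_ballP; exists r => // h.
by rewrite /ball /= sub0r normrN => hh h0; exact: hr.
Qed.

Section InvariantGroup.
Variables (R : realType) (H : lmodType R[i]) (q : H -> H -> R[i]).
Hypotheses (qP : inner_product q) (qC : qcomplete q).
Local Notation N := (qnorm q).
Variables (W : R -> H -> H) (Wu : unitary q W).
Variables (Dm : set H) (A : H -> H) (gA : is_gen q W Dm A).
Variables (V : lmodType R[i]) (io ta : V -> H).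
Hypothesis fdV : form_domain q io ta.
Local Notation Q := (qV q io ta).
Local Notation NV := (qnorm Q).

Record inv_group (WV : R -> V -> V) : Prop := InvGroup {
  wv_io : forall t x, io (WV t x) = W t (io x);
  wv_bd : forall t, exists M : R, forall x, N (ta (WV t x)) <= M * N (ta x) }.

Variables (WV : R -> V -> V) (WVi : inv_group WV).

Lemma wv_lin t a x y : WV t (a *: x + y) = a *: WV t x + WV t y.
Proof.
apply: (fd_inj fdV).
by rewrite (fd_io fdV) !(wv_io WVi) (fd_io fdV) (W_lin Wu).
Qed.

Lemma wv_D s t x : WV (s + t) x = WV s (WV t x).
Proof. by apply: (fd_inj fdV); rewrite !(wv_io WVi) (W_D Wu). Qed.

Lemma wv_0 x : WV 0 x = x.
Proof. by apply: (fd_inj fdV); rewrite (wv_io WVi) (W_0 Wu). Qed.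

Lemma wv_K t x : WV t (WV (- t) x) = x.
Proof. by rewrite -wv_D subrr wv_0. Qed.

Lemma wv_sub t x y : WV t (x - y) = WV t x - WV t y.
Proof. by rewrite addrC -scaleN1r wv_lin scaleN1r addrC. Qed.

Lemma io_norm t x : N (io (WV t x)) = N (io x).
Proof. by rewrite (wv_io WVi) (W_norm Wu). Qed.

Let bounded_at (n : nat) : set R :=
  [set t | forall x, N (ta (WV t x)) <= n%:R * N (ta x)].

(** By density of the range of [io], the norm of [ta (WV t x)] is a supremum over k of expressions
    in [q (ta k) (W t (io x))], each continuous in t; hence it is lower semicontinuous. *)
Lemma bounded_at_closed n : open (~` bounded_at n).
Proof.
rewrite openE => t /= /existsNP[x /negP]; rewrite -ltNge.
set c := n%:R * N (ta x) => cx.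
have c0 : 0 <= c by rewrite mulr_ge0.
have [k hk] : exists k, c * N (io k) < cmod (q (io k) (ta (WV t x))).
  apply: contrapT => /forallNP hk; move: cx; rewrite ltNge => /negP; apply.
  apply: (norm_le_test qP qC fdV) => // k.
  by rewrite leNgt; apply/negP; exact: hk.
rewrite -(fd_sym fdV) (wv_io WVi) in hk.
pose d := cmod (q (ta k) (W t (io x))) - c * N (io k).
have d0 : 0 < d by rewrite subr_gt0.
have hnear : vanish 0^' (fun h => N (ta k) * N (W h (W t (io x)) - W t (io x))).
  exact: vanishZ (qnorm_ge0 q (ta k)) (W_cont Wu (W t (io x))).
rewrite /interior /= nbhsE /=.
have {hnear}[r r0 hr] : exists2 r : R, 0 < r & forall h : R, `|h| < r ->
    N (ta k) * N (W h (W t (io x)) - W t (io x)) < d.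
  move: hnear => /(_ _ d0)/dnbhs0P[r r0 hr]; exists r => // h hh.
  have [->|h0] := eqVneq h 0.
    by rewrite (W_0 Wu) subrr (qnorm0 qP) mulr0.
  exact: hr.
exists (ball t r); first by split; [exact: ball_open|exact: ballxx].
move=> s; rewrite /ball /= distrC => hs hbs.
have := hr _ hs; rewrite -(W_D Wu) subrK; apply/negP; rewrite -leNgt.
have h1 := cauchy_schwarz qP (ta k) (W s (io x) - W t (io x)).
have h2 : cmod (q (ta k) (W s (io x))) <= c * N (io k).
  rewrite -(wv_io WVi) (fd_sym fdV); apply: le_trans (cauchy_schwarz qP _ _) _.
  by rewrite mulrC; apply: ler_wpM2r => //; exact: hbs.
have h3 := cmodB (q (ta k) (W s (io x))) (q (ta k) (W s (io x) - W t (io x))).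
move: h3; rewrite -(ipBr qP) opprB addrC subrK /d; lra.
Qed.

(** The closed sets [bounded_at n] cover the line, since [wv_bd] gives a bound for each t; by Baire
    one of them contains a ball around some a, and [WV (- a)] moves this ball to 0. *)
Lemma wv_loc_bound : exists r K : R, [/\ 0 < r, 1 <= K &
  forall t x, `|t| < r -> N (ta (WV t x)) <= K * N (ta x)].
Proof.
have [n hn] : exists n, ~ dense (~` bounded_at n).
  apply: contrapT => /forallNP hd.
  have := @Baire R R^o (fun n => ~` bounded_at n).
  move=> /(_ (fun i => conj (@bounded_at_closed i) (contrapT (hd i)))).
  move=> /(_ setT) [||t [_ /= ht]]; [by exists 0|exact: openT|].
  have [M hM] := wv_bd WVi t.
  apply: (ht (Num.truncn `|M|).+1) => // x.
  apply: le_trans (hM x) _; apply: ler_wpM2r => //.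
  by apply: le_trans (ler_norm _) _; rewrite ltW // truncnS_gt.
have [U [[a Ua] [oU hU]]] : exists U : set R,
    U !=set0 /\ (open U /\ U `<=` bounded_at n).
  apply: contrapT => /forallNP h; apply: hn => U U0 oU.
  apply: contrapT => /set0P/negP; rewrite negbK => /eqP UO.
  apply: (h U); split=> //; split=> // t Ut; apply: contrapT => nt.
  have : (U `&` ~` bounded_at n) t by [].
  by rewrite UO.
have /nbhs_ballP[r /= r0 hr] : nbhs a U by exact: open_nbhs_nbhs.
have [M hM] := wv_bd WVi (- a).
exists r, (n%:R * `|M| + 1); split=> [//||t x tr].
  by rewrite lerDr mulr_ge0.
have -> : WV t x = WV (a + t) (WV (- a) x).
  by rewrite -wv_D addrAC subrr add0r.
have at_n : bounded_at n (a + t).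
  by apply/hU/hr; rewrite /ball /= opprD addrA subrr sub0r normrN.
apply: le_trans (at_n _) _; rewrite mulrDl mul1r -mulrA.
have h1 : N (ta (WV (- a) x)) <= `|M| * N (ta x).
  by apply: le_trans (hM x) _; apply: ler_wpM2r => //; exact: ler_norm.
by have := ler_wpM2l (ler0n R n) h1; have := qnorm_ge0 q (ta x); lra.
Qed.

(** Time is cut into steps of length d = r / 2, each costing a factor K. The summand 1 in the rate
    keeps it positive when K = 1. *)
Lemma wv_exp_bound : exists K om : R, [/\ 1 <= K, 0 < om &
  forall t x, 0 <= t -> N (ta (WV t x)) <= K * expR (om * t) * N (ta x)].
Proof.
have [r [K [r0 K1 hK]]] := wv_loc_bound.
pose d := r / 2; have d0 : 0 < d by rewrite divr_gt0.
have K0 : 0 < K by lra.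
exists K, ((ln K + 1) / d); split=> [//||t x t0].
  by rewrite divr_gt0 // ltr_wpDl // ln_ge0.
have step n : forall s y, 0 <= s <= n%:R * d ->
    N (ta (WV s y)) <= K ^+ n * N (ta y).
  elim: n => [|n IH] s y /andP[s0 sn].
    have -> : s = 0 by apply/le_anti; rewrite s0 andbT; move: sn; rewrite mul0r.
    by rewrite wv_0 expr0 mul1r.
  have [sd|sd] := leP s (n%:R * d).
    apply: le_trans (IH s y _) _; first by rewrite s0.
    apply: ler_wpM2r => //; rewrite exprS ler_peMl // exprn_ge0 //; exact: ltW.
  have -> : WV s y = WV (n%:R * d) (WV (s - n%:R * d) y).
    by rewrite -wv_D addrC subrK.
  have nd : 0 <= n%:R * d <= n%:R * d by rewrite lexx andbT mulr_ge0 // ltW.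
  apply: le_trans (IH _ _ nd) _; rewrite exprSr -mulrA.
  apply: ler_wpM2l; first by rewrite exprn_ge0 // ltW.
  apply: hK; rewrite ger0_norm; last lra.
  by move: sn; rewrite -natr1 mulrDl mul1r /d; lra.
pose n := Num.truncn (t / d).
have tn : 0 <= t <= n.+1%:R * d.
  by rewrite t0 /= -ler_pdivrMr // ltW // truncnS_gt.
apply: le_trans (step _ _ _ tn) _; apply: ler_wpM2r => //.
rewrite exprS ler_pM2l // -{1}(@lnK _ K) ?posrE // -expRM_natl ler_expR.
have h1 : n%:R <= t / d by rewrite truncn_le // divr_ge0 // ltW.
have l0 : 0 <= ln K by rewrite ln_ge0.
have -> : (ln K + 1) / d * t = (ln K + 1) * (t / d) by rewrite mulrAC mulrA.
have := ler_wpM2l l0 h1; have : 0 <= t / d by rewrite divr_ge0 // ltW.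
by nra.
Qed.

End InvariantGroup.

(** * Weak density of the domain of the generator in the form domain *)

Section DomainDense.
Variables (R : realType) (H : lmodType R[i]) (q : H -> H -> R[i]).
Hypotheses (qP : inner_product q) (qC : qcomplete q).
Local Notation N := (qnorm q).
Variables (W : R -> H -> H) (Wu : unitary q W).
Variables (Dm : set H) (A : H -> H) (gA : is_gen q W Dm A).
Variables (V : lmodType R[i]) (io ta : V -> H).
Hypothesis fdV : form_domain q io ta.
Local Notation Q := (qV q io ta).
Local Notation NV := (qnorm Q).
Variables (WV : R -> V -> V) (WVi : inv_group q W io ta WV).

(** The part of [A] in the form domain, as a graph: y is A x seen as an element of [V]. *)
Definition dAV (x y : V) : Prop := Dm (io x) /\ io y = A (io x).

Lemma test_rderiv k (g : H) (u : H) s : Dm u -> A u = g ->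
  rderiv (fun r => q (ta k) (W r u)) s (q (ta k) (W s ('i *: g))).
Proof. by move=> Du <-; apply/cderiv_rderiv/(gen_cderiv qP Wu gA). Qed.

(* The function [s |-> q (ta k) (W s u)] solves [phi' = kap phi + psi] with
   [psi] of order [exp (om s)]; being bounded, it is determined by [psi]. *)
Lemma gen_resolvent_V : exists om C : R, [/\ 0 < om, 0 < C &
  forall (kap : R) (f : V), om < kap -> exists u,
   [/\ Dm (io u), A (io u) = io (f - ('i * kap%:C) *: u) &
      (kap - om) * N (ta u) <= C * N (ta f)]].
Proof.
have [K [om [K1 om0 hK]]] := wv_exp_bound qP qC Wu fdV WVi.
exists om, K; split=> [//||kap f omk]; first lra.
have kap0 : 0 < kap by lra.
have del0 : 0 < kap - om by rewrite subr_gt0.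
have [u0 Du0 Au0] := gen_resolvent qP qC gA (io f) kap0.
have bnd k : cmod (q (ta k) u0) <= K * N (ta f) / (kap - om) * N (io k).
  pose B := N (io k) * (K * N (ta f)).
  have B0 : 0 <= B by apply: mulr_ge0 => //; apply: mulr_ge0 => //; lra.
  pose phi (s : R) : R[i] := q (ta k) (W s u0).
  pose chi (s : R) : R[i] := (expR (- kap * s))%:C * phi s.
  pose psi (s : R) : R := - (B / (kap - om)) * expR (- (kap - om) * s).
  pose psi' (s : R) : R := B * expR (- (kap - om) * s).
  pose chi' (s : R) : R[i] := (- kap * expR (- kap * s))%:C * phi s +
     (expR (- kap * s))%:C * q (ta k) (W s ('i *: (io f - ('i * kap%:C) *: u0))).
  have dchi s : rderiv chi s (chi' s).
    apply: rderivM; last exact: is_derive_expRZ.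
    apply: test_rderiv => //.
    by rewrite -Au0 addrK.
  have chi'E s : chi' s = (expR (- kap * s))%:C * ('i * q (io k) (ta (WV s f))).
    rewrite /chi' /phi (W_Z Wu) (W_B Wu) (W_Z Wu) !(ipZr qP) (ipBr qP) (ipZr qP).
    rewrite -(wv_io WVi) (fd_sym fdV) rmorphM rmorphN /=.
    have ii : 'i * 'i = -1 :> R[i] by rewrite -expr2 sqr_i.
    set X := q (ta k) (W s u0); set Y := q (io k) _; set e := (expR _)%:C.
    transitivity (e * ('i * Y) - e * X * kap%:C * (1 + 'i * 'i)); first by ring.
    by rewrite ii subrr mulr0 subr0.
  have dpsi (s : R) : is_derive s 1 psi (psi' s).
    have h := is_deriveZ (- (B / (kap - om))) (is_derive_expRZ (- (kap - om)) s).
    apply: is_derive_eq h _; rewrite /GRing.scale /= /psi'.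
    by field; rewrite gt_eqF.
  have le s : 0 <= s -> cmod (chi' s) <= psi' s.
    move=> s0; rewrite chi'E !cmodM cmodi mul1r cmod_real ger0_norm ?expR_ge0 //.
    have h1 := cauchy_schwarz qP (io k) (ta (WV s f)).
    have h2 := ler_wpM2l (qnorm_ge0 q (io k)) (hK s f s0).
    apply: le_trans (ler_wpM2l (expR_ge0 _) (le_trans h1 h2)) _.
    rewrite /psi' /B (_ : - (kap - om) * s = - kap * s + om * s) ?expRD; last by ring.
    by rewrite le_eqVlt; apply/orP; left; apply/eqP; ring.
  have phi0 : chi 0 = q (ta k) u0.
    by rewrite /chi /phi mulr0 expR0 mul1r (W_0 Wu).
  have main t : 0 <= t ->
      cmod (q (ta k) u0) <= B / (kap - om) + expR (- kap * t) * (N (ta k) * N u0).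
    move=> t0; have := mean_value t0 (fun s _ => dchi s) (fun s _ => dpsi s)
      (fun s st => le s (andP st).1).
    rewrite phi0 cmod_distC => h.
    have h1 : cmod (q (ta k) u0) <= cmod (q (ta k) u0 - chi t) + cmod (chi t).
      by apply: le_trans (cmodD _ _); rewrite subrK.
    have h2 : cmod (chi t) <= expR (- kap * t) * (N (ta k) * N u0).
      rewrite cmodM cmod_real ger0_norm ?expR_ge0 //; apply: ler_wpM2l => //.
      by apply: le_trans (cauchy_schwarz qP _ _) _; rewrite (W_norm Wu).
    have h3 : psi t <= 0.
      rewrite /psi mulNr oppr_le0 mulr_ge0 ?expR_ge0 // divr_ge0 //; exact: ltW.
    have h4 : psi 0 = - (B / (kap - om)) by rewrite /psi mulr0 expR0 mulr1.
    lra.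
  have -> : K * N (ta f) / (kap - om) * N (io k) = B / (kap - om).
    by rewrite /B; field; rewrite gt_eqF.
  apply/ler_addgt0Pr => e e0.
  pose c := N (ta k) * N u0; have c0 : 0 <= c by exact: mulr_ge0.
  (* At this time the remainder [expR (- kap * t) * c] is at most e, by [expR x >= 1 + x]. *)
  have t0 : 0 <= c / (kap * e) by rewrite divr_ge0 // ltW // mulr_gt0.
  apply: le_trans (main _ t0) _; rewrite lerD2l -/c.
  rewrite mulNr expRN.
  have -> : kap * (c / (kap * e)) = c / e by field; rewrite !gt_eqF.
  rewrite mulrC ler_pdivrMr ?expR_gt0 //.
  apply: le_trans (ler_wpM2l (ltW e0) (expR_ge1Dx (c / e))).
  by rewrite mulrDr mulr1 mulrC divfK ?gt_eqF // lerDr ltW.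
have phiL a x y : q (ta (a *: x + y)) u0 = (a^*)%R * q (ta x) u0 + q (ta y) u0.
  by rewrite (fd_ta fdV) (ipDl qP) (ipZl qP).
(* The bound [bnd] is relative to the norm of H, so u0 lies in the domain of the adjoint of [ta]; by
   [fd_max] this is the form domain. *)
have [w hw] := riesz_along (phi := fun k => q (ta k) u0) qP qC (fd_io fdV) phiL bnd.
have [u [uu uw]] := fd_max fdV hw.
exists u; rewrite uu; split=> //.
  by rewrite (ioB fdV) (ioZ fdV) uu -Au0 addrK.
rewrite mulrC -ler_pdivlMr //; apply: (norm_le_test qP qC fdV).
  by rewrite divr_ge0 ?mulr_ge0 //; lra.
by move=> k; rewrite -(fd_sym fdV) uu.
Qed.

(** Shows that i kap (A + i kap)^-1 f tends to f, the difference being - A u: choose g close to f,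
    then kap large. The estimate splits |A u|^2 as Re <A u, f - g> + Re <u, A g> and uses |A u| <=
    |f| and kap |u| <= |f|. *)
Lemma gen_resolvent_small (f u : H) (kap : R) (g : H) : 0 < kap -> Dm u -> Dm g ->
  A u + ('i * kap%:C) *: u = f ->
  N (A u) ^+ 2 <= N f * N (f - g) + N f * N (A g) / kap.
Proof.
move=> k0 Du Dg E; have sA := gen_sa gA.
have real : complex.Im (q (A u) u) = 0.
  have := congr1 (@complex.Im R) (ip_herm qP u (A u)).
  by rewrite Imconj -(sa_sym sA Du Du) => h; lra.
have nf : N f ^+ 2 = N (A u) ^+ 2 + kap ^+ 2 * N u ^+ 2.
  rewrite -E (qnormD_sqr qP) (qnormZ qP) cmodM cmodi mul1r cmod_real.
  rewrite exprMn real_normK ?num_real // (ipZr qP) !ReM !ImM real /=; ring.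
have h1 : N (A u) <= N f by apply: le_of_sqr => //; rewrite nf lerDl -exprMn sqr_ge0.
have h2 : kap * N u <= N f.
  by apply: le_of_sqr => //; rewrite nf exprMn lerDr sqr_ge0.
have -> : N (A u) ^+ 2 = complex.Re (q (A u) (f - g)) + complex.Re (q u (A g)).
  rewrite -(sa_sym sA Du Dg) -ReD -(ipDr qP) subrK -E (ipDr qP) (ipZr qP) ReD.
  by rewrite (qnorm_sqr qP) !ReM !ImM real /=; ring.
apply: lerD.
  apply: le_trans (Re_le_cmod' _) _; apply: le_trans (cauchy_schwarz qP _ _) _.
  exact: ler_wpM2r.
rewrite ler_pdivlMr //; have h3 := le_trans (Re_le_cmod' _) (cauchy_schwarz qP u (A g)).
apply: le_trans (ler_wpM2r (ltW k0) h3) _.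
by rewrite mulrAC (mulrC (N u)); apply: ler_wpM2r.
Qed.

(** The approximants are i kap (A + i kap)^-1 f with kap = om + n + 1. The factor kap / (kap - om)
    stays below 1 + om, which bounds them in the form domain; with convergence in H this is weak
    convergence there. *)
Lemma dAV_approx (f : V) : exists (x y : nat -> V) (M : R),
  [/\ forall n, dAV (x n) (y n),
      vanish \oo (fun n => N (io (x n) - io f)) &
      forall n, N (ta (x n)) <= M].
Proof.
have [om [C [om0 C0 hr]]] := gen_resolvent_V.
pose kap n : R := om + n.+1%:R.
have kom n : om < kap n by rewrite ltrDl ltr0n.
have k0 n : 0 < kap n by apply: lt_trans (kom n).
have /choice[u hu] : forall n, exists u,
   [/\ Dm (io u), A (io u) = io (f - ('i * (kap n)%:C) *: u) &
      (kap n - om) * N (ta u) <= C * N (ta f)].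
  by move=> n; exact: hr.
have sA := gen_sa gA.
have ak n : cmod ('i * (kap n)%:C) = kap n.
  by rewrite cmodM cmodi mul1r cmod_real ger0_norm // ltW.
exists (fun n => ('i * (kap n)%:C) *: u n).
exists (fun n => ('i * (kap n)%:C) *: (f - ('i * (kap n)%:C) *: u n)).
exists ((1 + om) * (C * N (ta f))); split.
- move=> n; have [Du Au _] := hu n; rewrite /dAV !(ioZ fdV) -Au.
  have [D0 DL] := sa_sub sA.
  have AZ a v : Dm v -> Dm (a *: v) /\ A (a *: v) = a *: A v.
    move=> Dv; rewrite -[a *: v]addr0; split; first exact: DL.
    rewrite (sa_lin sA) //; have := sa_lin sA 1 D0 D0.
    rewrite scaler0 addr0 scale1r => /eqP; rewrite -subr_eq subrr => /eqP <-.
    by rewrite addr0.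
  by have [] := AZ ('i * (kap n)%:C) _ Du.
- move=> e e0.
  pose F := N (io f) + 1; have F0 : 0 < F by rewrite ltr_wpDl.
  have e2 : 0 < e ^+ 2 / 2 / F by rewrite !divr_gt0 ?exprn_gt0.
  have [g Dg hg] := dense_of_perp0 qP qC (sa_sub sA) (sa_dense sA) (io f) e2.
  pose G := N (A g) + 1; have G0 : 0 < G by rewrite ltr_wpDl.
  have e3 : 0 < e ^+ 2 / 2 / F / G by rewrite !divr_gt0 ?exprn_gt0.
  have [n0 hn0] := natSinv_small e3; exists n0 => // n /= /hn0 hn.
  have [Du Au _] := hu n.
  have -> : io (('i * (kap n)%:C) *: u n) - io f = - A (io (u n)).
    by rewrite Au (ioB fdV) opprB.
  rewrite (qnormN qP); apply: lt_of_sqr; first exact: ltW.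
  have E : A (io (u n)) + ('i * (kap n)%:C) *: io (u n) = io f.
    by rewrite Au (ioB fdV) (ioZ fdV) subrK.
  apply: le_lt_trans (gen_resolvent_small (k0 n) Du Dg E) _.
  have h1 : N (io f) * N (io f - g) < e ^+ 2 / 2.
    have : F * N (io f - g) < e ^+ 2 / 2 by rewrite mulrC -ltr_pdivlMr.
    by apply: le_lt_trans; apply: ler_wpM2r => //; rewrite lerDl.
  have h2 : N (io f) * N (A g) / kap n <= e ^+ 2 / 2.
    have kn : (kap n)^-1 <= n.+1%:R^-1 by rewrite lef_pV2 ?posrE ?ltr0Sn // lerDr ltW.
    have h3 : (kap n)^-1 <= e ^+ 2 / 2 / F / G by apply: le_trans kn (ltW hn).
    have h4 : N (io f) * N (A g) <= F * G.
      by apply: ler_pM => //; rewrite lerDl.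
    have h5 : 0 <= (kap n)^-1 by rewrite invr_ge0 ltW.
    have := ler_pM (mulr_ge0 (qnorm_ge0 q (io f)) (qnorm_ge0 q (A g))) h5 h4 h3.
    have -> : F * G * (e ^+ 2 / 2 / F / G) = e ^+ 2 / 2 by field; rewrite !gt_eqF.
    by [].
  lra.
- move=> n; have [_ _ h] := hu n; rewrite (taZ fdV) (qnormZ qP) ak.
  have nn : kap n - om = n.+1%:R by rewrite /kap addrAC subrr add0r.
  rewrite nn in h; rewrite /kap mulrDl.
  have n1 : 1 <= n.+1%:R :> R by rewrite ler1n.
  have h1 : N (ta (u n)) <= C * N (ta f).
    by apply: le_trans h; rewrite ler_peMl.
  by have := ler_wpM2l (ltW om0) h1; lra.
Qed.

(** Weak density is enough because the arguments are freed one at a time: with the other one fixed,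
    the form is a bounded functional, represented by a vector. *)
Lemma form_dense (B : V -> V -> R[i]) : bform Q B ->
  (forall x x' y y', dAV x x' -> dAV y y' -> B x y = 0) ->
  forall x y, B x y = 0.
Proof.
move=> BB B0; have [M M0 hM] := bform_bound BB; have Bs := BB.1.
have half x y y' : dAV y y' -> B x y = 0.
  move=> hy; have [w hw] : exists w, forall v, B v y = Q v w.
    apply: (@riesz _ _ _ (qV_P qP fdV) (qV_C qP qC fdV) (B^~ y) (M * NV y)).
      by move=> a v v'; exact: Bs.2.
    by move=> v; rewrite mulrAC.
  have [xn [yn [M' [h1 h2 h3]]]] := dAV_approx x.
  have h : vanish \oo (fun n => cmod (Q w (xn n) - Q w x)).
    by apply: (weak_limit qP qC fdV w h2); apply: nearW; exact: h3.
  rewrite hw (ip_herm (qV_P qP fdV) w).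
  have -> : Q w x = 0; last by rewrite rmorph0.
  apply/eqP; rewrite -cmod_eq0; apply/eqP/le_anti; rewrite cmod_ge0 andbT.
  apply: (@vanish_cst _ _ \oo) => //; apply: vanish_le h; apply: nearW => n.
  rewrite (ip_herm (qV_P qP fdV) (xn n)) -hw (B0 _ _ _ _ (h1 n) hy) rmorph0 sub0r.
  by rewrite cmodN.
move=> x y; have [w hw] : exists w, forall v, B x v = Q w v.
  apply: (@lin_riesz _ _ _ qP qC _ _ _ fdV (B x) (M * NV x)).
    by move=> a v v'; exact: Bs.1.
  by move=> v.
have [yn [y'n [M' [h1 h2 h3]]]] := dAV_approx y.
have h : vanish \oo (fun n => cmod (Q w (yn n) - Q w y)).
  by apply: (weak_limit qP qC fdV w h2); apply: nearW; exact: h3.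
rewrite hw; apply/eqP; rewrite -cmod_eq0; apply/eqP/le_anti; rewrite cmod_ge0 andbT.
apply: (@vanish_cst _ _ \oo) => //; apply: vanish_le h; apply: nearW => n.
by rewrite -(hw (yn n)) (half _ _ _ (h1 n)) sub0r cmodN.
Qed.

(** Formally [WV t x - x] is the integral of i W_s A x over [0, t], with A x in the form domain; the
    mean value inequality is applied to it after testing with [ta k]. Negative times are reduced to
    positive ones by the group law. *)
Lemma wv_quot x y : dAV x y -> exists r M : R, [/\ 0 < r, 0 <= M &
  forall t, `|t| < r -> N (ta (WV t x - x)) <= M * `|t|].
Proof.
move=> [Dx yE]; have [r [K [r0 K1 hK]]] := wv_loc_bound qP qC Wu fdV WVi.
have KN0 : 0 <= K * N (ta y) by apply: mulr_ge0 => //; lra.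
have pos t : 0 <= t -> t < r -> N (ta (WV t x - x)) <= K * N (ta y) * t.
  move=> t0 tr; apply: (norm_le_test qP qC fdV); first exact: mulr_ge0.
  move=> k; rewrite -(fd_sym fdV) (ioB fdV) (wv_io WVi) (ipBr qP).
  pose phi (s : R) : R[i] := q (ta k) (W s (io x)).
  pose phi' (s : R) : R[i] := q (ta k) (W s ('i *: io y)).
  pose c := K * N (ta y) * N (io k).
  have dpsi (s : R) : is_derive s 1 (c \*: (id : R -> R)) c.
    by apply: is_derive_eq (is_deriveZ c (is_derive_id s 1)) _; rewrite /GRing.scale /= mulr1.
  have hb (s : R) : 0 <= s <= t -> cmod (phi' s) <= c.
    move=> /andP[s0 st]; rewrite /phi' (W_Z Wu) (ipZr qP) cmodM cmodi mul1r.
    rewrite -(wv_io WVi) (fd_sym fdV); apply: le_trans (cauchy_schwarz qP _ _) _.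
    rewrite mulrC; apply: ler_wpM2r => //; apply: hK.
    by rewrite ger0_norm //; exact: le_lt_trans tr.
  have := mean_value (phi := phi) (phi' := phi') (psi := c \*: id)
    (psi' := fun=> c) t0 (fun s _ => test_rderiv k s Dx (esym yE)) (fun s _ => dpsi s) hb.
  rewrite /phi (W_0 Wu) (_ : (c \*: id) t - (c \*: id) 0 = c * t); last first.
    by rewrite /GRing.scale /= /GRing.scale /= mulr0 subr0.
  move=> h; apply: le_trans h _.
  by rewrite /c mulrAC.
exists r, (K * (K * N (ta y))); split=> [//||t tr].
  by apply: mulr_ge0 => //; lra.
have [t0|t0] := leP 0 t.
  rewrite ger0_norm //; apply: le_trans (pos _ t0 _) _.
    by move: tr; rewrite ger0_norm.
  by apply: ler_wpM2r => //; rewrite ler_peMl.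
have -> : WV t x - x = - WV t (WV (- t) x - x).
  by rewrite (wv_sub Wu fdV WVi) (wv_K Wu fdV WVi) opprB.
rewrite -[- WV t _]scaleN1r (taZ fdV) scaleN1r (qnormN qP).
apply: le_trans (hK _ _ tr) _; rewrite -mulrA; apply: ler_wpM2l; first lra.
rewrite ltr0_norm //; apply: pos; first lra.
by move: tr; rewrite ltr0_norm.
Qed.
End DomainDense.

(** * Derivatives of forms along the group *)

Section FormDerivative.
Variables (R : realType) (H : lmodType R[i]) (q : H -> H -> R[i]).
Hypotheses (qP : inner_product q) (qC : qcomplete q).
Local Notation N := (qnorm q).
Variables (W : R -> H -> H) (Wu : unitary q W).
Variables (Dm : set H) (A : H -> H) (gA : is_gen q W Dm A).
Variables (V : lmodType R[i]) (io ta : V -> H).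
Hypothesis fdV : form_domain q io ta.
Local Notation Q := (qV q io ta).
Local Notation NV := (qnorm Q).
Variables (WV : R -> V -> V) (WVi : inv_group q W io ta WV).
Let QP := qV_P qP fdV.
Let QC := qV_C qP qC fdV.

Lemma vanish_eq0 (I : Type) (F : set_system I) {PF : ProperFilter F} (z : R[i]) :
  vanish F (fun=> cmod z) -> z = 0.
Proof.
move=> /vanish_cst h; apply/eqP; rewrite -cmod_eq0; apply/eqP/le_anti.
by rewrite h cmod_ge0.
Qed.

Lemma weak_lin (I : Type) (F : set_system I) {FF : Filter F} (x : I -> V)
    (l : V) (phi : V -> R[i]) (M M' : R) :
  (forall a x y, phi (a *: x + y) = a * phi x + phi y) ->
  (forall x, cmod (phi x) <= M * NV x) ->
  vanish F (fun i => N (io (x i) - io l)) ->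
  (\forall i \near F, N (ta (x i)) <= M') ->
  vanish F (fun i => cmod (phi (x i) - phi l)).
Proof.
move=> phiL phiM xl xM; have [w hw] := lin_riesz qP qC fdV phiL phiM.
apply: vanish_le (weak_limit qP qC fdV w xl xM).
by apply: nearW => i; rewrite !hw.
Qed.

Lemma weak_antilin (I : Type) (F : set_system I) {FF : Filter F} (x : I -> V)
    (l : V) (phi : V -> R[i]) (M M' : R) :
  (forall a x y, phi (a *: x + y) = (a^*)%R * phi x + phi y) ->
  (forall x, cmod (phi x) <= M * NV x) ->
  vanish F (fun i => N (io (x i) - io l)) ->
  (\forall i \near F, N (ta (x i)) <= M') ->
  vanish F (fun i => cmod (phi (x i) - phi l)).
Proof.
move=> phiL phiM xl xM.
have phiL' a y z : ((phi (a *: y + z))^*)%R = a * ((phi y)^*)%R + ((phi z)^*)%R.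
  by rewrite phiL rmorphD rmorphM /= conjCK.
have phiM' y : cmod ((phi y)^*)%R <= M * NV y by rewrite cmod_conj.
apply: vanish_le (weak_lin phiL' phiM' xl xM).
by apply: nearW => i; rewrite -rmorphB cmod_conj.
Qed.

Lemma NV_wv t : exists2 K : R, 0 < K & forall x, NV (WV t x) <= K * NV x.
Proof.
have [M hM] := wv_bd WVi t; exists (1 + `|M|); first by rewrite ltr_wpDr.
move=> x; apply: le_trans (qV_le qP _ _ _) _.
rewrite (io_norm Wu WVi) mulrDl mul1r; apply: lerD; first exact: le_io.
apply: le_trans (hM x) _; apply: le_trans (ler_wpM2r (qnorm_ge0 _ _) (ler_norm M)) _.
by apply: ler_wpM2l => //; exact: le_ta.
Qed.

Definition quot (L : V -> V -> R[i]) (t : R) (f g : V) : R[i] :=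
  (t^-1)%:C * (L (WV t f) (WV t g) - L f g).

(* [t |-> L (W_t f) (W_t g)] has derivative [i L' f g] at [0], in the norm of the
   antidual of [V] when either argument is fixed; formally [L' = [L, A]]. *)
Definition dform (L L' : V -> V -> R[i]) : Prop :=
  (forall f e, 0 < e -> \forall t \near 0^', forall g,
     cmod (quot L t f g - 'i * L' f g) <= e * NV g) /\
  (forall g e, 0 < e -> \forall t \near 0^', forall f,
     cmod (quot L t f g - 'i * L' f g) <= e * NV f).

Lemma dform_vanish L L' f g : dform L L' ->
  vanish 0^' (fun t => cmod (quot L t f g - 'i * L' f g)).
Proof.
move=> [dL _] e e0; have Ng : 0 < NV g + 1 by rewrite ltr_wpDl.
have eg : 0 < e / (NV g + 1) by rewrite divr_gt0.
apply: filterS (dL f _ eg) => t /(_ g) h; apply: le_lt_trans h _.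
by rewrite mulrAC ltr_pdivrMr // ltr_pM2l // ltrDl.
Qed.

Lemma dform_lin a L1 L1' L2 L2' : dform L1 L1' -> dform L2 L2' ->
  dform (fun f g => a * L1 f g + L2 f g) (fun f g => a * L1' f g + L2' f g).
Proof.
move=> [l1 r1] [l2 r2].
have E t f g : quot (fun f g => a * L1 f g + L2 f g) t f g -
    'i * (a * L1' f g + L2' f g) =
    a * (quot L1 t f g - 'i * L1' f g) + (quot L2 t f g - 'i * L2' f g).
  by rewrite /quot; ring.
have B x y e n : 0 <= n -> cmod x <= e / 2 / (cmod a + 1) * n ->
    cmod y <= e / 2 * n -> 0 < e -> cmod (a * x + y) <= e * n.
  move=> n0 hx hy e0; apply: le_trans (cmodD _ _) _; rewrite cmodM.
  have a1 : 0 < cmod a + 1 by rewrite ltr_wpDl // cmod_ge0.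
  have h1 : cmod a * cmod x <= e / 2 * n.
    apply: le_trans (ler_wpM2l (cmod_ge0 a) hx) _.
    rewrite mulrA; apply: ler_wpM2r => //; rewrite mulrC mulrAC ler_pdivrMr //.
    by apply: ler_wpM2l; [rewrite divr_ge0 // ltW|rewrite lerDl].
  lra.
have e1 (e : R) : 0 < e -> 0 < e / 2 / (cmod a + 1).
  by move=> e0; rewrite !divr_gt0 // ltr_wpDl // cmod_ge0.
have e2 (e : R) : 0 < e -> 0 < e / 2 by move=> e0; rewrite divr_gt0.
split=> f e e0.
  apply: filterS2 (l1 f _ (e1 _ e0)) (l2 f _ (e2 _ e0)) => t h1 h2 g.
  by rewrite E; apply: B.
apply: filterS2 (r1 f _ (e1 _ e0)) (r2 f _ (e2 _ e0)) => t h1 h2 g.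
by rewrite E; apply: B.
Qed.

Lemma dform_ext L1 L1' L2 L2' : (forall f g, L1 f g = L2 f g) ->
  (forall f g, L1' f g = L2' f g) -> dform L1 L1' -> dform L2 L2'.
Proof.
move=> e e' [l r].
have E t f g : quot L2 t f g - 'i * L2' f g = quot L1 t f g - 'i * L1' f g.
  by rewrite /quot !e e'.
split=> f a a0; first by apply: filterS (l f a a0) => t h g; rewrite E.
by apply: filterS (r f a a0) => t h g; rewrite E.
Qed.

Lemma dform_ip : dform (fun f g => q (io f) (io g)) (fun _ _ => 0).
Proof.
have E t f g : quot (fun f g => q (io f) (io g)) t f g - 'i * 0 = 0.
  by rewrite /quot !(wv_io WVi) (W_iso Wu) subrr !mulr0 subrr.
by split=> f e e0; apply: nearW => t g; rewrite E cmod0 mulr_ge0 // ltW.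
Qed.

(** Sesquilinearity passes to the limit. Each half of [dform], used at a single t where the quotient
    is bounded, bounds [L'] with one argument fixed, and separate boundedness implies joint
    boundedness. *)
Lemma dform_bform L L' : bform Q L -> dform L L' -> bform Q L'.
Proof.
move=> LB dL; have [M M0 hM] := bform_bound LB; have [Ls _] := LB.
have i0 : 'i%R != 0 :> R[i] by rewrite -cmod_eq0 -complexiE cmodi oner_eq0.
apply: (separately_bounded QP QC).
- split=> a x y z; apply/eqP; rewrite -subr_eq0; apply/eqP; apply: (mulfI i0);
    rewrite mulr0; apply: (@vanish_eq0 _ (0 : R)^').
    apply: vanish_le (vanishD (vanishD (dform_vanish z (a *: x + y) dL)
      (vanishZ (cmod_ge0 a) (dform_vanish z x dL))) (dform_vanish z y dL)).
    apply: nearW => t; rewrite -cmodM.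
    rewrite -(cmodN (quot _ _ _ (_ + _) - _)).
    apply: le_trans (lerD (cmodD _ _) (lexx _)); apply: le_trans (cmodD _ _).
    rewrite le_eqVlt; apply/orP; left; apply/eqP; congr cmod.
    by rewrite /quot (wv_lin Wu fdV WVi) !Ls.1; ring.
  apply: vanish_le (vanishD (vanishD (dform_vanish (a *: x + y) z dL)
      (vanishZ (cmod_ge0 a) (dform_vanish x z dL))) (dform_vanish y z dL)).
  apply: nearW => t; rewrite -(cmod_conj a) -cmodM.
  rewrite -(cmodN (quot _ _ (_ + _) _ - _)).
  apply: le_trans (lerD (cmodD _ _) (lexx _)); apply: le_trans (cmodD _ _).
  rewrite le_eqVlt; apply/orP; left; apply/eqP; congr cmod.
  by rewrite /quot (wv_lin Wu fdV WVi) !Ls.2; ring.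
- move=> f; have [t ht] : exists t, forall g,
      cmod (quot L t f g - 'i * L' f g) <= 1 * NV g.
    by have h := dL.1 f 1 ltr01; have := @filter_ex _ _ (Proper_dnbhs_numFieldType (0 : R)) _ h.
  have [K K0 hK] := NV_wv t.
  exists (1 + `|t^-1| * (M * (K * NV f) * K + M * NV f)) => g.
  have h1 : cmod (L' f g) <= cmod (quot L t f g - 'i * L' f g) + cmod (quot L t f g).
    rewrite -[cmod (L' f g)]mul1r -cmodi -cmodM cmod_distC.
    by apply: le_trans (cmodD _ _); rewrite subrK.
  have h2 := ht g; rewrite mul1r in h2.
  have h3 : cmod (quot L t f g) <=
      `|t^-1| * ((M * (K * NV f) * K + M * NV f) * NV g).
    rewrite cmodM cmod_real; apply: ler_wpM2l => //.
    apply: le_trans (cmodB _ _) _; rewrite mulrDl; apply: lerD; last exact: hM.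
    apply: le_trans (hM _ _) _; rewrite -!mulrA; apply: ler_wpM2l; first exact: ltW.
    rewrite [leRHS]mulrA; exact: ler_pM.
  rewrite mulrDl mul1r -mulrA; lra.
- move=> g; have [t ht] : exists t, forall f,
      cmod (quot L t f g - 'i * L' f g) <= 1 * NV f.
    by have h := dL.2 g 1 ltr01; have := @filter_ex _ _ (Proper_dnbhs_numFieldType (0 : R)) _ h.
  have [K K0 hK] := NV_wv t.
  exists (1 + `|t^-1| * (M * K * (K * NV g) + M * NV g)) => f.
  have h1 : cmod (L' f g) <= cmod (quot L t f g - 'i * L' f g) + cmod (quot L t f g).
    rewrite -[cmod (L' f g)]mul1r -cmodi -cmodM cmod_distC.
    by apply: le_trans (cmodD _ _); rewrite subrK.
  have h2 := ht f; rewrite mul1r in h2.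
  have h3 : cmod (quot L t f g) <=
      `|t^-1| * ((M * K * (K * NV g) + M * NV g) * NV f).
    rewrite cmodM cmod_real; apply: ler_wpM2l => //.
    apply: le_trans (cmodB _ _) _; rewrite mulrDl; apply: lerD; last first.
      by rewrite mulrAC; exact: hM.
    apply: le_trans (hM _ _) _.
    rewrite [leRHS](_ : _ = M * ((K * NV f) * (K * NV g))); last by ring.
    by rewrite -mulrA; apply: ler_wpM2l; [exact: ltW|exact: ler_pM].
  rewrite mulrDl mul1r -mulrA; lra.
Qed.

Lemma dAV_quot x y : dAV Dm A io x y ->
  vanish 0^' (fun t : R => N (io ((t^-1)%:C *: (WV t x - x)) - io ('i *: y))) /\
  exists M : R, \forall t \near 0^', NV ((t^-1)%:C *: (WV t x - x)) <= M.
Proof.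
move=> hxy; have [Dx yE] := hxy.
have io_eq t : io ((t^-1)%:C *: (WV t x - x)) =
    (t^-1)%:C *: (W t (io x) - io x).
  by rewrite (ioZ fdV) (ioB fdV) (wv_io WVi).
have h1 : vanish 0^' (fun t : R =>
    N (io ((t^-1)%:C *: (WV t x - x)) - io ('i *: y))).
  apply: vanish_le (gen_der gA Dx); apply: nearW => t.
  by rewrite io_eq (ioZ fdV 'i) yE.
split=> //; have [r [M [r0 M0 hM]]] := wv_quot qP qC Wu gA fdV WVi hxy.
exists (N (io ('i *: y)) + 1 + M).
have hr : \forall t \near (0 : R)^', `|t| < r by exact: dnbhs0_lt.
have hn : \forall t \near (0 : R)^', t != 0 by exact: nbhs_dnbhs_neq.
apply: filterS3 (h1 _ ltr01) hr hn => t a b t0.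
apply: le_trans (qV_le qP _ _ _) _; apply: lerD.
  have := qnormD qP (io ((t^-1)%:C *: (WV t x - x)) - io ('i *: y)) (io ('i *: y)).
  rewrite subrK; lra.
rewrite (taZ fdV) (qnormZ qP) cmod_real normfV mulrC ler_pdivrMr ?normr_gt0 //.
exact: hM.
Qed.

(** The product rule, with difference quotients that converge only weakly in the form domain. The
    mixed term is harmless: both quotients are bounded in norm, so it is of order t. *)
Lemma dform_comm L L' f f' g g' : bform Q L -> dform L L' ->
  dAV Dm A io f f' -> dAV Dm A io g g' -> L' f g = L f g' - L f' g.
Proof.
move=> LB dL hf hg; have [M M0 hM] := bform_bound LB; have [Ls _] := LB.
have [vf [Mf bf]] := dAV_quot hf; have [vg [Mg bg]] := dAV_quot hg.
set xf := (fun t : R => (t^-1)%:C *: (WV t f - f)) in vf bf.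
set xg := (fun t : R => (t^-1)%:C *: (WV t g - g)) in vg bg.
have taf : \forall t \near 0^', N (ta (xf t)) <= Mf.
  by apply: filterS bf => t; apply: le_trans; exact: le_ta.
have tag : \forall t \near 0^', N (ta (xg t)) <= Mg.
  by apply: filterS bg => t; apply: le_trans; exact: le_ta.
have c1 : vanish 0^' (fun t => cmod (L f (xg t) - L f ('i *: g'))).
  exact: weak_lin (fun a x y => Ls.1 a x y f) (hM f) vg tag.
have hM' x : cmod (L x g) <= M * NV g * NV x by rewrite mulrAC.
have c2 : vanish 0^' (fun t => cmod (L (xf t) g - L ('i *: f') g)).
  exact: (weak_antilin (phi := L^~ g) (fun a x y => Ls.2 a x y g) hM' vf taf).
have c3 : vanish 0^' (fun t : R => M * `|Mf| * `|Mg| * `|t|).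
  by apply: vanishZ; [rewrite !mulr_ge0 // ltW|exact: vanish_id].
have i0 : 'i%R != 0 :> R[i] by rewrite -cmod_eq0 -complexiE cmodi oner_eq0.
apply: (mulfI i0); apply/eqP; rewrite -subr_eq0; apply/eqP.
apply: (@vanish_eq0 _ (0 : R)^').
apply: vanish_le (vanishD (dform_vanish f g dL) (vanishD c1 (vanishD c2 c3))).
have hn : \forall t \near (0 : R)^', t != 0 by exact: nbhs_dnbhs_neq.
apply: filterS3 bf bg hn => t bf' bg' t0.
have tx (x : V) : WV t x = t%:C *: ((t^-1)%:C *: (WV t x - x)) + x.
  by rewrite scalerA -rmorphM /= mulfV // scale1r subrK.
have e3 : cmod (L (xf t) (WV t g - g)) <= M * `|Mf| * `|Mg| * `|t|.
  apply: le_trans (hM _ _) _; rewrite {1}(tx g) addrK (qnormZ QP t%:C) cmod_real.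
  have a1 : NV (xf t) <= `|Mf| by apply: le_trans bf' (ler_norm _).
  have a2 : NV (xg t) <= `|Mg| by apply: le_trans bg' (ler_norm _).
  rewrite -!mulrA; apply: ler_wpM2l; first exact: ltW.
  apply: ler_pM => //; first exact: mulr_ge0.
  by rewrite mulrC; apply: ler_wpM2r.
have qE : quot L t f g = L (xf t) (WV t g - g) + L (xf t) g + L f (xg t).
  rewrite -(sesqDr Ls) subrK /xf /xg (sesqZl Ls) (sesqZr Ls) conjCE conjc_real.
  by rewrite (sesqBl Ls) (sesqBr Ls) /quot; ring.
set X := L (xf t) (WV t g - g) in qE e3.
have -> : 'i * L' f g - 'i * (L f g' - L f' g) =
   - (quot L t f g - 'i * L' f g) + ((L f (xg t) - L f ('i *: g')) +
     ((L (xf t) g - L ('i *: f') g) + X)).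
  by rewrite qE (sesqZr Ls 'i) (sesqZl Ls 'i) conjCi; ring.
apply: le_trans (cmodD _ _) _; rewrite cmodN; apply: lerD => //.
apply: le_trans (cmodD _ _) _; apply: lerD => //.
by apply: le_trans (cmodD _ _) _; apply: lerD.
Qed.

(** Makes any bounded extension of the form commutator, whichever one a choice operator returns,
    equal to the derivative along the group. *)
Lemma comm_unique L L' B : bform Q L -> dform L L' -> bform Q B ->
  (forall f f' g g', dAV Dm A io f f' -> dAV Dm A io g g' ->
     B f g = L f g' - L f' g) ->
  forall f g, B f g = L' f g.
Proof.
move=> LB dL BB hB f g; have L'B := dform_bform LB dL.
apply/eqP; rewrite -subr_eq0; apply/eqP.
apply: (form_dense qP qC Wu gA fdV WVi (B := fun f g => B f g - L' f g)).
  split; first split=> a x y z; rewrite ?BB.1.1 ?L'B.1.1 ?BB.1.2 ?L'B.1.2; try ring.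
  have [M1 _ h1] := bform_bound BB; have [M2 _ h2] := bform_bound L'B.
  exists (M1 + M2) => x y; apply: le_trans (cmodB _ _) _.
  by rewrite !mulrDl; apply: lerD.
move=> x x' y y' hx hy.
by rewrite (hB _ _ _ _ hx hy) (dform_comm LB dL hx hy) subrr.
Qed.

End FormDerivative.

(** * Solutions of coercive form equations and the virial identity *)

Section Virial.
Variables (R : realType) (H : lmodType R[i]) (q : H -> H -> R[i]).
Hypotheses (qP : inner_product q) (qC : qcomplete q).
Local Notation N := (qnorm q).
Variables (W : R -> H -> H) (Wu : unitary q W).
Variables (Dm : set H) (A : H -> H) (gA : is_gen q W Dm A).
Variables (V : lmodType R[i]) (io ta : V -> H).
Hypothesis fdV : form_domain q io ta.
Local Notation Q := (qV q io ta).
Local Notation NV := (qnorm Q).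
Variables (WV : R -> V -> V) (WVi : inv_group q W io ta WV).
Let QP := qV_P qP fdV.
Let QC := qV_C qP qC fdV.

Definition coercive (L : V -> V -> R[i]) (theta : R[i]) (alpha : R) : Prop :=
  forall x, alpha * NV x ^+ 2 <= complex.Re (theta * L x x).

Lemma coercive_bound L theta alpha w K : coercive L theta alpha -> 0 < alpha ->
  0 <= K -> cmod (L w w) <= K * NV w -> alpha * NV w <= cmod theta * K.
Proof.
move=> Lc a0 K0 hw.
have [->|w0] := eqVneq (NV w) 0; first by rewrite mulr0 mulr_ge0 // cmod_ge0.
have Nw : 0 < NV w by rewrite lt_neqAle eq_sym w0 qnorm_ge0.
rewrite -(ler_pM2r Nw) -mulrA -expr2; apply: le_trans (Lc w) _.
apply: le_trans (Re_le_cmod' _) _; rewrite cmodM -mulrA.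
by apply: ler_wpM2l => //; exact: cmod_ge0.
Qed.

Lemma solve_right L theta alpha (f : H) : bform Q L -> coercive L theta alpha ->
  0 < alpha -> exists u, forall g, L g u = q (io g) f.
Proof.
move=> LB Lc a0; apply: (lax_milgram QP QC LB a0 Lc (M := N f)).
  by move=> a x y; rewrite (fd_io fdV) (ipDl qP) (ipZl qP).
move=> x; apply: le_trans (cauchy_schwarz qP _ _) _; rewrite mulrC.
by apply: ler_wpM2l => //; exact: le_io.
Qed.

(** The adjoint form, with multiplier the conjugate of [theta], is coercive with the same
    constant. *)
Lemma solve_left L theta alpha (f : H) : bform Q L -> coercive L theta alpha ->
  0 < alpha -> exists v, forall g, L v g = q f (io g).
Proof.
move=> [Ls [M hM]] Lc a0.
have LB' : bform Q (fun x y => ((L y x)^*)%R).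
  split; first split=> a x y z.
  - by rewrite Ls.2 rmorphD rmorphM /= conjCK.
  - by rewrite Ls.1 rmorphD rmorphM.
  by exists M => x y; rewrite cmod_conj mulrAC.
have Lc' : coercive (fun x y => ((L y x)^*)%R) ((theta^*)%R) alpha.
  by move=> x; rewrite -rmorphM Reconj; exact: Lc.
have [v hv] := solve_right f LB' Lc' a0.
by exists v => g; rewrite (ip_herm qP (io g)) -hv conjCK.
Qed.

(* [L_t^{-1} f = W_(-t) L^{-1} W_t f] is compared with [L^{-1} f] in two ways. *)
Lemma virial L L' theta alpha f u v : bform Q L -> dform q io ta WV L L' ->
  coercive L theta alpha -> 0 < alpha -> Dm f ->
  (forall g, L g u = q (io g) f) -> (forall g, L v g = q f (io g)) ->
  L' v u = q (A f) (io u) - q (io v) (A f).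
Proof.
move=> LB dL Lc a0 Df hu hv.
have L'B := dform_bform qP qC Wu fdV WVi LB dL; have Ls := LB.1.
have /choice[y hy] : forall t, exists y, forall g, L g y = q (io g) (W t f).
  by move=> t; exact: solve_right LB Lc a0.
pose x t := WV (- t) (y t).
have yu t : NV (y t - u) <= cmod theta / alpha * N (W t f - f).
  rewrite mulrAC ler_pdivlMr // mulrC; apply: (coercive_bound Lc) => //.
  rewrite {1}(sesqBr Ls) hy hu -(ipBr qP).
  apply: le_trans (cauchy_schwarz qP _ _) _; rewrite mulrC.
  by apply: ler_wpM2l => //; exact: le_io.
have yuv : vanish (0 : R)^' (fun t => NV (y t - u)).
  apply: vanish_le (nearW _ yu) _; apply: vanishZ (W_cont Wu f).
  by rewrite divr_ge0 ?cmod_ge0 // ltW.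
have xu : vanish (0 : R)^' (fun t => N (io (x t) - io u)).
  apply: vanish_le (vanishD yuv (W_cont Wu (io u))); apply: nearW => t.
  rewrite -(W_norm Wu t) (W_B Wu) /x (wv_io WVi) -(W_D Wu) subrr (W_0 Wu).
  apply: le_trans (qnorm_dist qP _ (io u) _) _.
  rewrite (qnormBC qP (io u)); apply: lerD => //.
  by rewrite -(ioB fdV); exact: le_io.
have [r [K [r0 K1 hK]]] := wv_loc_bound qP qC Wu fdV WVi.
pose M := K * (NV u + 1).
have hr : \forall t \near (0 : R)^', `|t| < r by exact: dnbhs0_lt.
have ny t : NV (y t - u) < 1 -> NV (y t) <= NV u + 1.
  by move=> h; have := qnormD QP (y t - u) u; rewrite subrK; lra.
have tax : \forall t \near (0 : R)^', N (ta (x t)) <= M.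
  apply: filterS2 hr (yuv _ ltr01) => t tr /ny h.
  apply: le_trans (hK _ _ _) _; first by rewrite normrN.
  by apply: ler_wpM2l; [lra|apply: le_trans h; exact: le_ta].
have nx : \forall t \near (0 : R)^', NV (x t) <= NV u + 1 + M.
  apply: filterS2 tax (yuv _ ltr01) => t h1 /ny h2.
  apply: le_trans (qV_le qP _ _ _) _; apply: lerD => //.
  by rewrite (io_norm Wu WVi); apply: le_trans h2; exact: le_io.
have M0 : 0 < NV u + 1 + M.
  have : 0 <= M by rewrite /M mulr_ge0 // ?addr_ge0 //; lra.
  by have := qnorm_ge0 Q u; lra.
(* Since [x t] moves with t, the uniformity of [dform] in the right argument is what counts here,
   along with the bound on [NV (x t)]. *)
have v1 : vanish (0 : R)^' (fun t => cmod (quot WV L t v (x t) - 'i * L' v (x t))).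
  move=> e e0; have e1 : 0 < e / 2 / (NV u + 1 + M) by rewrite !divr_gt0.
  apply: filterS2 nx (dL.1 v _ e1) => t h1 h2; apply: le_lt_trans (h2 _) _.
  apply: le_lt_trans (ler_wpM2l (ltW e1) h1) _.
  by rewrite divfK ?gt_eqF // ltr_pdivrMr // ltr_pMr // ltrDl.
have v2 : vanish (0 : R)^' (fun t => cmod (L' v (x t) - L' v u)).
  have [M' _ hM'] := bform_bound L'B.
  exact: (weak_lin qP qC fdV (phi := L' v) (fun a x y => L'B.1.1 a x y v) (hM' v) xu tax).
have v3 := gen_der gA Df.
pose d t := (t^-1)%:C *: (W t f - f).
(* [W t] cancels in [L (WV t v) (WV t (x t))], which the equation of [y t] evaluates to
   [q (io v) f]; the equation of v evaluates [L v (x t)]. What remains are difference quotients of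
   [W t f] alone. *)
have qE t : quot WV L t v (x t) = - (q (d t) (io (y t)) + q (io v) (d t)).
  have e1 : L (WV t v) (WV t (x t)) = q (io v) f.
    by rewrite /x (wv_K Wu fdV WVi) hy (wv_io WVi) (W_iso Wu).
  have e2 : L v (x t) = q (W t f) (io (y t)).
    by rewrite hv /x (wv_io WVi) -(W_adj Wu).
  have e3 : q (io v) (W t f) - q (io v) f = q f (io (y t)) - q (io v) f.
    by rewrite -hy hv.
  have e4 : q (io v) f = q f (io u) by rewrite -hu hv.
  rewrite /quot e1 e2 /d (ipZl qP) (ipZr qP) (ipBl qP) (ipBr qP) e3.
  by rewrite conjCE conjc_real; ring.
have v4 : vanish (0 : R)^' (fun t =>
    cmod (quot WV L t v (x t) - 'i * (q (A f) (io u) - q (io v) (A f)))).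
  have c1 : 0 <= NV u + 1 + N (io v) by rewrite !addr_ge0.
  apply: vanish_le (vanishD (vanishZ c1 v3) (vanishZ (qnorm_ge0 q (A f)) yuv)).
  apply: filterS (yuv _ ltr01) => t /ny hny.
  have -> : quot WV L t v (x t) - 'i * (q (A f) (io u) - q (io v) (A f)) =
     - (q (d t - 'i *: A f) (io (y t)) + q (io v) (d t - 'i *: A f))
     + 'i * q (A f) (io (y t) - io u).
    rewrite qE !(ipBl qP) !(ipBr qP) (ipZl qP 'i) (ipZr qP 'i) ?complexiE conjCi; ring.
  apply: le_trans (cmodD _ _) _; rewrite cmodN cmodM cmodi mul1r; apply: lerD.
    apply: le_trans (cmodD _ _) _; rewrite mulrDl; apply: lerD.
      apply: le_trans (cauchy_schwarz qP _ _) _; rewrite mulrC.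
      by apply: ler_wpM2r => //; apply: le_trans hny; exact: le_io.
    exact: cauchy_schwarz.
  apply: le_trans (cauchy_schwarz qP _ _) _; apply: ler_wpM2l => //.
  by rewrite -(ioB fdV); exact: le_io.
have i0 : 'i%R != 0 :> R[i] by rewrite -cmod_eq0 -complexiE cmodi oner_eq0.
apply: (mulfI i0); apply/eqP; rewrite -subr_eq0; apply/eqP.
apply: (@vanish_eq0 _ _ (0 : R)^').
apply: vanish_le (vanishD v1 (vanishD v2 v4)); apply: nearW => t.
set T := 'i * (q _ _ - _); set X := quot _ _ _ _ _.
have -> : 'i * L' v u - T = - (X - 'i * L' v (x t)) +
  (- ('i * (L' v (x t) - L' v u)) + (X - T)) by ring.
apply: le_trans (cmodD _ _) _; rewrite cmodN; apply: lerD => //.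
apply: le_trans (cmodD _ _) _; rewrite cmodN cmodM -complexiE cmodi mul1r.
by apply: lerD.
Qed.

End Virial.

(** * The differential inequality *)

Section Gronwall.
Variable R : realType.

(** The function n^2 + |F|^2 is differentiable even where |F| is not, and its derivative is at least
    -2K|F|(n + |F|), hence at least -3K(n^2 + |F|^2). So its product with exp(3 K r) is
    nondecreasing, and the value at 1 bounds those to its left. *)
Lemma gronwall (F dF : R -> R[i]) (K n : R) : 0 <= K -> 0 <= n ->
  (forall s, 0 < s <= 1 -> cderiv F s (dF s)) ->
  (forall s, 0 < s <= 1 -> cmod (dF s) <= K * (n + cmod (F s))) ->
  forall s, 0 < s <= 1 ->
  n ^+ 2 + cmod (F s) ^+ 2 <= (n ^+ 2 + cmod (F 1) ^+ 2) * expR (3 * K).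
Proof.
move=> K0 n0 dFs bnd s /andP[s0 s1].
pose re (r : R) : R := complex.Re (1 * F r).
pose im (r : R) : R := complex.Re (- 'i * F r).
have reE r : re r = complex.Re (F r) by rewrite /re mul1r.
have imE r : im r = complex.Im (F r).
  by rewrite /im ReM !ReN !ImN /=; ring.
pose re' (r : R) : R := complex.Re (1 * dF r).
pose im' (r : R) : R := complex.Re (- 'i * dF r).
pose e (r : R) : R := expR (3 * K * r).
pose g : R -> R := (cst (n ^+ 2) + (re * re + im * im)) * e.
pose g' (r : R) : R := (n ^+ 2 + (re r * re r + im r * im r)) * (3 * K * e r)
  + e r * (2 * (re r * re' r + im r * im' r)).
have gd r : s <= r <= 1 -> is_derive r 1 g (g' r).
  move=> /andP[sr r1]; have r01 : 0 < r <= 1 by rewrite r1 (lt_le_trans s0 sr).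
  have d1 : is_derive r 1 re (re' r) by exact: cderiv_Re (dFs r r01).
  have d2 : is_derive r 1 im (im' r) by exact: cderiv_Re (dFs r r01).
  have d3 : is_derive r 1 e (3 * K * e r) by exact: is_derive_expRZ.
  have d4 := is_deriveD (is_deriveM d1 d1) (is_deriveM d2 d2).
  have d5 := is_deriveM (is_deriveD (is_derive_cst (n ^+ 2) r 1) d4) d3.
  apply: is_derive_eq d5 _; rewrite /g' /GRing.scale /= !fctE; ring.
have sq r : re r * re r + im r * im r = cmod (F r) ^+ 2.
  by rewrite cmod_sqr reE imE !expr2.
have g0 r : s <= r <= 1 -> 0 <= g' r.
  move=> /andP[sr r1]; have r01 : 0 < r <= 1 by rewrite r1 (lt_le_trans s0 sr).
  have e0 : 0 <= e r by exact: expR_ge0.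
  have -> : g' r = e r * (3 * K * (n ^+ 2 + cmod (F r) ^+ 2) +
      2 * (re r * re' r + im r * im' r)) by rewrite /g' sq; ring.
  apply: mulr_ge0 => //; have b := bnd r r01.
  have -> : re r * re' r + im r * im' r = complex.Re ((F r)^*%R * dF r).
    rewrite reE imE /re' /im' mul1r !ReM !ReN !ImN /= Reconj Imconj; ring.
  have := Re_le_cmod ((F r)^*%R * dF r); rewrite cmodM cmod_conj ler_norml => /andP[h _].
  have c0 := cmod_ge0 (F r); have := ler_wpM2l c0 b.
  move: (cmod (F r)) c0 h => a c0 h hb.
  have sqn := mulr_ge0 K0 (sqr_ge0 (n - a)).
  have sqa := mulr_ge0 K0 (sqr_ge0 n); nra.
have := derive_nondecreasing s1 gd g0; rewrite /g !fctE !sq /e mulr1 => h.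
apply: le_trans h; rewrite ler_peMr ?addr_ge0 ?sqr_ge0 //.
by rewrite -expR0 ler_expR mulr_ge0 ?mulr_ge0 // ltW.
Qed.

End Gronwall.

(** * The regularised form and the bound on the form factor *)

Section LimitingAbsorption.
Variables (R : realType) (H : lmodType R[i]) (q : H -> H -> R[i]).
Hypotheses (qP : inner_product q) (qC : qcomplete q).
Local Notation N := (qnorm q).
Variables (W : R -> H -> H) (Wu : unitary q W).
Variables (Dm : set H) (A : H -> H) (gA : is_gen q W Dm A).
Variables (V : lmodType R[i]) (io ta : V -> H).
Hypothesis fdV : form_domain q io ta.
Local Notation Q := (qV q io ta).
Local Notation NV := (qnorm Q).
Variables (WV : R -> V -> V) (WVi : inv_group q W io ta WV).
Let QP := qV_P qP fdV.
Let QC := qV_C qP qC fdV.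

Variables (h B B2 : V -> V -> R[i]).
Hypotheses (hB : bform Q h) (dh : dform q io ta WV h B) (dB : dform q io ta WV B B2).
Variables (c1 C lam mu : R).
Hypotheses (c1_ge0 : 0 <= c1) (C_ge0 : 0 <= C) (mu_gt0 : 0 < mu)
  (lam_ge0 : 0 <= c1 * lam).
Hypothesis mourre : forall x,
  N (ta x) ^+ 2 <= complex.Re ('i * B x x) - c1 * complex.Re (h x x).
Hypothesis Im_comm : forall x, 0 <= c1 * complex.Im ('i * B x x).
Hypothesis Im_ge0 : forall x, 0 <= complex.Im (h x x).
Hypothesis comm2 : forall x, cmod (B2 x x) <= C * N (ta x) ^+ 2.

Let z : R[i] := lam%:C - 'i * mu%:C.

Let BB : bform Q B := dform_bform qP qC Wu fdV WVi hB dh.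
Let B2B : bform Q B2 := dform_bform qP qC Wu fdV WVi BB dB.

Let q0 (f g : V) : R[i] := q (io f) (io g).

Let q0B : bform Q q0.
Proof.
split; first by split=> a x y w; rewrite /q0 (fd_io fdV) ?(ip_lin qP) // (ipDl qP) (ipZl qP).
exists 1 => x y; rewrite mul1r; apply: le_trans (cauchy_schwarz qP _ _) _.
by apply: ler_pM => //; exact: le_io.
Qed.

(* the regularised form of [H - z], with [eps = s ^ 2] *)
Let L (s : R) (f g : V) : R[i] := h f g - (s ^+ 2)%:C * B f g - z * q0 f g.

Let L_B s : bform Q (L s).
Proof.
split.
  split=> a x y w; rewrite /L ?hB.1.1 ?BB.1.1 ?q0B.1.1 ?hB.1.2 ?BB.1.2 ?q0B.1.2; ring.
have [M1 m1 h1] := bform_bound hB; have [M2 m2 h2] := bform_bound BB.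
have [M3 m3 h3] := bform_bound q0B.
exists (M1 + s ^+ 2 * M2 + cmod z * M3) => x y.
have -> : (M1 + s ^+ 2 * M2 + cmod z * M3) * NV x * NV y = M1 * NV x * NV y +
    s ^+ 2 * (M2 * NV x * NV y) + cmod z * (M3 * NV x * NV y) by ring.
apply: le_trans (cmodB _ _) _; apply: lerD.
  apply: le_trans (cmodB _ _) _; apply: lerD => //.
  rewrite cmodM cmod_real ger0_norm ?sqr_ge0 //.
  by apply: ler_wpM2l => //; exact: sqr_ge0.
by rewrite cmodM; apply: ler_wpM2l => //; exact: cmod_ge0.
Qed.

Let L_d s : dform q io ta WV (L s) (fun f g => B f g - (s ^+ 2)%:C * B2 f g).
Proof.
have d0 := dform_ip Wu WVi.
have := dform_lin (- (s ^+ 2)%:C) dB (dform_lin (- z) d0 dh).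
by apply: dform_ext => f g; rewrite /L /q0; ring.
Qed.

(** Chosen so that Re (theta w) = Im w - c1 s^2 Re w, the combination that the positivity assumption
    controls. *)
Let theta (s : R) : R[i] := - 'i - (c1 * s ^+ 2)%:C.

(** Besides the terms kept on the left, the expansion contains Im h, c1 s^4 Im (i B) and c1 lam s^2
    |x|^2. Their signs come from dissipativity, from the sign of the commutator with Im h, and from
    c1 lam >= 0. *)
Let L_lower s x : s ^+ 2 * N (ta x) ^+ 2 + mu * N (io x) ^+ 2 <=
  complex.Re (theta s * L s x x).
Proof.
have m := mourre x; have i1 := Im_comm x; have i2 := Im_ge0 x.
set n2 := N (io x) ^+ 2; have n2E : q0 x x = n2%:C by rewrite /q0 (qnorm_sqr qP).
have n0 : 0 <= n2 by rewrite sqr_ge0.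
have e : complex.Re (theta s * L s x x) =
  complex.Im (h x x) + s ^+ 2 * (complex.Re ('i * B x x) - c1 * complex.Re (h x x))
  + s ^+ 2 * s ^+ 2 * (c1 * complex.Im ('i * B x x)) + mu * n2 + s ^+ 2 * (c1 * lam * n2).
  rewrite /L n2E /theta /z.
  by rewrite !(ReD, ImD, ReN, ImN, ReM, ImM) /=; ring.
rewrite e; have s0 := sqr_ge0 s.
have := ler_wpM2l s0 m; have := mulr_ge0 s0 (mulr_ge0 lam_ge0 n0).
have := mulr_ge0 (mulr_ge0 s0 s0) i1; lra.
Qed.

Let alpha (s : R) : R := Num.min (s ^+ 2) mu.

Let alpha_gt0 s : 0 < s -> 0 < alpha s.
Proof. by move=> s0; rewrite /alpha lt_min mu_gt0 exprn_gt0. Qed.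

Let L_coercive s : coercive q io ta (L s) (theta s) (alpha s).
Proof.
move=> x; apply: le_trans (L_lower s x); rewrite (qV_sqr qP) mulrDr addrC.
by apply: lerD; apply: ler_wpM2r; rewrite ?sqr_ge0 // /alpha ge_min lexx ?orbT.
Qed.

Let cmod_theta s : 0 <= s <= 1 -> cmod (theta s) <= 1 + c1.
Proof.
move=> /andP[s0 s1]; apply: le_trans (cmodB _ _) _; rewrite cmodN cmodi.
rewrite cmod_real ger0_norm; last by rewrite mulr_ge0 ?sqr_ge0.
by rewrite lerD2l ler_piMr // exprn_ile1.
Qed.

(** The assumption controls only the quadratic form; polarisation over the four units 1, -1, i, -i
    recovers the sesquilinear one, and the parallelogram identity costs the factor 2. *)
Let B2_bound x y : cmod (B2 x y) <= 2 * C * (N (ta x) ^+ 2 + N (ta y) ^+ 2).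
Proof.
have s2 := B2B.1.
have pol c : cmod c = 1 ->
    cmod (B2 (x + c *: y) (x + c *: y)) <= 2 * C * (N (ta x) ^+ 2 + N (ta y) ^+ 2).
  move=> c1'; apply: le_trans (comm2 _) _; rewrite (taD fdV) (taZ fdV).
  rewrite (mulrC 2) -mulrA; apply: ler_wpM2l => //.
  have := parallelogram qP (ta x) (c *: ta y); rewrite (qnormZ qP) c1' mul1r.
  have := sqr_ge0 (N (ta x - c *: ta y)); lra.
have E c : B2 (x + c *: y) (x + c *: y) =
    B2 x x + c * B2 x y + (c^*)%R * B2 y x + c * (c^*)%R * B2 y y.
  by rewrite (sesqDr s2) !(sesqDl s2) !(sesqZr s2) !(sesqZl s2); ring.
have i2 : 'i * 'i = -1 :> R[i] by rewrite -expr2 sqrCi.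
have p1 := pol 1; have p2 := pol (-1); have p3 := pol 'i%R; have p4 := pol (- 'i%R).
move: p1 p2 p3 p4; rewrite !cmodN -complexiE cmodi complexiE.
have -> : cmod 1 = 1 :> R by rewrite /cmod normr1.
move=> /(_ erefl) p1 /(_ erefl) p2 /(_ erefl) p3 /(_ erefl) p4.
have : cmod (4%:R%:C * B2 x y) <= 4 * (2 * C * (N (ta x) ^+ 2 + N (ta y) ^+ 2)).
  have -> : 4%:R%:C * B2 x y = (B2 (x + 1 *: y) (x + 1 *: y) -
      B2 (x + (-1) *: y) (x + (-1) *: y)) + (- 'i) * (B2 (x + 'i *: y) (x + 'i *: y)
      - B2 (x + (- 'i) *: y) (x + (- 'i) *: y)).
    rewrite !E !rmorphN rmorph1 /= conjCi rmorph_nat.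
    transitivity (2 * B2 x y + 2 * B2 y x - 2 * ('i * 'i) * B2 x y + 2 * ('i * 'i) * B2 y x).
      by rewrite i2; ring.
    by ring.
  apply: le_trans (cmodD _ _) _; rewrite cmodM cmodN -complexiE cmodi complexiE mul1r.
  have := cmodB (B2 (x + 1 *: y) (x + 1 *: y)) (B2 (x + (-1) *: y) (x + (-1) *: y)).
  have := cmodB (B2 (x + 'i *: y) (x + 'i *: y)) (B2 (x + (- 'i) *: y) (x + (- 'i) *: y)).
  lra.
by rewrite cmodM cmod_real ger0_norm // ler_pM2l.
Qed.

Section Solutions.
Variables (f : H) (f0 f1 : V).
Hypotheses (Df : Dm f) (f0E : ta f0 = f) (f1E : ta f1 = A f).
Variables (u v : R -> V).
Hypothesis hu : forall s, 0 < s -> forall g, L s g (u s) = q (io g) f.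
Hypothesis hv : forall s, 0 < s -> forall g, L s (v s) g = q f (io g).

Let F (s : R) : R[i] := q f (io (u s)).
Let n2 : R := N (io f0) ^+ 2 + N (io f1) ^+ 2.

Let n2_ge0 : 0 <= n2.
Proof. by rewrite addr_ge0 ?sqr_ge0. Qed.

Let quad s w : 0 <= s <= 1 -> cmod (L s w w) = cmod (F s) ->
  s ^+ 2 * N (ta w) ^+ 2 <= (1 + c1) * cmod (F s).
Proof.
move=> s01 E; have := L_lower s w.
have := Re_le_cmod' (theta s * L s w w); rewrite cmodM E.
have := ler_wpM2r (cmod_ge0 (F s)) (cmod_theta s01).
have := mulr_ge0 (ltW mu_gt0) (sqr_ge0 (N (io w))); lra.
Qed.

Let quad_u s : 0 < s <= 1 -> s ^+ 2 * N (ta (u s)) ^+ 2 <= (1 + c1) * cmod (F s).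
Proof.
move=> /andP[s0 s1]; apply: quad; first by rewrite ltW.
by rewrite hu // (ip_herm qP f) cmod_conj.
Qed.

Let quad_v s : 0 < s <= 1 -> s ^+ 2 * N (ta (v s)) ^+ 2 <= (1 + c1) * cmod (F s).
Proof.
move=> /andP[s0 s1]; apply: quad; first by rewrite ltW.
(* Both equations evaluate [L s (v s) (u s)], so [F s = q (io (v s)) f] and the same form factor
   controls u and v. *)
rewrite hv // /F -(hv s0 (u s)) hu //.
by rewrite (ip_herm qP f) cmod_conj.
Qed.

Let F_le s : cmod (F s) <= N (io f0) * N (ta (u s)).
Proof. by rewrite /F -f0E (fd_sym fdV); exact: cauchy_schwarz. Qed.

(** The starting value for Gronwall: at s = 1 the quadratic bound reads |S^(1/2) u|^2 <= (1 +
    c1)|F|, while |F| <= |S^(-1/2) f| |S^(1/2) u|; a factor |F| cancels. *)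
Let F1 : cmod (F 1) <= (1 + c1) * n2.
Proof.
have := quad_u (s := 1); rewrite ltr01 lexx expr1n mul1r => /(_ isT) h1.
have h2 := F_le 1; have a0 := cmod_ge0 (F 1); move: a0 h1 h2.
move: (cmod (F 1)) (N (ta (u 1))) => a t a0 h1 h2.
have h3 : a ^+ 2 <= N (io f0) ^+ 2 * ((1 + c1) * a).
  apply: le_trans (_ : (N (io f0) * t) ^+ 2 <= _).
    by rewrite !expr2; apply: ler_pM.
  by rewrite exprMn; apply: ler_wpM2l => //; exact: sqr_ge0.
have [->|an0] := eqVneq a 0; first by apply: mulr_ge0; [exact: addr_ge0|exact: n2_ge0].
have ap : 0 < a by rewrite lt_neqAle eq_sym an0.
have h4 : a <= N (io f0) ^+ 2 * (1 + c1).
  by rewrite -(ler_pM2r ap) -expr2 -mulrA.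
apply: le_trans h4 _; rewrite mulrC; apply: ler_wpM2l; first exact: addr_ge0.
by rewrite lerDl sqr_ge0.
Qed.

(** The two terms with A f contribute 2 n2 + 2 (1 + c1)|F|. The double commutator contributes 2s *
    s^2 * 2C (|S^(1/2) u|^2 + |S^(1/2) v|^2), at most 8C (1 + c1)|F| by the quadratic bounds and s
    <= 1. *)
Let K : R := (2 + 8 * C) * (1 + c1).

Let K_ge0 : 0 <= K.
Proof. by have := c1_ge0; have := C_ge0; rewrite /K; nra. Qed.

Let dF (s : R) : R[i] := (2 * s)%:C * B (v s) (u s).

Let dF_bound s : 0 < s <= 1 -> cmod (dF s) <= K * (n2 + cmod (F s)).
Proof.
move=> s01; have /andP[s0 s1] := s01.
have vir := virial qP qC Wu gA fdV WVi (L_B s) (L_d s) (L_coercive s)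
  (alpha_gt0 s0) Df (hu s0) (hv s0).
have BE : B (v s) (u s) = q (A f) (io (u s)) - q (io (v s)) (A f)
    + (s ^+ 2)%:C * B2 (v s) (u s).
  by rewrite -vir subrK.
have b1 : cmod (q (A f) (io (u s))) <= N (io f1) * N (ta (u s)).
  by rewrite -f1E (fd_sym fdV); exact: cauchy_schwarz.
have b2 : cmod (q (io (v s)) (A f)) <= N (ta (v s)) * N (io f1).
  by rewrite -f1E -(fd_sym fdV); exact: cauchy_schwarz.
have b3 := B2_bound (v s) (u s).
have qu := quad_u s01; have qv := quad_v s01.
rewrite /dF BE cmodM cmod_real ger0_norm; last by rewrite mulr_ge0 // ltW.
have b4 : cmod (q (A f) (io (u s)) - q (io (v s)) (A f) + (s ^+ 2)%:C * B2 (v s) (u s))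
   <= N (io f1) * N (ta (u s)) + N (ta (v s)) * N (io f1) +
      s ^+ 2 * (2 * C * (N (ta (v s)) ^+ 2 + N (ta (u s)) ^+ 2)).
  apply: le_trans (cmodD _ _) _; apply: lerD.
    by apply: le_trans (cmodB _ _) _; exact: lerD.
  by rewrite cmodM cmod_real ger0_norm ?sqr_ge0 // ler_wpM2l ?sqr_ge0.
have s2 : 0 <= 2 * s by lra.
apply: le_trans (ler_wpM2l s2 b4) _.
have Fge : 0 <= cmod (F s) by exact: cmod_ge0.
have n1 : N (io f1) ^+ 2 <= n2 by rewrite lerDr sqr_ge0.
move: qu qv Fge n1; rewrite /K.
move: (N (ta (u s))) (N (ta (v s))) (N (io f1)) (cmod (F s)) => tu tv a Fs qu qv Fge n1.
have c10 := c1_ge0; have C0 := C_ge0; have n20 := n2_ge0.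
have k1 : 2 * (s * (a * tu)) <= n2 + (1 + c1) * Fs.
  by have := sqr_ge0 (a - s * tu); lra.
have k2 : 2 * (s * (tv * a)) <= n2 + (1 + c1) * Fs.
  by have := sqr_ge0 (a - s * tv); lra.
have k3 : s * (s ^+ 2 * (tv ^+ 2 + tu ^+ 2)) <= 2 * (1 + c1) * Fs.
  apply: (@le_trans _ _ (s ^+ 2 * (tv ^+ 2 + tu ^+ 2))); last lra.
  by rewrite ler_piMl // mulr_ge0 ?addr_ge0 ?sqr_ge0.
have k4 := ler_wpM2l C_ge0 k3.
have k5 : 0 <= (1 + 8 * C) * c1 * n2 by rewrite !mulr_ge0 //; lra.
have k6 : 0 <= C * n2 by exact: mulr_ge0.
have k7 : 0 <= C * c1 * n2 by rewrite !mulr_ge0.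
have k8 : 0 <= c1 * n2 by rewrite mulr_ge0.
nra.
Qed.

Let M := sval (cid2 (bform_bound BB)).
Let M_gt0 : 0 < M. Proof. by rewrite /M; case: cid2. Qed.
Let B_le x y : cmod (B x y) <= M * NV x * NV y.
Proof. by rewrite /M; case: cid2. Qed.

Let L_diff s t x y : L t x y = L s x y - (t ^+ 2 - s ^+ 2)%:C * B x y.
Proof. by rewrite /L rmorphB /=; ring. Qed.

(** The difference w of two solutions solves the equation at s + r with right-hand side ((s + r)^2 -
    s^2) B u_s, and coercivity bounds it. As s + r lies between s / 2 and 3 / 2, the constants [a0],
    [T] and 3 are uniform in r. *)
Let u_diff s : 0 < s <= 1 -> exists2 c : R, 0 <= c &
  forall r, `|r| < s / 2 -> NV (u (s + r) - u s) <= c * `|r|.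
Proof.
move=> /andP[s0 s1]; have s20 : 0 < s / 2 by rewrite divr_gt0.
pose a0 := alpha (s / 2); have a00 : 0 < a0 by exact: alpha_gt0.
pose T := 1 + c1 * 4; have T0 : 0 <= T by rewrite addr_ge0 ?mulr_ge0.
have D0 : 0 <= 3 * M * NV (u s) by rewrite !mulr_ge0 // ltW.
exists (T * (3 * M * NV (u s)) / a0).
  by apply: divr_ge0; [exact: mulr_ge0|exact: ltW].
move=> r rs; have /andP[r1 r2] : - (s / 2) < r < s / 2 by rewrite -ltr_norml.
have t0 : s / 2 <= s + r by lra.
have t00 : 0 < s + r by lra.
have th : cmod (theta (s + r)) <= T.
  apply: le_trans (cmodB _ _) _; rewrite cmodN cmodi lerD2l cmod_real.
  rewrite ger0_norm; last by rewrite mulr_ge0 ?sqr_ge0.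
  by apply: ler_wpM2l => //; nra.
have al : a0 <= alpha (s + r).
  rewrite /a0 /alpha le_min !ge_min lexx orbT andbT.
  by apply/orP; left; rewrite !expr2; apply: ler_pM => //; exact: ltW.
set w := u (s + r) - u s.
have Lw : cmod (L (s + r) w w) <= 3 * M * NV (u s) * `|r| * NV w.
  have -> : L (s + r) w w = ((s + r) ^+ 2 - s ^+ 2)%:C * B w (u s).
    rewrite {2}/w (sesqBr (L_B _).1) hu // (L_diff s (s + r) w (u s)) hu //.
    by rewrite opprB addrC subrK.
  rewrite cmodM cmod_real.
  have -> : (s + r) ^+ 2 - s ^+ 2 = (2 * s + r) * r by ring.
  have h1 : `|2 * s + r| <= 3 by rewrite ger0_norm; lra.
  rewrite normrM.
  have h2 := ler_pM (normr_ge0 _) (cmod_ge0 _) h1 (B_le w (u s)).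
  have h3 := ler_wpM2l (normr_ge0 r) h2.
  by apply: le_trans (le_trans _ h3) _; rewrite le_eqVlt; apply/orP; left;
    apply/eqP; ring.
have D1 : 0 <= 3 * M * NV (u s) * `|r| by exact: mulr_ge0.
have := coercive_bound (L_coercive (s + r)) (alpha_gt0 t00) D1 Lw.
have h1 := ler_wpM2r D1 th; have h2 := ler_wpM2r (qnorm_ge0 Q w) al => h3.
rewrite mulrAC ler_pdivlMr // mulrC.
apply: le_trans (le_trans (le_trans h2 h3) h1) _.
by rewrite le_eqVlt; apply/orP; left; apply/eqP; ring.
Qed.

Let F_deriv s : 0 < s <= 1 -> cderiv F s (dF s).
Proof.
move=> s01; have [c c0 hc] := u_diff s01; have /andP[s0 s1] := s01.
have s20 : 0 < s / 2 by rewrite divr_gt0.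
pose c' := 3 * M * NV (v s) * c + M * NV (v s) * NV (u s).
have M0 := ltW M_gt0.
have c'0 : 0 <= c' by rewrite addr_ge0 // !mulr_ge0.
apply: vanish_le (vanishZ c'0 (@vanish_id R)).
have hn : \forall r \near (0 : R)^', r != 0 by exact: nbhs_dnbhs_neq.
have hs : \forall r \near (0 : R)^', `|r| < s / 2 by exact: dnbhs0_lt.
apply: filterS2 hn hs => r r0 rs.
have /andP[r1 r2] : - (s / 2) < r < s / 2 by rewrite -ltr_norml.
have t00 : 0 < s + r by lra.
(* An exact resolvent identity: [L s] and [L (s + r)], evaluated at the same pair [v s],
   [u (s + r)], give the two values of F. *)
have E : F (s + r) - F s = (r * (2 * s + r))%:C * B (v s) (u (s + r)).
  have e1 : F (s + r) = L s (v s) (u (s + r)) by rewrite hv.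
  have e2 : F s = L (s + r) (v s) (u (s + r)) by rewrite hu // /F -(hv s0) hu.
  rewrite e1 e2 (L_diff s (s + r)) opprB addrC subrK; congr (_%:C * _); ring.
have -> : (r^-1)%:C * (F (s + r) - F s) - dF s =
   (2 * s + r)%:C * B (v s) (u (s + r) - u s) + r%:C * B (v s) (u s).
  have -> : (r^-1)%:C * (F (s + r) - F s) = (2 * s + r)%:C * B (v s) (u (s + r)).
    by rewrite E mulrA -rmorphM /= mulKf.
  rewrite (sesqBr BB.1) /dF rmorphD /=; ring.
have w := hc r rs.
have h1 : `|2 * s + r| <= 3 by rewrite ger0_norm; lra.
have h2 := B_le (v s) (u (s + r) - u s).
have Mv : 0 <= M * NV (v s) by exact: mulr_ge0.
have h3 := le_trans h2 (ler_wpM2l Mv w).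
have h4 := ler_pM (normr_ge0 _) (cmod_ge0 _) h1 h3.
have h5 := ler_wpM2l (normr_ge0 r) (B_le (v s) (u s)).
apply: le_trans (cmodD _ _) _; rewrite !cmodM !cmod_real /c'.
rewrite [leRHS]mulrDl; apply: lerD.
  by apply: le_trans h4 _; rewrite le_eqVlt; apply/orP; left; apply/eqP; ring.
by rewrite [leRHS]mulrC.
Qed.

(** The inequalities 1 + (1 + c1)^2 <= (2 + c1)^2 and exp(3K) <= exp(3K)^2 make the bound from
    Gronwall and [F1] a perfect square. *)
Let F_bound s : 0 < s <= 1 -> cmod (F s) <= (2 + c1) * expR (3 * K) * n2.
Proof.
move=> s01; have := gronwall K_ge0 n2_ge0 F_deriv dF_bound s01.
have e1 : 1 <= expR (3 * K) by rewrite -expR0 ler_expR mulr_ge0 // K_ge0.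
have := F1; have a0 := cmod_ge0 (F 1); have := n2_ge0; have := c1_ge0.
move: (expR _) e1 (cmod (F 1)) a0 (cmod_ge0 (F s)) => e e1 a a0.
move: (cmod (F s)) n2 c1 => b n c b0 c0 n0 an hh.
have e0 : 0 <= e by lra.
apply: le_of_sqr; first by rewrite !mulr_ge0 //; lra.
have h1 : b ^+ 2 <= (n ^+ 2 + a ^+ 2) * e by have := sqr_ge0 n; lra.
have h2 : a ^+ 2 <= ((1 + c) * n) ^+ 2.
  by rewrite !expr2; apply: ler_pM.
have h3 : n ^+ 2 + a ^+ 2 <= ((2 + c) * n) ^+ 2.
  have : 0 <= n ^+ 2 * (1 + c) by rewrite mulr_ge0 ?sqr_ge0 //; lra.
  move: h2; rewrite !exprMn; nra.
have h4 : e <= e ^+ 2 by rewrite expr2 ler_peMr.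
have := ler_pM (addr_ge0 (sqr_ge0 n) (sqr_ge0 a)) e0 h3 h4; rewrite !exprMn; lra.
Qed.

(** With mu fixed, w = u_s - u0 satisfies L_s w = s^2 B u0. For s^2 <= mu the coercivity constant is
    s^2, so w stays bounded in the form domain; inserted into the lower bound, this makes w of order
    s in H. The rate depends on mu, the limiting bound does not. *)
Lemma lap_solutions (u0 : V) :
  (forall g, h g u0 - z * q (io g) (io u0) = q (io g) f) ->
  cmod (q f (io u0)) <= (2 + c1) * expR (3 * K) * n2.
Proof.
move=> hu0; apply/ler_addgt0Pr => e e0.
have M0 := ltW M_gt0; have mu0 := ltW mu_gt0.
have key s : 0 < s <= 1 -> s ^+ 2 <= mu ->
    mu * N (io (u s - u0)) ^+ 2 <= s ^+ 2 * ((1 + c1) * M * NV u0) ^+ 2.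
  move=> /andP[s0 s1] smu; set w := u s - u0.
  have Lw : L s w w = (s ^+ 2)%:C * B w u0.
    rewrite {2}/w (sesqBr (L_B _).1) hu // -hu0 /L /q0; ring.
  have s0' := sqr_ge0 s; have c10 : 0 <= 1 + c1 by exact: addr_ge0.
  have th : cmod (theta s) <= 1 + c1 by apply: cmod_theta; rewrite ltW.
  have D0 : 0 <= s ^+ 2 * (M * NV u0) by apply: mulr_ge0 => //; exact: mulr_ge0.
  have hL : cmod (L s w w) <= s ^+ 2 * (M * NV u0) * NV w.
    rewrite Lw cmodM cmod_real ger0_norm // -mulrA; apply: ler_wpM2l => //.
    by rewrite mulrAC; exact: B_le.
  have al : alpha s = s ^+ 2 by rewrite /alpha; apply/min_idPl.
  have := coercive_bound (L_coercive s) (alpha_gt0 s0) D0 hL.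
  rewrite al => h1.
  have h2 : NV w <= (1 + c1) * (M * NV u0).
    have s2 : 0 < s ^+ 2 by rewrite exprn_gt0.
    rewrite -(ler_pM2l s2); apply: le_trans h1 _.
    by rewrite mulrCA; apply: ler_wpM2l => //; apply: ler_wpM2r => //; exact: mulr_ge0.
  have h3 := L_lower s w; have h4 := Re_le_cmod' (theta s * L s w w).
  have h5 : mu * N (io w) ^+ 2 <= cmod (theta s) * cmod (L s w w).
    rewrite -cmodM; apply: le_trans h4; apply: le_trans h3.
    by rewrite lerDr mulr_ge0 // sqr_ge0.
  apply: le_trans h5 _.
  have h6 := ler_pM (cmod_ge0 _) (cmod_ge0 _) th hL.
  apply: le_trans h6 _.
  have h7 := ler_wpM2l (mulr_ge0 c10 D0) h2.
  have -> : (1 + c1) * (s ^+ 2 * (M * NV u0) * NV w) =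
    (1 + c1) * (s ^+ 2 * (M * NV u0)) * NV w by ring.
  apply: le_trans h7 _; rewrite le_eqVlt; apply/orP; left; apply/eqP; ring.
pose D := (1 + c1) * M * NV u0; have D0 : 0 <= D.
  by rewrite !mulr_ge0 // addr_ge0.
pose Z := (N f + 1) * (D + 1); have Z0 : 0 < Z.
  by rewrite mulr_gt0 // ltr_wpDl.
pose m := Num.min 1 mu; have m0 : 0 < m by rewrite lt_min ltr01.
have m1 : m <= 1 by rewrite ge_min lexx.
have mm : m <= mu by rewrite ge_min lexx orbT.
(* With m = min(1, mu) one has m^2 <= mu, hence |w| m <= s D, and s Z <= e m then makes |f| |w| at
   most e. *)
pose s := Num.min m (e * m / Z).
have s0 : 0 < s by rewrite lt_min m0 divr_gt0 // mulr_gt0.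
have sm : s <= m by rewrite ge_min lexx.
have se : s * Z <= e * m by rewrite -ler_pdivlMr // ge_min lexx orbT.
have s01 : 0 < s <= 1 by rewrite s0 (le_trans sm).
have smu : s ^+ 2 <= mu.
  apply: (le_trans _ mm); apply: (le_trans _ sm); rewrite expr2.
  by apply: ler_piMl; [exact: ltW|exact: le_trans sm m1].
have k := key s s01 smu; rewrite -/D in k.
have Nw : N (io (u s - u0)) * m <= s * D.
  apply: le_of_sqr; first by rewrite mulr_ge0 // ltW.
  rewrite exprMn [leRHS]exprMn; apply: (le_trans _ k); rewrite mulrC.
  apply: ler_wpM2r; first exact: sqr_ge0.
  by apply: (le_trans _ mm); rewrite expr2 ler_piMl // ltW.
have fw : N f * N (io (u s - u0)) <= e.
  rewrite -(ler_pM2r m0) -mulrA; apply: le_trans (ler_wpM2l (qnorm_ge0 q f) Nw) _.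
  apply: (le_trans _ se); rewrite mulrCA; apply: ler_wpM2l; first exact: ltW.
  by apply: ler_pM => //; rewrite lerDl.
have -> : q f (io u0) = F s - q f (io (u s - u0)).
  by rewrite /F -(ipBr qP) (ioB fdV) opprB addrC subrK.
apply: le_trans (cmodB _ _) _; apply: lerD; first exact: F_bound.
exact: le_trans (cauchy_schwarz qP _ _) fw.
Qed.

End Solutions.
Lemma limiting_absorption (f : H) (f0 f1 u0 : V) :
  Dm f -> ta f0 = f -> ta f1 = A f ->
  (forall g, h g u0 - z * q (io g) (io u0) = q (io g) f) ->
  cmod (q f (io u0)) <= (2 + c1) * expR (3 * ((2 + 8 * C) * (1 + c1))) *
    (N (io f0) ^+ 2 + N (io f1) ^+ 2).
Proof.
move=> Df f0E f1E hu0.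
have /choice[u hu] : forall s, exists u, 0 < s -> forall g, L s g u = q (io g) f.
  move=> s; have [s0|_] := ltP 0 s; last by exists 0.
  by have [u ?] := solve_right qP qC fdV f (L_B s) (L_coercive s) (alpha_gt0 s0); exists u.
have /choice[v hv] : forall s, exists v, 0 < s -> forall g, L s v g = q f (io g).
  move=> s; have [s0|_] := ltP 0 s; last by exists 0.
  by have [v ?] := solve_left qP qC fdV f (L_B s) (L_coercive s) (alpha_gt0 s0); exists v.
exact: (lap_solutions Df f0E f1E hu hv).
Qed.

End LimitingAbsorption.

(** * Concrete Hilbert spaces *)

Section Subspace.
Variables (R : realType) (H : lmodType R[i]) (G : set H).

(** The proof that [G] is a subspace is a parameter of the type, which lets the module structure be
    declared on it. *)
Record subspace_elem (HG : Defs.subspace G) := SubspaceElem {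
  elem_val :> H; elem_valP : G elem_val }.

Variable HG : Defs.subspace G.
Local Notation V := (subspace_elem HG).

HB.instance Definition _ := gen_eqMixin V.
HB.instance Definition _ := gen_choiceMixin V.

Lemma elem_val_inj : injective (@elem_val HG).
Proof.
case=> [x px] [y py] /= e; case: y / e py => py.
by congr SubspaceElem; exact: Prop_irrelevance.
Qed.

Let GD x y : G x -> G y -> G (x + y).
Proof. by move=> hx hy; have := HG.2 1 x y hx hy; rewrite scale1r. Qed.

Let GZ a x : G x -> G (a *: x).
Proof. by move=> hx; have := HG.2 a x 0 hx HG.1; rewrite addr0. Qed.

Let GN x : G x -> G (- x).
Proof. by move=> hx; rewrite -scaleN1r; exact: GZ. Qed.

Let zero : V := SubspaceElem HG HG.1.
Let opp (x : V) : V := SubspaceElem HG (GN (elem_valP x)).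
Let add (x y : V) : V := SubspaceElem HG (GD (elem_valP x) (elem_valP y)).
Let scale a (x : V) : V := SubspaceElem HG (GZ a (elem_valP x)).

Let addA : associative add.
Proof. by move=> x y z; apply: elem_val_inj; exact: addrA. Qed.
Let addC : commutative add.
Proof. by move=> x y; apply: elem_val_inj; exact: addrC. Qed.
Let add0 : left_id zero add.
Proof. by move=> x; apply: elem_val_inj; exact: add0r. Qed.
Let addN : left_inverse zero opp add.
Proof. by move=> x; apply: elem_val_inj; exact: addNr. Qed.

HB.instance Definition _ := GRing.isZmodule.Build V addA addC add0 addN.

Let scaleA a b (x : V) : scale a (scale b x) = scale (a * b) x.
Proof. by apply: elem_val_inj; exact: scalerA. Qed.
Let scale1 : left_id 1 scale.
Proof. by move=> x; apply: elem_val_inj; exact: scale1r. Qed.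
Let scaleDr : right_distributive scale +%R.
Proof. by move=> a x y; apply: elem_val_inj; exact: scalerDr. Qed.
Let scaleDl (x : V) : {morph scale^~ x : a b / a + b}.
Proof. by move=> a b; apply: elem_val_inj; exact: scalerDl. Qed.

HB.instance Definition _ :=
  GRing.Zmodule_isLmodule.Build R[i] V scaleA scale1 scaleDr scaleDl.

End Subspace.

(** * Complete normed spaces and unbounded operators in terms of the inner product *)

Section Hilbert.
Variables (R : realType) (H : completeNormedModType R[i]).
Variables (ip : {dot H for Num.conj}) (hip : hilbert_ip ip).
Local Notation q := (braket ip).
Local Notation N := (qnorm q).

Lemma braket_ip : inner_product q.
Proof.
split=> [a x y z|x y|x|x]; rewrite /braket.
- by rewrite linearDl linearZl_LR.
- by rewrite hermC expr0 mul1r.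
- by rewrite -/(braket ip x x) -hip exprn_ge0.
- by rewrite -/(braket ip x x) -hip => /eqP; rewrite expf_eq0 /= normr_eq0 => /eqP.
Qed.

Lemma norm_qnorm x : `|x| = (N x)%:C.
Proof.
apply/eqP; rewrite -(@eqrXn2 _ 2) //; last by rewrite ler0c.
by rewrite hip (qnorm_sqr braket_ip) rmorphXn.
Qed.

Lemma braket_complete : qcomplete q.
Proof.
move=> u cu; have : cvg (u @ \oo).
  apply/cauchy_cvgP/cauchy_exP => e e0.
  have re : 0 < complex.Re e by move: e0; rewrite ltcE => /andP[].
  have eE : e = (complex.Re e)%:C.
    by apply: complex_ext => //=; move: e0; rewrite ltcE /= => /andP[/eqP].
  have [n hn] := cu _ re; exists (u n); exists n => // m /= nm.
  rewrite -ball_normE /= eE norm_qnorm ltcR; exact: hn.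
move=> /cvg_ex[/= l /cvgrPdist_lt hl]; exists l => e e0.
have [|n _ hn] := hl e%:C; first by rewrite ltcR.
exists n => m nm; have := hn m nm; rewrite norm_qnorm ltcR.
by rewrite (qnormBC braket_ip).
Qed.

Lemma dense_perp0 (D : set H) x : dense D -> (forall k, D k -> q k x = 0) -> x = 0.
Proof.
move=> dD hx; apply: (qnorm_eq0 braket_ip); apply/eqP; apply: contrapT => /negP x0.
have Nx : 0 < N x by rewrite lt_neqAle eq_sym x0 qnorm_ge0.
have [||k [kb Dk]] := dD (ball x (N x)%:C).
- by exists x; apply: ballxx; rewrite ltcR.
- by apply: ball_open; rewrite ltcR.
move: kb; rewrite -ball_normE /= norm_qnorm ltcR => kb.
have := cauchy_schwarz braket_ip (x - k) x; rewrite (ipBl braket_ip) (hx _ Dk) subr0.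
rewrite (qnorm_sqr braket_ip) cmod_real ger0_norm ?sqr_ge0 // expr2.
by rewrite ler_pM2r // leNgt kb.
Qed.

Lemma adjointP (T : operator H) x : dom (adjoint ip T) x ->
  forall f, dom T f -> q x (T f) = q (adjoint ip T x) f.
Proof. by move=> dx; exact: (xgetPex 0 dx). Qed.

Lemma adjoint_eq (T : operator H) x y : dense (dom T) ->
  (forall f, dom T f -> q x (T f) = q y f) ->
  dom (adjoint ip T) x /\ adjoint ip T x = y.
Proof.
move=> dT hxy; have dx : dom (adjoint ip T) x by exists y.
split=> //; apply/eqP; rewrite -subr_eq0; apply/eqP/(dense_perp0 dT) => k Dk.
by rewrite (ip_herm braket_ip) (ipBl braket_ip) -(adjointP dx) // -hxy // subrr rmorph0.
Qed.

Lemma selfadjoint_selfadj (T : operator H) : selfadjoint ip T ->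
  selfadj q (dom T) T.
Proof.
move=> [[sT lT] dT [domE appE]]; split=> // [x|x y Dx Dy|x y hxy].
- exact: dense_perp0.
- have Dx' : dom (adjoint ip T) x by rewrite domE.
  by rewrite -(appE _ Dx') (adjointP Dx').
- have [Dx Tx] : dom (adjoint ip T) x /\ adjoint ip T x = y.
    apply: adjoint_eq => // k Dk.
    by rewrite (ip_herm braket_ip) hxy // -(ip_herm braket_ip).
  by rewrite -domE; split=> //; rewrite -appE.
Qed.

Lemma op_invP (T : operator H) g : dom (op_inv T) g ->
  dom T (op_inv T g) /\ T (op_inv T g) = g.
Proof.
move=> [x Dx Tx].
exact: (@xgetPex _ 0 [set f | dom T f /\ T f = g] (ex_intro _ x (conj Dx Tx))).
Qed.

Lemma cvg_vanish (F : R -> H) (l : H) : F t @[t --> 0^'] --> l ->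
  vanish 0^' (fun t => N (F t - l)).
Proof.
move=> /cvgrPdist_lt h e e0; have e0' : 0 < e%:C by rewrite ltcR.
by apply: filterS (h _ e0') => t; rewrite norm_qnorm ltcR (qnormBC braket_ip).
Qed.

Lemma exp_itA_unitary (A : operator H) (W : R -> H -> H) :
  is_exp_itA ip A W -> unitary q W.
Proof.
move=> [[lW iW W0 WD cW] _]; split=> // [t a x y|x]; first exact: lW.
apply: cvg_vanish; apply: cvg_within_filter.
by have := cW x 0; rewrite /continuous_at W0.
Qed.

Lemma exp_itA_gen (A : operator H) (W : R -> H -> H) : selfadjoint ip A ->
  is_exp_itA ip A W -> is_gen q W (dom A) A.
Proof.
move=> sA [_ [domE appE]]; split; first exact: selfadjoint_selfadj.
move=> f Df; have Df' : dom (generator W) f by rewrite domE.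
have h := cvg_vanish Df'; apply: vanish_le h; apply: nearW => t.
have -> : lim (('i%R * x%:C)^-1 *: (W x f - f) @[x --> 0^']) = A f by exact: appE.
have -> : (t^-1)%:C *: (W t f - f) - 'i *: A f =
    'i%R *: (('i%R * t%:C)^-1 *: (W t f - f) - A f).
  rewrite [RHS]scalerBr [in RHS]scalerA invfM mulrA mulfV ?mul1r ?fmorphV //.
  exact: neq0Ci.
by rewrite (qnormZ braket_ip) -complexiE cmodi mul1r.
Qed.

(** With f = T f0, the pairing with g is <T g, f0>, so the supremum tests f0 against the unit ball
    of the range of T. That range is dense because T is injective, as its square S is. *)
Lemma dual_norm_ge (S T : operator H) f : selfadjoint ip T -> op_injective S ->
  op_eq (op_comp T T) S -> dom (op_inv T) f ->
  N (op_inv T f) <= dual_norm ip (dom T) (fun g => `|T g|) f.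
Proof.
move=> sT Si [domS appS] /op_invP[]; set f0 := op_inv T f => Df0 Tf0.
have sa := selfadjoint_selfadj sT; have [D0 DL] := sa_sub sa.
have T0 : T 0 = 0.
  have := sa_lin sa 1 D0 D0; rewrite scaler0 addr0 scale1r => /eqP.
  by rewrite -subr_eq subrr => /eqP <-.
have TZ a x : dom T x -> dom T (a *: x) /\ T (a *: x) = a *: T x.
  move=> Dx; rewrite -[a *: x]addr0; split; first exact: DL.
  by rewrite (sa_lin sa) // T0 addr0.
rewrite /dual_norm; set D := [set _ | _ in _].
have Dge x : D x -> x <= N f0.
  move=> [g [Dg Ng] <-]; rewrite -/(cmod _) -Tf0 -(sa_sym sa) //.
  apply: le_trans (cauchy_schwarz braket_ip _ _) _.
  by move: Ng; rewrite norm_qnorm lecR => Ng; rewrite ler_piMl.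
(* Without an upper bound [sup] would return its default value. *)
have Dub : has_ubound D by exists (N f0).
have D_0 : 0 <= sup D.
  apply: ub_le_sup => //; exists 0; first by split=> //=; rewrite T0 normr0 ler01.
  by rewrite (ip0l braket_ip) normr0.
have sR : Defs.subspace (T @` dom T).
  split; first by exists 0.
  move=> a _ _ [x Dx <-] [y Dy <-]; exists (a *: x + y); first exact: DL.
  exact: sa_lin sa _ _ _ _ _.
have perp w : (forall k, (T @` dom T) k -> q k w = 0) -> w = 0.
  move=> hw; have [Dw Tw] : dom T w /\ T w = 0.
    apply: (sa_max sa) => k Dk; rewrite (ip0r braket_ip); apply: hw.
    by exists k.
  have c0 : dom (op_comp T T) 0 by split=> //=; rewrite T0.
  have cw : dom (op_comp T T) w by split=> //=; rewrite Tw.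
  apply: Si; rewrite -?domS //.
  by rewrite -(appS _ cw) -(appS _ c0) /= Tw T0.
have [->|f00] := eqVneq (N f0) 0; first exact: D_0.
have Nf0 : 0 < N f0 by rewrite lt_neqAle eq_sym f00 qnorm_ge0.
rewrite -(ler_pM2r Nf0); apply/ler_addgt0Pr => e e0.
(* Approximation within d gives |f0|^2 <= sup D * (|f0| + d) + d |f0|; this d makes the excess
   exactly e. *)
pose d := e / (sup D + N f0); have sN : 0 < sup D + N f0 by rewrite ltr_wpDl.
have d0 : 0 < d by rewrite divr_gt0.
have dE : d * (sup D + N f0) = e by rewrite divfK // gt_eqF.
have [_ [g Dg <-] hg] :=
  dense_of_perp0 braket_ip braket_complete sR perp f0 d0.
have Nd : 0 < N f0 + d by rewrite addr_gt0.
have NTg : N (T g) <= N f0 + d.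
  have := qnormB braket_ip f0 (f0 - T g); rewrite opprB addrC subrK.
  by move=> h; apply: le_trans h _; rewrite lerD2l ltW.
have Ni : 0 <= (N f0 + d)^-1 by rewrite invr_ge0 ltW.
have [Dg' Tg'] := TZ ((N f0 + d)^-1)%:C g Dg.
have h1 : cmod (q (T g) f0) <= sup D * (N f0 + d).
  rewrite -ler_pdivrMr //; apply: ub_le_sup => //.
  exists (((N f0 + d)^-1)%:C *: g).
    split=> //; rewrite norm_qnorm lecR Tg' (qnormZ braket_ip) cmod_real ger0_norm //.
    by rewrite mulrC ler_pdivrMr // mul1r.
  rewrite -/(cmod _) -Tf0 -(sa_sym sa) // Tg' (ipZl braket_ip) cmodM cmod_conj.
  by rewrite cmod_real ger0_norm // mulrC.
have h2 : N f0 ^+ 2 <= cmod (q (T g) f0) + d * N f0.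
  have -> : N f0 ^+ 2 = cmod (q f0 f0).
    by rewrite (qnorm_sqr braket_ip) cmod_real ger0_norm ?sqr_ge0.
  have := cmodD (q (T g) f0) (q (f0 - T g) f0).
  rewrite -(ipDl braket_ip) addrC subrK => h; apply: le_trans h _; rewrite lerD2l.
  apply: le_trans (cauchy_schwarz braket_ip _ _) _.
  by apply: ler_wpM2r => //; exact: ltW.
by rewrite -dE -expr2; lra.
Qed.

End Hilbert.

(** * Forms and commutators on the domain of a self-adjoint operator *)

Section ConcreteForms.
Variables (R : realType) (H : completeNormedModType R[i]).
Variables (ip : {dot H for Num.conj}) (hip : hilbert_ip ip).
Local Notation q := (braket ip).
Local Notation N := (qnorm q).
Variables (T : operator H) (sT : selfadjoint ip T).
Let sa := selfadjoint_selfadj hip sT.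
Let G := dom T.
Let GN := graph_norm T.
Let V : lmodType R[i] := subspace_elem (sa_sub sa).
Let io (x : V) : H := elem_val x.
Let ta (x : V) : H := T (elem_val x).
Let qP := braket_ip hip.
Let qC := braket_complete hip.
Local Notation Q := (qV q io ta).
Local Notation NV := (qnorm Q).

Lemma selfadjoint_form_domain : form_domain q io ta.
Proof.
split=> //.
- by move=> a x y; rewrite /ta; apply: (sa_lin sa); exact: elem_valP.
- exact: elem_val_inj.
- by move=> x y; apply: (sa_sym sa); exact: elem_valP.
- move=> x y hxy; have [Dx Tx] : dom T x /\ T x = y.
    by apply: (sa_max sa) => k Dk; exact: (hxy (SubspaceElem (sa_sub sa) Dk)).
  by exists (SubspaceElem (sa_sub sa) Dx).
- move=> x hx; apply: (sa_dense sa) => k Dk.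
  exact: (hx (SubspaceElem (sa_sub sa) Dk)).
Qed.
Let fdV := selfadjoint_form_domain.

Lemma graph_normE (x : V) : GN (io x) = (NV x)%:C.
Proof.
have E : `|io x| ^+ 2 + `|T (io x)| ^+ 2 = (NV x)%:C ^+ 2 :> R[i].
  by rewrite !(norm_qnorm hip) -[RHS]rmorphXn (qV_sqr qP) /= rmorphD /= !rmorphXn.
by rewrite /GN /graph_norm E sqrCK // ler0c.
Qed.

Lemma memG (f : H) : G f -> exists x : V, io x = f.
Proof. by move=> Gf; exists (SubspaceElem (sa_sub sa) Gf). Qed.

Definition on_dom (L : H -> H -> R[i]) (x y : V) : R[i] := L (io x) (io y).

Lemma bounded_form_bform L : bounded_form G GN L -> bform Q (on_dom L).
Proof.
move=> [Lr Ll [M hM]]; split.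
  by split=> a x y z; [apply: Lr|apply: Ll]; exact: elem_valP.
exists M => x y; rewrite -lecR -normcmod rmorphM rmorphM /= -!graph_normE.
by apply: hM; exact: elem_valP.
Qed.

Variables (A : operator H) (W : R -> H -> H).
Hypotheses (sA : selfadjoint ip A) (W_exp : is_exp_itA ip A W).
Hypothesis W_G : forall t f, G f -> G (W t f).
Variables (X : completeNormedModType R[i]) (j : H -> X).
Hypothesis X_compl : is_completion G (fun f => `|T f|) j.
Hypothesis W_X : forall t, extends_boundedly G j (W t).

Let Wu := exp_itA_unitary hip W_exp.
Let gA := exp_itA_gen hip sA W_exp.

Definition restrict_group (t : R) (x : V) : V :=
  SubspaceElem (sa_sub sa) (W_G t (elem_valP x)).
Local Notation WV := restrict_group.

Lemma restrict_inv_group : inv_group q W io ta WV.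
Proof.
split=> // t; have [U cU hU] := W_X t; have [_ jN _] := X_compl.
have /linear_boundedP := continuous_linear_bounded 0 (cU 0).
move=> /pinfty_ex_gt0[M M0 hM]; exists (complex.Re M) => x.
have ME : M = (complex.Re M)%:C.
  by apply: complex_ext => //=; move: M0; rewrite ltcE /= => /andP[/eqP].
have := hM (j (io x)); rewrite hU; last exact: elem_valP.
rewrite !jN; [|exact: elem_valP|by apply: W_G; exact: elem_valP].
by rewrite !(norm_qnorm hip) ME -rmorphM lecR.
Qed.
Let WVi := restrict_inv_group.

(** [commutator] is a choice and says something only once a candidate exists: the derivative [L'] is
    one, and [comm_unique] shows that every other candidate agrees with it on the form domain. *)
Lemma commutatorE L L' : bform Q (on_dom L) -> dform q io ta WV (on_dom L) L' ->
  forall f g : V, commutator G GN A L (io f) (io g) = L' f g.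
Proof.
move=> LB dL; have L'B := dform_bform qP qC Wu fdV WVi LB dL.
(* [L'] lives on the type [V], whereas candidates are functions on all of H; the value 0 off [G] is
   a mere filler. *)
pose B0 (f g : H) : R[i] :=
  if pselect (G f) is left Gf then
    if pselect (G g) is left Gg then
      L' (SubspaceElem (sa_sub sa) Gf) (SubspaceElem (sa_sub sa) Gg) else 0 else 0.
have B0E x y : B0 (io x) (io y) = L' x y.
  rewrite /B0; case: pselect => [Gx|]; last by case; exact: elem_valP.
  case: pselect => [Gy|]; last by case; exact: elem_valP.
  by congr L'; exact: elem_val_inj.
have ex : exists B, is_form_commutator G GN A L B.
  exists B0; split; first split.
  - move=> a f g1 g2 /memG[x <-] /memG[y1 <-] /memG[y2 <-].
    by rewrite -[a *: _ + _]/(io (a *: y1 + y2)) !B0E L'B.1.1.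
  - move=> a f1 f2 g /memG[x1 <-] /memG[x2 <-] /memG[y <-].
    by rewrite -[a *: _ + _]/(io (a *: x1 + x2)) !B0E L'B.1.2.
  - have [M hM] := L'B.2; exists M => f g /memG[x <-] /memG[y <-].
    by rewrite B0E !graph_normE normcmod -!rmorphM lecR.
  move=> f g [Af Gf /memG[f' f'E]] [Ag Gg /memG[g' g'E]].
  have [x xE] := memG Gf; have [y yE] := memG Gg.
  rewrite -xE -yE in Af f'E Ag g'E *; rewrite B0E -f'E -g'E.
  exact: (dform_comm qP qC Wu gA fdV WVi LB dL).
have [CB Ccomm] : is_form_commutator G GN A L (commutator G GN A L).
  exact: (@xgetPex _ (fun _ _ => 0) [set B | is_form_commutator G GN A L B] ex).
apply: (comm_unique qP qC Wu gA fdV WVi LB dL (B := on_dom (commutator G GN A L))).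
  exact: bounded_form_bform.
move=> f f' g g' [Df f'E] [Dg g'E].
rewrite /on_dom Ccomm /= ?f'E ?g'E //; split=> //; try exact: elem_valP.
  by rewrite -f'E; exact: elem_valP.
by rewrite -g'E; exact: elem_valP.
Qed.

Section TwiceDifferentiable.
Variable hs : bool -> H -> H -> R[i].
Hypothesis hs_adj : forall s f g, G f -> G g -> hs (~~ s) f g = ((hs s g f)^*)%R.
Hypothesis hs_C2 : forall s, form_Ck G GN W 2 (hs s).

(* [B] and [B2] are the first two derivatives at [0] of [W_(-t) h W_t], up to
   powers of ['i]; the bounds with the left argument fixed come from those for
   the adjoint form. *)
Lemma conj_realC (r : R) : (r%:C^*)%R = r%:C.
Proof. exact: conjc_real. Qed.

Lemma form_C2_dform : exists B B2 : bool -> V -> V -> R[i],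
  [/\ forall s, dform q io ta WV (on_dom (hs s)) (B s),
      forall s, dform q io ta WV (B s) (B2 s) &
      forall s f g, B (~~ s) g f = - ((B s f g)^*)%R].
Proof.
pose h s := on_dom (hs s).
have adj s x y : h (~~ s) x y = ((h s y x)^*)%R.
  by apply: hs_adj; exact: elem_valP.
have W_D' s t x : WV (s + t) x = WV s (WV t x).
  exact: (wv_D Wu fdV WVi).
have /choice[F1 hF1] : forall p : bool * V, exists F1 : R -> H -> R[i],
    (forall t e, 0 < e -> \forall r \near (0 : R)^', forall f : V,
      cmod ((r^-1)%:C * (h p.1 (WV (t + r) f) (WV (t + r) p.2) -
         h p.1 (WV t f) (WV t p.2)) - F1 t (io f)) <= e * NV f) /\
    exists F2 : R -> H -> R[i],
    (forall t e, 0 < e -> \forall r \near (0 : R)^', forall f : V,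
      cmod ((r^-1)%:C * (F1 (t + r) (io f) - F1 t (io f)) - F2 t (io f)) <= e * NV f).
  move=> [s g] /=; have [_ /(_ (io g) (elem_valP g))] := hs_C2 s.
  move=> [_ [F1 hF1 [_ [F2 hF2 _]]]]; exists F1; split.
    move=> t e e0; apply: filterS (hF1 t e e0) => r hr f.
    have := hr (io f) (elem_valP f); rewrite graph_normE normcmod -rmorphM lecR.
    by [].
  exists F2 => t e e0; apply: filterS (hF2 t e e0) => r hr f.
  by have := hr (io f) (elem_valP f); rewrite graph_normE normcmod -rmorphM lecR.
have /choice[F2 hF2] : forall p, exists F2 : R -> H -> R[i],
    (forall t e, 0 < e -> \forall r \near (0 : R)^', forall f : V,
      cmod ((r^-1)%:C * (F1 p (t + r) (io f) - F1 p t (io f)) - F2 t (io f)) <= e * NV f).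
  by move=> p; case: (hF1 p).
have W0 x : WV 0 x = x by exact: (wv_0 Wu fdV WVi).
have cvg_unif (f : V) (D : R -> V -> R[i]) : (forall e, 0 < e ->
     \forall r \near (0 : R)^', forall f : V, cmod (D r f) <= e * NV f) ->
     vanish (0 : R)^' (fun r => cmod (D r f)).
  move=> hD e e0; have Ng : 0 < NV f + 1 by rewrite ltr_wpDl.
  have eg : 0 < e / (NV f + 1) by rewrite divr_gt0.
  apply: filterS (hD _ eg) => t /(_ f) hh; apply: le_lt_trans hh _.
  by rewrite mulrAC ltr_pdivrMr // ltr_pM2l // ltrDl.
have uniq (Dq : R -> R[i]) l1 l2 :
    vanish (0 : R)^' (fun r => cmod (Dq r - l1)) ->
    vanish (0 : R)^' (fun r => cmod (Dq r - l2)) -> l1 = l2.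
  move=> v1 v2; apply/eqP; rewrite -subr_eq0; apply/eqP.
  apply: (@vanish_eq0 _ _ (0 : R)^'); apply: vanish_le (vanishD v1 v2).
  apply: nearW => r; rewrite (cmod_distC (Dq r) l1).
  by apply: le_trans (cmodD _ _); rewrite addrA subrK.
(* By the group law the derivative at time t is the one at time 0 transported by [WV t]. Hence the
   second derivative of the curve at 0 is the derivative of the form [B] along the group. *)
have F1W s g t f : F1 (s, g) t (io f) = F1 (s, WV t g) 0 (io (WV t f)).
  have [d1 _] := hF1 (s, g); have [d2 _] := hF1 (s, WV t g).
  apply: (uniq _ _ _ (cvg_unif f _ (d1 t)) _).
  have := cvg_unif (WV t f) (fun r f => (r^-1)%:C * (h s (WV (0 + r) f)
    (WV (0 + r) (WV t g)) - h s (WV 0 f) (WV 0 (WV t g))) -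
    F1 (s, WV t g) 0 (io f)) (d2 0).
  apply: vanish_le; apply: nearW => r /=.
  by rewrite add0r !W0 (addrC t) !W_D'.
pose B s f g := - 'i%R * F1 (s, g) 0 (io f).
pose B2 s f g := - F2 (s, g) 0 (io f).
have iB s f g : 'i%R * B s f g = F1 (s, g) 0 (io f).
  by rewrite /B mulrA mulrN -expr2 sqrCi opprK mul1r.
have right1 s g e : 0 < e -> \forall t \near (0 : R)^', forall f,
    cmod (quot WV (h s) t f g - 'i%R * B s f g) <= e * NV f.
  move=> e0; have [d _] := hF1 (s, g); apply: filterS (d 0 e e0) => t ht f.
  by have := ht f; rewrite add0r !W0 iB.
have right2 s g e : 0 < e -> \forall t \near (0 : R)^', forall f,
    cmod (quot WV (B s) t f g - 'i%R * B2 s f g) <= e * NV f.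
  move=> e0; apply: filterS (hF2 (s, g) 0 e e0) => t ht f.
  have := ht f; rewrite add0r /quot /B -(F1W s g t f).
  have -> : (t^-1)%:C * (- 'i * F1 (s, g) t (io f) - - 'i * F1 (s, g) 0 (io f))
     - 'i%R * B2 s f g = - 'i * ((t^-1)%:C * (F1 (s, g) t (io f) - F1 (s, g) 0 (io f))
       - F2 (s, g) 0 (io f)) by rewrite /B2; ring.
  by rewrite cmodM cmodN -complexiE cmodi mul1r.
have lim_right (L L' : V -> V -> R[i]) f g : (forall e, 0 < e ->
     \forall t \near (0 : R)^', forall f, cmod (quot WV L t f g - 'i%R * L' f g) <= e * NV f) ->
     vanish (0 : R)^' (fun t => cmod (quot WV L t f g - 'i%R * L' f g)).
  exact: (cvg_unif f (fun t f => quot WV L t f g - 'i%R * L' f g)).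
have iconj (w : R[i]) : ('i%R * w)^*%R = - ('i%R * w^*%R).
  by rewrite rmorphM /= conjCi mulNr.
have quotC s t f g : quot WV (h (~~ s)) t f g = (quot WV (h s) t g f)^*%R.
  by rewrite /quot !adj rmorphM rmorphB /= conj_realC.
have Badj s f g : B (~~ s) g f = - (B s f g)^*%R.
  have i0 : 'i%R != 0 :> R[i] by exact: neq0Ci.
  apply: (mulfI i0); rewrite mulrN -iconj.
  apply: uniq (lim_right _ _ g f (right1 (~~ s) f)) _.
  apply: vanish_le (lim_right _ _ f g (right1 s g)); apply: nearW => t.
  by rewrite quotC -rmorphB cmod_conj.
have quotBC s t f g : quot WV (B (~~ s)) t f g = - (quot WV (B s) t g f)^*%R.
  rewrite /quot !Badj; move: (B s _ _) (B s _ _) => b1 b2.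
  by rewrite rmorphM rmorphB /= conj_realC; ring.
have B2adj s f g : B2 (~~ s) g f = (B2 s f g)^*%R.
  have i0 : 'i%R != 0 :> R[i] by exact: neq0Ci.
  apply: (mulfI i0); rewrite -[RHS]opprK -iconj.
  apply: uniq (lim_right _ _ g f (right2 (~~ s) f)) _.
  apply: vanish_le (lim_right _ _ f g (right2 s g)); apply: nearW => t.
  by rewrite quotBC opprK addrC -rmorphB cmod_conj cmod_distC.
exists B, B2; split=> // s; split=> f e e0; [|exact: right1| |exact: right2].
  apply: filterS (right1 (~~ s) f e e0) => t ht g.
  have := ht g; rewrite quotC Badj mulrN -iconj -rmorphB cmod_conj.
  by [].
apply: filterS (right2 (~~ s) f e e0) => t ht g.
have := ht g; rewrite quotBC B2adj -[X in - _ - X]opprK -iconj opprK.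
by rewrite addrC -rmorphB cmod_conj cmod_distC.
Qed.

End TwiceDifferentiable.
End ConcreteForms.

(** * Resolvents *)

Section Resolvent.
Variables (R : realType) (H : completeNormedModType R[i]).
Variables (ip : {dot H for Num.conj}) (hip : hilbert_ip ip).
Local Notation q := (braket ip).
Local Notation N := (qnorm q).
Let qP := braket_ip hip.
Let qC := braket_complete hip.

Lemma qcvg_cvg (u : nat -> H) l : qcvg q u l -> u @ \oo --> l.
Proof.
move=> ul; apply/cvgrPdist_lt => e e0.
have re : 0 < complex.Re e by move: e0; rewrite ltcE => /andP[].
have eE : e = (complex.Re e)%:C.
  by apply: complex_ext => //=; move: e0; rewrite ltcE /= => /andP[/eqP].
have [n hn] := ul _ re; exists n => // m /= nm.
by rewrite eE (norm_qnorm hip) ltcR (qnormBC qP); exact: hn.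
Qed.

Lemma bijective_resolvent (T : operator H) (z : R[i]) (alpha : R) :
  linear_op T -> 0 < alpha ->
  (forall f, dom T f -> alpha * N f <= N (T f - z *: f)) ->
  (forall w, exists2 f, dom T f & T f - z *: f = w) ->
  in_resolvent_set T z /\ forall f, dom T (op_inv (op_shift T z) f) /\
    T (op_inv (op_shift T z) f) - z *: op_inv (op_shift T z) f = f.
Proof.
move=> [[D0 DL] TL] a0 low onto.
have inv f : dom T (op_inv (op_shift T z) f) /\
    T (op_inv (op_shift T z) f) - z *: op_inv (op_shift T z) f = f.
  have := @op_invP _ _ (op_shift T z) f; apply.
  by have [g Dg Tg] := onto f; exists g.
split=> //; split.
- move=> f g /= Df Dg E.
  have dE : - 1 *: g + f = f - g by rewrite scaleN1r addrC.
  have Dfg : dom T (f - g) by rewrite -dE; exact: DL.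
  have TE : T (f - g) = T f - T g by rewrite -dE TL // scaleN1r addrC.
  apply/eqP; rewrite -subr_eq0; apply/eqP/(qnorm_eq0 qP); apply/le_anti.
  rewrite qnorm_ge0 andbT -(ler_pM2l a0) mulr0.
  have := low _ Dfg; rewrite TE scalerBr opprB [z *: g - _]addrC addrACA E.
  by rewrite addrACA subrr addNr addr0 (qnorm0 qP).
- by apply/seteqP; split=> // f _; have [g Dg Tg] := onto f; exists g.
exists alpha^-1 => f; have [Di Ei] := inv f.
rewrite !(norm_qnorm hip) -rmorphM lecR mulrC ler_pdivlMr // mulrC.
by rewrite -{2}Ei; exact: low.
Qed.

Variables (T Tm : operator H) (D : set H).
Hypotheses (T_lin : linear_op T) (Tm_lin : linear_op Tm) (T_closed : closed_op T).
Hypotheses (T_dense : dense (dom T)) (T_dom : dom T = D) (Tm_dom : dom Tm = D).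
Hypothesis T_adj : op_eq (adjoint ip T) Tm.
Hypothesis T_diss : forall f, D f -> 0 <= complex.Im (q f (T f)).
Variables (z : R[i]).
Hypothesis z_im : complex.Im z < 0.

Let adjD f g : D f -> D g -> q f (T g) = q (Tm f) g.
Proof.
move=> Df Dg; have [dE aE] := T_adj.
have Da : dom (adjoint ip T) f by rewrite dE Tm_dom.
by rewrite -(aE _ Da); apply: adjointP => //; rewrite T_dom.
Qed.

Let adj_max f g : (forall k, D k -> q f (T k) = q g k) -> D f /\ Tm f = g.
Proof.
move=> hfg; have [dE aE] := T_adj.
have [Da Ea] : dom (adjoint ip T) f /\ adjoint ip T f = g.
  by apply: (adjoint_eq hip) => // k; rewrite T_dom; exact: hfg.
by split; [rewrite -Tm_dom -dE|rewrite -(aE _ Da)].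
Qed.

Let lower_of_Im (x y : H) : - complex.Im z * N x ^+ 2 <= `|complex.Im (q x y)| ->
  - complex.Im z * N x <= N y.
Proof.
move=> h; have [->|x0] := eqVneq (N x) 0; first by rewrite mulr0.
have Nx : 0 < N x by rewrite lt_neqAle eq_sym x0 qnorm_ge0.
rewrite -(ler_pM2l Nx) mulrCA -expr2; apply: le_trans h _.
exact: le_trans (Im_le_cmod _) (cauchy_schwarz qP _ _).
Qed.

Let T_lower f : D f -> - complex.Im z * N f <= N (T f - z *: f).
Proof.
move=> Df; apply: lower_of_Im; apply: le_trans (ler_norm _).
rewrite (ipBr qP) (ipZr qP) ImD ImN (qnorm_sqr qP) ImM /= mulr0 add0r.
by have := T_diss Df; lra.
Qed.

(** For Im z < 0 dissipativity gives |Im z| |f| <= |(T - z) f|. If w is orthogonal to the range,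
    then Tm w = conj(z) w, so <w, T w> = z |w|^2 has nonnegative imaginary part only if w = 0. *)
Lemma dissipative_resolvent : in_resolvent_set T z /\
  forall f, D (op_inv (op_shift T z) f) /\
    T (op_inv (op_shift T z) f) - z *: op_inv (op_shift T z) f = f.
Proof.
have z0 : 0 < - complex.Im z by rewrite oppr_gt0.
rewrite -{1}T_dom; apply: (bijective_resolvent T_lin z0).
  by move=> f; rewrite T_dom; exact: T_lower.
have [sD lT] := T_lin.
have BL : linear_on (dom T) (fun f => T f - z *: f).
  move=> a x y Dx Dy; rewrite lT // scalerDr scalerBr !scalerA (mulrC a z).
  by rewrite opprD addrACA.
apply: (onto qC qP qC (Dm := dom T) (B := fun f => T f - z *: f) sD BL z0).
- move=> u l w Du ul Bw.
  have cu := qcvg_cvg ul.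
  have cT : (fun n => T (u n)) @ \oo --> w + z *: l.
    have zu : (fun n => z *: u n) @ \oo --> z *: l.
      by apply: cvgZ; [exact: cvg_cst|exact: cu].
    have -> : (fun n => T (u n)) = (fun n => (T (u n) - z *: u n) + z *: u n).
      by apply/funext => n; rewrite subrK.
    exact: cvgD (qcvg_cvg Bw) zu.
  have [Dl Tl] : dom T l /\ w + z *: l = T l.
    have := @closed_cvg _ _ \oo _ (fun n => (u n, T (u n)))
      (fun v : H * H => dom T v.1 /\ v.2 = T v.1) T_closed _ (l, w + z *: l).
    apply; first by apply: nearW => n; split=> //; exact: Du.
    exact: cvg_pair cu cT.
  by split=> //; rewrite -Tl addrK.
- by move=> f; rewrite T_dom; exact: T_lower.
move=> w hw; have [Dw Tw] : D w /\ Tm w = (z^*)%R *: w.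
  apply: adj_max => k Dk; rewrite (ipZl qP) conjCK.
  have := hw k; rewrite T_dom => /(_ Dk); rewrite (ip_herm qP w) (ipBr qP) (ipZr qP).
  by move=> /eqP; rewrite fmorph_eq0 subr_eq0 => /eqP.
have := T_diss Dw; rewrite adjD // Tw (ipZl qP) conjCK (qnorm_sqr qP) ImM /=.
rewrite mulr0 add0r => h; apply: (qnorm_eq0 qP); apply/eqP; rewrite -(@sqrf_eq0 R).
by apply/eqP/le_anti; rewrite sqr_ge0 andbT -(ler_pM2l z0) mulr0; lra.
Qed.

(** Provides the sign -: Riesz applied to x |-> <f, (T - z)^-1 x> yields a solution u of (Tm - conj
    z) u = f, so the resolvent of Tm is the adjoint of that of T and has the conjugate diagonal
    values. *)
Lemma adjoint_resolvent : in_resolvent_set Tm (z^*)%R /\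
  forall f, q f (op_inv (op_shift Tm (z^*)%R) f) =
    ((q f (op_inv (op_shift T z) f))^*)%R.
Proof.
have z0 : 0 < - complex.Im z by rewrite oppr_gt0.
have [rT hR] := dissipative_resolvent; set Rz := op_inv (op_shift T z) in hR *.
have [[D0 DL] TL] := T_lin.
have low f : D f -> - complex.Im z * N f <= N (Tm f - (z^*)%R *: f).
  move=> Df; apply: lower_of_Im; rewrite -normrN; apply: le_trans (ler_norm _).
  rewrite (ipBr qP) (ipZr qP) (ip_herm qP (Tm f)) -adjD // ImD !ImN Imconj.
  rewrite (qnorm_sqr qP) ImM Imconj /= mulr0 add0r.
  by have := T_diss Df; lra.
have Rn f : - complex.Im z * N (Rz f) <= N f.
  by have [Df Ef] := hR f; rewrite -{2}Ef; exact: T_lower.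
have Rinj f g : D f -> T f - z *: f = g -> Rz g = f.
  move=> Df Ef; have [inj _ _] := rT; have [Dg Eg] := hR g.
  have Dg' : dom T (Rz g) by rewrite T_dom.
  have Df' : dom T f by rewrite T_dom.
  exact: inj Dg' Df' (etrans Eg (esym Ef)).
have RL a x y : Rz (a *: x + y) = a *: Rz x + Rz y.
  have [Dx Ex] := hR x; have [Dy Ey] := hR y.
  rewrite -T_dom in Dx Dy; apply: Rinj; first by rewrite -T_dom; exact: DL.
  transitivity (a *: (T (Rz x) - z *: Rz x) + (T (Rz y) - z *: Rz y)).
    rewrite TL // [z *: (_ + _)]scalerDr [a *: (_ - _)]scalerBr !scalerA.
    by rewrite (mulrC a z) opprD addrACA.
  by rewrite Ex Ey.
have main f : exists2 u, D u & Tm u - (z^*)%R *: u = f /\ forall x, q u x = q f (Rz x).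
  have phiL a x y : (q f (Rz (a *: x + y)))^*%R =
      (a^*)%R * (q f (Rz x))^*%R + (q f (Rz y))^*%R.
    by rewrite RL (ip_lin qP) rmorphD rmorphM.
  have phiM x : cmod (q f (Rz x))^*%R <= N f / (- complex.Im z) * N x.
    rewrite cmod_conj; apply: le_trans (cauchy_schwarz qP _ _) _.
    rewrite mulrAC -mulrA; apply: ler_wpM2l => //.
    by rewrite ler_pdivlMr // mulrC.
  have [u hu] := riesz (phi := fun x => (q f (Rz x))^*%R) qP qC phiL phiM.
  have hu' x : q u x = q f (Rz x) by rewrite (ip_herm qP x) -hu conjCK.
  have [Du Eu] : D u /\ Tm u = f + (z^*)%R *: u.
    apply: adj_max => k Dk; rewrite (ipDl qP) (ipZl qP) conjCK.
    have := hu' (T k - z *: k); rewrite (Rinj k) // => <-.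
    by rewrite (ipBr qP) (ipZr qP) subrK.
  by exists u => //; rewrite Eu addrK.
have Tm_onto w : exists2 f, dom Tm f & Tm f - (z^*)%R *: f = w.
  by have [u Du [Eu _]] := main w; exists u; rewrite ?Tm_dom.
have Tm_low f : dom Tm f -> - complex.Im z * N f <= N (Tm f - (z^*)%R *: f).
  by rewrite Tm_dom; exact: low.
have [rm hm] := bijective_resolvent Tm_lin z0 Tm_low Tm_onto.
split=> // f; have [u Du [Eu hu]] := main f.
have [inj _ _] := rm; have [Dm Em] := hm f.
have -> : op_inv (op_shift Tm (z^*)%R) f = u.
  have Du' : dom Tm u by rewrite Tm_dom.
  exact: inj Dm Du' (etrans Em (esym Eu)).
by rewrite (ip_herm qP u) hu.
Qed.

End Resolvent.

(** * From the operators of the statement to the form estimate *)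

Lemma bform_lin (R : realType) (V : lmodType R[i]) (Q L1 L2 : V -> V -> R[i])
    (a : R[i]) : bform Q L1 -> bform Q L2 -> bform Q (fun x y => a * L1 x y + L2 x y).
Proof.
move=> B1 B2; have [M1 _ h1] := bform_bound B1; have [M2 _ h2] := bform_bound B2.
split; first by split=> b x y w; rewrite ?B1.1.1 ?B2.1.1 ?B1.1.2 ?B2.1.2; ring.
exists (cmod a * M1 + M2) => x y; apply: le_trans (cmodD _ _) _.
rewrite cmodM !mulrDl; apply: lerD => //.
by rewrite -!mulrA; apply: ler_wpM2l; rewrite ?mulrA.
Qed.

Lemma half_real (R : realType) : (2^-1 : R[i]) = (2^-1 : R)%:C.
Proof. by rewrite fmorphV rmorph_nat. Qed.

Lemma inv_2i (R : realType) : (2 * 'i%R)^-1 = - ((2^-1 : R)%:C * 'i%R) :> R[i].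
Proof. by rewrite invfM half_real mulrC invCi mulNr mulrC. Qed.

Theorem theoremB1 (R : realType) (H : completeNormedModType R[i])
  (ip : {dot H for Num.conj}) (hip : hilbert_ip ip)
  (E : Type) (D G : set H)
  (Hpm : bool -> E -> operator H)
  (H_lin : forall s p, linear_op (Hpm s p))
  (H_closed : forall s p, closed_op (Hpm s p))
  (H_dense : forall s p, dense (dom (Hpm s p)))
  (H_dom : forall s p, dom (Hpm s p) = D)
  (H_adj : forall p, op_eq (adjoint ip (Hpm true p)) (Hpm false p))
  (H_diss : forall p f, D f -> 0 <= complex.Im (braket ip f (Hpm true p f)))
  (* S and its square root; G = D(S^{1/2}) *)
  (S sqrtS : operator H)
  (S_sa : selfadjoint ip S)
  (S_ge0 : nonneg_op ip S)
  (S_inj : op_injective S)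
  (S_sqrt : is_sqrt_op ip S sqrtS)
  (G_def : G = dom sqrtS)
  (D_sub_G : D `<=` G)
  (X : completeNormedModType R[i]) (j : H -> X)
  (X_compl : is_completion G (fun f => `|sqrtS f|) j)
  (* A and W_t = exp(itA) *)
  (A : operator H) (W : R -> H -> H)
  (A_sa : selfadjoint ip A)
  (W_exp : is_exp_itA ip A W)
  (S_C1 : op_C1 W S)
  (W_G : forall t f, G f -> G (W t f))
  (W_X : forall t, extends_boundedly G j (W t))
  (* the extensions of H^+(p), H^-(p) to B(G, G^* ), as forms on G *)
  (h : E -> bool -> H -> H -> R[i])
  (h_ext : forall p s f g, G f -> D g -> h p s f g = braket ip f (Hpm s p g))
  (h_adj : forall p f g, G f -> G g -> h p false f g = ((h p true g f)^*)%R)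
  (h_C2 : forall p s, form_Ck G (graph_norm sqrtS) W 2 (h p s))
  (H_comm : exists c : R, forall p s f g,
     D f -> dom A f -> D g -> dom A g ->
     `|braket ip (Hpm (~~ s) p f) (A g) - braket ip (A f) (Hpm s p g)|
       <= c%:C * (`|f| * `|Hpm s p g + (pm R s * 'i) *: g|))
  (c1 : R) (c1_ge0 : 0 <= c1)
  (mourre : forall p f, G f ->
     `|sqrtS f| ^+ 2 <=
       'i * commutator G (graph_norm sqrtS) A (form_Re (h p)) f f
       - c1%:C * form_Re (h p) f f)
  (Im_comm : forall p s f, G f ->
     0 <= pm R s * (c1%:C *
       ('i * commutator G (graph_norm sqrtS) A (form_Im (h p) s) f f)))
  (Im_ge0 : forall p s f, G f -> 0 <= pm R s * form_Im (h p) s f f)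
  (H_comm2 : exists2 C : R, 0 < C & forall p s f, G f ->
     `|commutator G (graph_norm sqrtS) A
         (commutator G (graph_norm sqrtS) A (h p s)) f f|
       <= C%:C * `|sqrtS f| ^+ 2) :
  let Sstar_norm := dual_norm ip G (fun g => `|sqrtS g|) in
  exists c mu0 : R, [/\ 0 < c, 0 < mu0 &
    forall (p : E) (s : bool) (lam mu : R) (f : H),
      0 < mu < mu0 -> (0 < c1 -> 0 <= lam) ->
      dom A f -> dom (op_inv sqrtS) f -> dom (op_inv sqrtS) (A f) ->
      let z := lam%:C - pm R s * ('i * mu%:C) in
      [/\ in_resolvent_set (Hpm s p) z,
          `|braket ip f (op_inv (op_shift (Hpm s p) z) f)|
            <= c%:C * (`|op_inv sqrtS f| ^+ 2 + `|op_inv sqrtS (A f)| ^+ 2) &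
          c%:C * (`|op_inv sqrtS f| ^+ 2 + `|op_inv sqrtS (A f)| ^+ 2)
            <= (c * (Sstar_norm f ^+ 2 + Sstar_norm (A f) ^+ 2))%:C]].
Proof.
subst G.
have qP := braket_ip hip; have qC := braket_complete hip.
have [saT T_ge0 TT] := S_sqrt.
have Wu := exp_itA_unitary hip W_exp; have gA := exp_itA_gen hip A_sa W_exp.
have fdV := selfadjoint_form_domain hip saT.
have WVi := restrict_inv_group hip saT W_G X_compl W_X.
have [C C0 hC] := H_comm2.
pose V : lmodType R[i] := subspace_elem (sa_sub (selfadjoint_selfadj hip saT)).
pose io (x : V) : H := elem_val x.
pose K := (2 + c1) * expR (3 * ((2 + 8 * C) * (1 + c1))).
have K0 : 0 < K by rewrite mulr_gt0 ?expR_gt0 // ltr_wpDr.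
have resp (lam mu : R) (mu0 : 0 < mu) : complex.Im (lam%:C - 'i * mu%:C) < 0.
  by rewrite ImD ImN ImM /= mul0r mul1r !add0r oppr_lt0.
have rp p := dissipative_resolvent hip (H_lin true p) (H_closed true p)
  (H_dense true p) (H_dom true p) (H_dom false p) (H_adj p) (H_diss p).
have rm p := adjoint_resolvent hip (H_lin true p) (H_lin false p) (H_closed true p)
  (H_dense true p) (H_dom true p) (H_dom false p) (H_adj p) (H_diss p).
(* Only the sign + is estimated; for the sign - the quadratic form of the resolvent is the complex
   conjugate, by [rm]. *)
have main p (lam mu : R) f : 0 < mu -> (0 < c1 -> 0 <= lam) ->
    dom A f -> dom (op_inv sqrtS) f -> dom (op_inv sqrtS) (A f) ->
    cmod (braket ip f (op_inv (op_shift (Hpm true p) (lam%:C - 'i * mu%:C)) f)) <=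
    K * (qnorm (braket ip) (op_inv sqrtS f) ^+ 2 +
         qnorm (braket ip) (op_inv sqrtS (A f)) ^+ 2).
  move=> mu0 lam0 Df /op_invP[Gf0 f0E] /op_invP[Gf1 f1E].
  set z := lam%:C - 'i * mu%:C.
  have hadj s x y : dom sqrtS x -> dom sqrtS y ->
      h p (~~ s) x y = ((h p s y x)^*)%R.
    case: s => Gx Gy /=; first exact: h_adj.
    by rewrite (h_adj p _ _ Gy Gx) conjCK.
  have [B [B2 [dB dB2 Badj]]] :=
    form_C2_dform hip saT W_exp W_G X_compl W_X hadj (h_C2 p).
  have hB s := bounded_form_bform hip saT (h_C2 p s).1.
  have BB s := dform_bform qP qC Wu fdV WVi (hB s) (dB s).
  have comm L L' := @commutatorE _ _ _ hip _ saT _ _ A_sa W_exp W_G _ _ X_compl W_X L L'.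
  have commB s x y : commutator (dom sqrtS) (graph_norm sqrtS) A (h p s)
      (io x) (io y) = B s x y by exact: comm.
  have commB2 s x y : commutator (dom sqrtS) (graph_norm sqrtS) A
      (commutator (dom sqrtS) (graph_norm sqrtS) A (h p s)) (io x) (io y) = B2 s x y.
    apply: comm; set L := on_dom _; have -> : L = B s; try exact: BB; try exact: dB2;
      by apply/funext => v; apply/funext => w; exact: commB.
  have comm_lin a b L x y : (forall v w : V, L (io v) (io w) =
        a * h p true (io v) (io w) + b * h p false (io v) (io w)) ->
      commutator (dom sqrtS) (graph_norm sqrtS) A L (io x) (io y) =
      a * B true x y + b * B false x y.
    move=> LE.
    (* [b] is split as (b - 1) + 1 to match the shape a * L1 + L2 of [bform_lin] and [dform_lin]. *)
    have LE2 : (fun v w : V => a * on_dom (h p true) v w +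
        ((b - 1) * on_dom (h p false) v w + on_dom (h p false) v w)) = on_dom L.
      by apply/funext => v; apply/funext => w; rewrite /on_dom LE; ring.
    rewrite (comm L (fun v w => a * B true v w + ((b - 1) * B false v w + B false v w))).
    - by ring.
    - by rewrite -LE2; apply: bform_lin => //; exact: bform_lin.
    - by rewrite -LE2; apply: dform_lin => //; exact: dform_lin.
  have hbar (x : V) : h p false (io x) (io x) = ((h p true (io x) (io x))^*)%R.
    by apply: h_adj; exact: elem_valP.
  (* With this and [hbar], i times the commutators of the real and imaginary parts have on the
     diagonal the values Re (i B) and Im (i B). *)
  have Bbar (x : V) : B false x x = - ((B true x x)^*)%R by exact: (Badj true x x).
  have lam1 : 0 <= c1 * lam.
    have [->|c10] := eqVneq c1 0; first by rewrite mul0r.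
    by apply: mulr_ge0 => //; apply: lam0; rewrite lt_neqAle eq_sym c10.
  have mourre' (x : V) : qnorm (braket ip) (sqrtS (io x)) ^+ 2 <=
      complex.Re ('i * B true x x) - c1 * complex.Re (h p true (io x) (io x)).
    have := mourre p (io x) (elem_valP x).
    rewrite (comm_lin (2^-1) (2^-1)) => [|v w]; last by rewrite /form_Re; ring.
    rewrite /form_Re hbar Bbar half_real (norm_qnorm hip) lecE => /andP[_].
    rewrite !(ReD, ImD, ReN, ImN, ReM, ImM, Reconj, Imconj) /=; lra.
  have form_ImE x y : form_Im (h p) true x y =
     - ((2^-1 : R)%:C * 'i%R) * h p true x y + ((2^-1 : R)%:C * 'i%R) * h p false x y.
    by rewrite /form_Im /pm mul1r inv_2i; ring.
  have Im_comm' (x : V) : 0 <= c1 * complex.Im ('i * B true x x).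
    have := Im_comm p true (io x) (elem_valP x).
    rewrite (comm_lin _ _ _ _ _ (fun v w => form_ImE (io v) (io w))).
    rewrite /pm mul1r Bbar lecE => /andP[_].
    rewrite !(ReD, ImD, ReN, ImN, ReM, ImM, Reconj, Imconj) /=; lra.
  have Im_ge0' (x : V) : 0 <= complex.Im (h p true (io x) (io x)).
    have := Im_ge0 p true (io x) (elem_valP x).
    rewrite form_ImE /pm mul1r hbar lecE => /andP[_].
    rewrite !(ReD, ImD, ReN, ImN, ReM, ImM, Reconj, Imconj) /=; lra.
  have comm2' (x : V) : cmod (B2 true x x) <= C * qnorm (braket ip) (sqrtS (io x)) ^+ 2.
    have := hC p true (io x) (elem_valP x).
    by rewrite commB2 normcmod (norm_qnorm hip) -rmorphXn -rmorphM lecR.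
  have [_ /(_ f)[Du Eu]] := rp p _ (resp lam mu mu0); rewrite -/z in Du Eu *.
  move: (op_inv _ f) Du Eu => u Du Eu.
  have [u0 u0E] := memG hip saT (D_sub_G _ Du).
  have [v0 v0E] := memG hip saT Gf0; have [v1 v1E] := memG hip saT Gf1.
  rewrite -u0E -v0E -v1E.
  apply: (limiting_absorption qP qC Wu gA fdV WVi (hB true) (dB true) (dB2 true)
    c1_ge0 (ltW C0) mu0 lam1 mourre' Im_comm' Im_ge0' comm2' Df).
  - by rewrite /= in v0E; rewrite /= v0E.
  - by rewrite /= in v1E; rewrite /= v1E.
  move=> g; rewrite /= in u0E; rewrite /on_dom /= u0E h_ext //; last exact: elem_valP.
  by rewrite -Eu (ipBr qP) (ipZr qP).
(* [K] does not depend on mu, so the threshold 1 is arbitrary. *)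
exists K, 1; split=> // p s lam mu f /andP[mu0 _] lam0 Df hf0 hf1 z.
have n0 := dual_norm_ge hip saT S_inj TT hf0.
have n1 := dual_norm_ge hip saT S_inj TT hf1.
have KE : K%:C * (`|op_inv sqrtS f| ^+ 2 + `|op_inv sqrtS (A f)| ^+ 2) =
    (K * (qnorm (braket ip) (op_inv sqrtS f) ^+ 2 +
         qnorm (braket ip) (op_inv sqrtS (A f)) ^+ 2))%:C.
  by rewrite !(norm_qnorm hip) -!rmorphXn -rmorphD -rmorphM.
rewrite KE normcmod !lecR.
have m := main p lam mu f mu0 lam0 Df hf0 hf1.
have third : K * (qnorm (braket ip) (op_inv sqrtS f) ^+ 2 +
         qnorm (braket ip) (op_inv sqrtS (A f)) ^+ 2) <=
    K * (dual_norm ip (dom sqrtS) (fun g => `|sqrtS g|) f ^+ 2 +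
         dual_norm ip (dom sqrtS) (fun g => `|sqrtS g|) (A f) ^+ 2).
  by apply: ler_wpM2l; [exact: ltW|rewrite !expr2; apply: lerD; apply: ler_pM].
have [rp1 _] := rp p _ (resp lam mu mu0).
have [rm1 rm2] := rm p _ (resp lam mu mu0).
case: s @z => z; split=> //.
- by rewrite /z /pm mul1r.
- by rewrite /z /pm mul1r.
- have -> : z = ((lam%:C - 'i * mu%:C)^*)%R.
    rewrite /z /pm; apply: complex_ext;
      by rewrite !(ReD, ImD, ReN, ImN, ReM, ImM, Reconj, Imconj) /=; ring.
  by [].
- have -> : z = ((lam%:C - 'i * mu%:C)^*)%R.
    rewrite /z /pm; apply: complex_ext;
      by rewrite !(ReD, ImD, ReN, ImN, ReM, ImM, Reconj, Imconj) /=; ring.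
  by rewrite rm2 cmod_conj.
Qed.
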